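(* For all nondeterministic expressions $E,F$ (possibly containing free variables): if $E = F$ is derivable from the axiom system described in the context, then $E \simeq F$ (weak congruence).
   Context: Fix a set $\mathsf{Act}$ of actions containing a distinguished internal action $\tau$, and a set $\mathsf{Var}$ of variables. Nondeterministic expressions $E$ and probabilistic expressions $P$ are generated by $E ::= 0 \mid X \mid \alpha.P \mid \mathrm{rec}\,X.E \mid E + E$ ($X \in \mathsf{Var}$, $\alpha \in \mathsf{Act}$) and $P ::= \partial(E) \mid P \oplus_p P$ ($0<p<1$). We write $\alpha.E$ for $\alpha.\partial(E)$. $\mathrm{rec}\,X$ binds $X$; an expression is closed if it has no free variables; $E[\vec F/\vec X]$ is simultaneous capture-avoiding substitution. $\sum_{i\in I} E_i$ denotes an iterated $+$; for probabilistic expressions $P_i$ and $p_i>0$ with $\sum_i p_i=1$, $\bigoplus_{i\in I} p_i P_i$ denotes an iterated $\oplus$ with weights chosen so that $P_i$ gets probability $p_i$, and $\bigoplus_{i} p_i E_i$ abbreviates $\bigoplus_i p_i \partial(E_i)$. A subdistribution over a set $S$ is $\mu:S\to\mathbb R_{\ge0}$ with $|\mu|:=\sum_s\mu(s)\le 1$; it is a distribution if $|\mu|=1$; $\delta_s$ is the Dirac distribution, $\emptyset$ the empty subdistribution; sums, differences, scalar multiples and $\le$ are pointwise. Operational semantics: $P\mapsto\mu$ and $E\xrightarrow{\alpha}\mu$ (with $\mu$ a distribution over expressions) are the least relations with: $\partial(E)\mapsto\delta_E$; if $P\mapsto\mu$ and $Q\mapsto\nu$ then $P\oplus_pQ\mapsto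 p\mu+(1-p)\nu$; if $P\mapsto\mu$ then $\alpha.P\xrightarrow{\alpha}\mu$; if $E[\mathrm{rec}\,X.E/X]\xrightarrow{\alpha}\mu$ then $\mathrm{rec}\,X.E\xrightarrow{\alpha}\mu$; if $E\xrightarrow{\alpha}\mu$ then $E+F\xrightarrow{\alpha}\mu$ and $F+E\xrightarrow{\alpha}\mu$. Combined transitions between subdistributions: the least relation with $\delta_E\xrightarrow{\alpha}\mu$ whenever $E\xrightarrow{\alpha}\mu$, and $\sum_i p_i\nu_i\xrightarrow{\alpha}\sum_ip_i\mu_i$ whenever $\nu_i\xrightarrow{\alpha}\mu_i$ for all $i\in I$ and $p_i\ge0$, $\sum_ip_i\le1$. A derivation is a sequence $(\mu_i^{\to},\mu_i^{\times})_{i\in\mathbb N}$ of subdistributions with $\mu_i^{\to}\xrightarrow{\tau}\mu_{i+1}^{\to}+\mu_{i+1}^{\times}$ (combined) for all $i$; $\mu\Rightarrow\nu$ iff there is a derivation with $\mu=\mu_0^{\to}+\mu_0^{\times}$ and $\nu=\sum_i\mu_i^{\times}$. $\mu\xRightarrow{\alpha}\nu$ means $\mu\Rightarrow\rho\xrightarrow{\alpha}\eta\Rightarrow\nu$ for some $\rho,\eta$; $\xRightarrow{\hat\alpha}$ is $\Rightarrow$ if $\alpha=\tau$ and $\xRightarrow{\alpha}$ otherwise. For an expression $E$, $E\Rightarrow\mu$ means $\delta_E\Rightarrow\mu$, etc. A relation $\mathcal R$ on expressions is lifted to subdistributions as the least relation with $\delta_E\,\mathcal R\,\delta_F$ whenever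 $E\mathcal RF$, closed under $\sum_ip_i\mu_i\,\mathcal R\,\sum_ip_i\nu_i$ when $\mu_i\mathcal R\nu_i$, $p_i\ge0$, $\sum p_i\le1$. A weak bisimulation is a relation $\mathcal R$ on closed expressions such that for $(E,F)\in\mathcal R$: if $E\xrightarrow{\alpha}\mu$ then $F\xRightarrow{\hat\alpha}\nu$ with $\mu\mathcal R\nu$, and if $F\xrightarrow{\alpha}\nu$ then $E\xRightarrow{\hat\alpha}\mu$ with $\mu\mathcal R\nu$; $E\approx F$ iff some weak bisimulation relates them. Closed $E,F$ are weakly congruent, $E\simeq F$, iff $E\xrightarrow{\alpha}\mu$ implies $F\xRightarrow{\alpha}\nu$ with $\mu\approx\nu$ (lifted), and $F\xrightarrow{\alpha}\nu$ implies $E\xRightarrow{\alpha}\mu$ with $\mu\approx\nu$. For expressions with free variables $\vec X$, $E\simeq F$ iff $E[\vec G/\vec X]\simeq F[\vec G/\vec X]$ for all closed $\vec G$. Probabilistic unguardedness: $E \rhd V$ (for $V\subseteq\mathsf{Var}$, also for probabilistic expressions) is the least relation with: $X\rhd\{X\}$; $\tau.P\rhd V$ if $P\rhd V$; $\mathrm{rec}\,X.E\rhd V\setminus\{X\}$ if $E\rhd V$ and $V\neq\{X\}$; $E+F\rhd V$ if $E\rhd V$; $E+F\rhd W$ if $F\rhd W$; $\partial(E)\rhd V$ if $E\rhd V$; $P\oplus_pQ\rhd V\cup W$ if $P\rhd V$ and $Q\rhd W$. $X$ is unguarded in $E$ ($E\rhd X$) iff $E\rhd\{X\}$, guarded otherwise.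 Provable equality $=$ is the least relation on expressions (of both categories) that is an equivalence, a congruence for all operators, allows renaming of bound variables, contains all instances of the axioms below, and is closed under rule R2: N1 $E+F=F+E$; N2 $E+(F+G)=(E+F)+G$; N3 $E+E=E$; N4 $E+0=E$; P1 $P\oplus_pQ=Q\oplus_{1-p}P$; P2 $P\oplus_p(Q\oplus_{q/(1-p)}R)=(P\oplus_{p/(p+q)}Q)\oplus_{p+q}R$; P3 $P\oplus_pP=P$; T1 $\alpha.(\partial(\tau.\partial(E))\oplus_pP)=\alpha.(\partial(E)\oplus_pP)$; T2 $\tau.\bigoplus_{i\in I}p_i(E_i+F)+F=\tau.\bigoplus_{i\in I}p_i(E_i+F)$; T3 $\tau.\bigoplus_{i}p_i(E_i+\alpha.P_i)+\alpha.\bigoplus_ip_iP_i=\tau.\bigoplus_ip_i(E_i+\alpha.P_i)$; T4 $\alpha.\bigoplus_ip_i(E_i+\tau.P_i)+\alpha.\bigoplus_ip_iP_i=\alpha.\bigoplus_ip_i(E_i+\tau.P_i)$; C $\alpha.P+\alpha.Q=\alpha.P+\alpha.(P\oplus_pQ)+\alpha.Q$; R1 $\mathrm{rec}\,X.E=E[\mathrm{rec}\,X.E/X]$; R2 if $F=E[F/X]$ and not $E\rhd X$, then $F=\mathrm{rec}\,X.E$; R3 $\mathrm{rec}\,X.(\tau.(\partial(X+E)\oplus_pP)+F)=\mathrm{rec}\,X.(\tau.(\partial(X+E)\oplus_pP)+\tau.P+F)$; R4 $\mathrm{rec}\,X.(X+E)=\mathrm{rec}\,X.E$; R5 $\mathrm{rec}\,X.(\tau.\partial(X)+E)=\mathrm{rec}\,X.\tau.\partial(E)$;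 R6 $\mathrm{rec}\,X.(\tau.\bigoplus_{i\in I}p_i(X+E_i)+F)=\mathrm{rec}\,X.(\tau.\partial(X)+\sum_{i\in I}E_i+F)$. *)

(* Defs.v *)
From Stdlib Require Import Reals List Arith ClassicalEpsilon.
Import ListNotations.
Set Implicit Arguments.
Unset Strict Implicit.

Open Scope R_scope.

Record prob := Prob { pval : R ; pval_range : 0 < pval < 1 }.

Section Calculus.
Variable Act : Type.

(* Syntax. Variables are de Bruijn indices: [Var n]; [Rec E] binds index 0
   in E (i.e. rec X.E with X the innermost bound variable). *)
Inductive NE : Type :=
| Nil : NE
| Var : nat -> NE
| Pre : Act -> PE -> NE
| Rec : NE -> NE
| Sum : NE -> NE -> NE
with PE : Type :=
| Dirac : NE -> PE
| PCh : prob -> PE -> PE -> PE.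

Definition upren (r : nat -> nat) (n : nat) : nat :=
  match n with O => O | S m => S (r m) end.

Fixpoint renN (r : nat -> nat) (E : NE) {struct E} : NE :=
  match E with
  | Nil => Nil
  | Var n => Var (r n)
  | Pre a P => Pre a (renP r P)
  | Rec E1 => Rec (renN (upren r) E1)
  | Sum E1 E2 => Sum (renN r E1) (renN r E2)
  end
with renP (r : nat -> nat) (P : PE) {struct P} : PE :=
  match P with
  | Dirac E1 => Dirac (renN r E1)
  | PCh p P1 P2 => PCh p (renP r P1) (renP r P2)
  end.

Definition upsub (s : nat -> NE) (n : nat) : NE :=
  match n with O => Var O | S m => renN S (s m) end.

Fixpoint substN (s : nat -> NE) (E : NE) {struct E} : NE :=
  match E with
  | Nil => Nil
  | Var n => s n
  | Pre a P => Pre a (substP s P)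
  | Rec E1 => Rec (substN (upsub s) E1)
  | Sum E1 E2 => Sum (substN s E1) (substN s E2)
  end
with substP (s : nat -> NE) (P : PE) {struct P} : PE :=
  match P with
  | Dirac E1 => Dirac (substN s E1)
  | PCh p P1 P2 => PCh p (substP s P1) (substP s P2)
  end.

Definition scons (x : NE) (s : nat -> NE) (n : nat) : NE :=
  match n with O => x | S m => s m end.

Definition inst (E F : NE) : NE := substN (scons F Var) E.

Fixpoint closedN (k : nat) (E : NE) {struct E} : Prop :=
  match E with
  | Nil => True
  | Var n => (n < k)%nat
  | Pre _ P => closedP k P
  | Rec E1 => closedN (S k) E1
  | Sum E1 E2 => closedN k E1 /\ closedN k E2
  end
with closedP (k : nat) (P : PE) {struct P} : Prop :=
  match P with
  | Dirac E1 => closedN k E1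
  | PCh _ P1 P2 => closedP k P1 /\ closedP k P2
  end.

Definition closed (E : NE) : Prop := closedN 0 E.

Variable tau : Act.

(* Probabilistic unguardedness  E |> V  (V a finite set of variables,
   represented by a list; set equality is extensional membership). *)
Definition is_singleton (V : list nat) (x : nat) : Prop :=
  forall y, In y V <-> y = x.

Inductive ugN : NE -> list nat -> Prop :=
| ug_var n : ugN (Var n) [n]
| ug_tau P V : ugP P V -> ugN (Pre tau P) V
| ug_rec E V : ugN E V -> ~ is_singleton V 0 ->
    ugN (Rec E) (map pred (filter (fun x => negb (Nat.eqb x 0)) V))
| ug_suml E F V : ugN E V -> ugN (Sum E F) V
| ug_sumr E F W : ugN F W -> ugN (Sum E F) W
with ugP : PE -> list nat -> Prop :=
| ug_dirac E V : ugN E V -> ugP (Dirac E) V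
| ug_pch p P Q V W : ugP P V -> ugP Q W -> ugP (PCh p P Q) (V ++ W).

Definition unguarded (E : NE) (n : nat) : Prop :=
  exists V, ugN E V /\ is_singleton V n.

(* Iterated probabilistic choice: [wsum l Q] means Q is an iterated (+)
   (in some bracketing) of the expressions of l, the i-th one receiving
   overall probability equal to its weight in l. *)
Definition wscale (c : R) (x : R * PE) : R * PE := (c * fst x, snd x).

Inductive wsum : list (R * PE) -> PE -> Prop :=
| ws_leaf P : wsum [(1, P)] P
| ws_node p l1 l2 Q1 Q2 :
    wsum l1 Q1 -> wsum l2 Q2 ->
    wsum (map (wscale (pval p)) l1 ++ map (wscale (1 - pval p)) l2) (PCh p Q1 Q2).

Fixpoint nsum (l : list NE) : NE :=
  match l with
  | [] => Nil
  | [E] => E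
  | E :: l' => Sum E (nsum l')
  end.


Inductive eqN : NE -> NE -> Prop :=
| eqN_refl E : eqN E E
| eqN_sym E F : eqN E F -> eqN F E
| eqN_trans E F G : eqN E F -> eqN F G -> eqN E G
| eqN_pre a P Q : eqP P Q -> eqN (Pre a P) (Pre a Q)
| eqN_rec E F : eqN E F -> eqN (Rec E) (Rec F)
| eqN_sum E E' F F' : eqN E E' -> eqN F F' -> eqN (Sum E F) (Sum E' F')
| ax_N1 E F : eqN (Sum E F) (Sum F E)
| ax_N2 E F G : eqN (Sum E (Sum F G)) (Sum (Sum E F) G)
| ax_N3 E : eqN (Sum E E) E
| ax_N4 E : eqN (Sum E Nil) E
| ax_T1 a E p P :
    eqN (Pre a (PCh p (Dirac (Pre tau (Dirac E))) P)) (Pre a (PCh p (Dirac E) P))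
| ax_T2 (ws : list (R * NE)) F Q :
    wsum (map (fun x => (fst x, Dirac (Sum (snd x) F))) ws) Q ->
    eqN (Sum (Pre tau Q) F) (Pre tau Q)
| ax_T3 (ws : list (R * (NE * PE))) a Q1 Q2 :
    wsum (map (fun x => (fst x, Dirac (Sum (fst (snd x)) (Pre a (snd (snd x)))))) ws) Q1 ->
    wsum (map (fun x => (fst x, snd (snd x))) ws) Q2 ->
    eqN (Sum (Pre tau Q1) (Pre a Q2)) (Pre tau Q1)
| ax_T4 (ws : list (R * (NE * PE))) a Q1 Q2 :
    wsum (map (fun x => (fst x, Dirac (Sum (fst (snd x)) (Pre tau (snd (snd x)))))) ws) Q1 ->
    wsum (map (fun x => (fst x, snd (snd x))) ws) Q2 ->
    eqN (Sum (Pre a Q1) (Pre a Q2)) (Pre a Q1)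
| ax_C a P Q p :
    eqN (Sum (Pre a P) (Pre a Q)) (Sum (Sum (Pre a P) (Pre a (PCh p P Q))) (Pre a Q))
| ax_R1 E : eqN (Rec E) (inst E (Rec E))
| rule_R2 E F : eqN F (inst E F) -> ~ unguarded E 0 -> eqN F (Rec E)
| ax_R3 E p P F :
    eqN (Rec (Sum (Pre tau (PCh p (Dirac (Sum (Var 0) E)) P)) F))
        (Rec (Sum (Sum (Pre tau (PCh p (Dirac (Sum (Var 0) E)) P)) (Pre tau P)) F))
| ax_R4 E : eqN (Rec (Sum (Var 0) E)) (Rec E)
| ax_R5 E : eqN (Rec (Sum (Pre tau (Dirac (Var 0))) E)) (Rec (Pre tau (Dirac E)))
| ax_R6 (ws : list (R * NE)) F Q :
    wsum (map (fun x => (fst x, Dirac (Sum (Var 0) (snd x)))) ws) Q ->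
    eqN (Rec (Sum (Pre tau Q) F))
        (Rec (Sum (Sum (Pre tau (Dirac (Var 0))) (nsum (map snd ws))) F))
with eqP : PE -> PE -> Prop :=
| eqP_refl P : eqP P P
| eqP_sym P Q : eqP P Q -> eqP Q P
| eqP_trans P Q S : eqP P Q -> eqP Q S -> eqP P S
| eqP_dirac E F : eqN E F -> eqP (Dirac E) (Dirac F)
| eqP_pch p P P' Q Q' : eqP P P' -> eqP Q Q' -> eqP (PCh p P Q) (PCh p P' Q')
| ax_P1 p p' P Q : pval p' = 1 - pval p -> eqP (PCh p P Q) (PCh p' Q P)
| ax_P2 (p a b c : prob) (q : R) P Q S :
    pval a = q / (1 - pval p) -> pval b = pval p / (pval p + q) ->
    pval c = pval p + q ->
    eqP (PCh p P (PCh a Q S)) (PCh c (PCh b P Q) S)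
| ax_P3 p P : eqP (PCh p P P) P.

Definition dist := NE -> R.

Definition dirac (E : NE) : dist :=
  fun F => if excluded_middle_informative (F = E) then 1 else 0.

Fixpoint sum_list (mu : dist) (l : list NE) : R :=
  match l with [] => 0 | x :: l' => mu x + sum_list mu l' end.

Definition subdist (mu : dist) : Prop :=
  (forall s, 0 <= mu s) /\ (forall l, NoDup l -> sum_list mu l <= 1).

Inductive pstep : PE -> dist -> Prop :=
| ps_dirac E : pstep (Dirac E) (dirac E)
| ps_pch p P Q mu nu : pstep P mu -> pstep Q nu ->
    pstep (PCh p P Q) (fun s => pval p * mu s + (1 - pval p) * nu s).

Inductive nstep : NE -> Act -> dist -> Prop :=
| ns_pre a P mu : pstep P mu -> nstep (Pre a P) a mu
| ns_rec E a mu : nstep (inst E (Rec E)) a mu -> nstep (Rec E) a mu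
| ns_suml E F a mu : nstep E a mu -> nstep (Sum E F) a mu
| ns_sumr E F a mu : nstep E a mu -> nstep (Sum F E) a mu.

(* Countable convex combinations: index set N; indices with weight 0 are
   irrelevant (equivalently, absent from the index set). *)
Definition weights (p : nat -> R) : Prop :=
  (forall i, 0 <= p i) /\ (forall n, sum_f_R0 p n <= 1).

Definition is_comb (p : nat -> R) (mus : nat -> dist) (mu : dist) : Prop :=
  forall s, infinite_sum (fun i => p i * mus i s) (mu s).

Inductive ctrans : dist -> Act -> dist -> Prop :=
| ct_dirac E a mu : nstep E a mu -> ctrans (dirac E) a mu
| ct_comb a p nus mus nu mu :
    weights p ->
    (forall i, 0 < p i -> ctrans (nus i) a (mus i)) ->
    is_comb p nus nu -> is_comb p mus mu -> ctrans nu a mu.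

Definition derivation (mt mx : nat -> dist) : Prop :=
  (forall i, subdist (mt i) /\ subdist (mx i)) /\
  (forall i, ctrans (mt i) tau (fun s => mt (S i) s + mx (S i) s)).

Definition wtau (mu nu : dist) : Prop :=
  exists mt mx, derivation mt mx /\
    (forall s, mu s = mt O s + mx O s) /\
    (forall s, infinite_sum (fun i => mx i s) (nu s)).

Definition wtrans (mu : dist) (a : Act) (nu : dist) : Prop :=
  exists rho eta, wtau mu rho /\ ctrans rho a eta /\ wtau eta nu.

Definition whtrans (mu : dist) (a : Act) (nu : dist) : Prop :=
  (a = tau /\ wtau mu nu) \/ (a <> tau /\ wtrans mu a nu).

Inductive lift (Rl : NE -> NE -> Prop) : dist -> dist -> Prop :=
| lift_dirac E F : Rl E F -> lift Rl (dirac E) (dirac F)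
| lift_comb p mus nus mu nu :
    weights p ->
    (forall i, 0 < p i -> lift Rl (mus i) (nus i)) ->
    is_comb p mus mu -> is_comb p nus nu -> lift Rl mu nu.

Definition weak_bisim (Rl : NE -> NE -> Prop) : Prop :=
  forall E F, Rl E F ->
    closed E /\ closed F /\
    (forall a mu, nstep E a mu -> exists nu, whtrans (dirac F) a nu /\ lift Rl mu nu) /\
    (forall a nu, nstep F a nu -> exists mu, whtrans (dirac E) a mu /\ lift Rl mu nu).

Definition wbisimilar (E F : NE) : Prop :=
  exists Rl, weak_bisim Rl /\ Rl E F.

Definition wcong_closed (E F : NE) : Prop :=
  (forall a mu, nstep E a mu -> exists nu, wtrans (dirac F) a nu /\ lift wbisimilar mu nu) /\
  (forall a nu, nstep F a nu -> exists mu, wtrans (dirac E) a mu /\ lift wbisimilar mu nu).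

Definition wcong (E F : NE) : Prop :=
  forall s : nat -> NE, (forall n, closed (s n)) ->
    wcong_closed (substN s E) (substN s F).

End Calculus.

(* Main.v *)
From Stdlib Require Import Reals List Arith ClassicalEpsilon FunctionalExtensionality Lra Lia.
Require Import Defs.
Import ListNotations.
Set Implicit Arguments.
Unset Strict Implicit.
Open Scope R_scope.

(* Infinite derivations are replaced by expectations.  For f with values in [0,1], the supremum of
   the expectation of f over all mu with E => mu is the value at E of the least function V f above f
   that does not increase along tau-transitions, and weakv a f = V (best a-step of V f) is the
   corresponding supremum for E =a=> mu.  Two expressions are similar (fsim) if V f and weakv a f, for
   a <> tau, agree on them whenever f is invariant under similarity, and congruent (feq) if weakv a f
   agrees for all a.  Every axiom becomes an (in)equality between real numbers.

   Recursion: transitions of C[A] are transitions of the context C, or of A when the variable is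
   exposed in C.  A function on contexts that is superharmonic for the context transitions and
   controls the exposed ones therefore bounds the values of all C[A]; this gives Park induction for
   rec X.E, hence the congruence rule and R3-R6.  For R2, the difference between the values of two
   solutions of X = E is contracted by the probability of reaching an exposed X from E, which is
   less than 1 when X is guarded.

   Back to transitions: the expressions reachable from a given one form a finite set, so for every f
   the value is attained by one of finitely many memoryless policies (discounted values, discount
   tending to 1).  By Ville's theorem, a transition whose expectations are dominated by the values is
   matched by a convex combination of these policies, and equal masses of the similarity classes
   give the lifting. *)

(* The obstacle is that a weak transition is the limit of an infinite derivation, possibly with loss
   of mass, so building matching transitions directly for recursive expressions would mean splicing
   infinitely many derivations. A value is a least superharmonic function instead: to bound it from
   above, it is enough to exhibit one function and check it against single transitions. Restricting
   to functions invariant under similarity is what makes the method coinductive. Such functions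
   cannot separate expressions already identified, yet they include the indicators of the similarity
   classes, and these determine the lifted relation between finitely supported distributions. The
   way back needs two precautions. Without a discount, a policy that takes an optimal move
   everywhere may circle in a tau-loop and reach nothing; with a discount below 1 the part still
   moving becomes negligible. And the minimax step turns answers that depend on the test function
   into one answer for all of them, for which the answers must come from one finite set whose
   mixtures are again weak transitions. *)
Scheme NE_mut := Induction for NE Sort Prop
with PE_mut := Induction for PE Sort Prop.
Combined Scheme NE_PE_ind from NE_mut, PE_mut.

(** * Substitution *)

Section Syntax.
Variable Act : Type.
Local Notation NE := (NE Act).
Local Notation PE := (PE Act).
Implicit Types (E F : NE) (P Q : PE) (s t : nat -> NE).

Lemma upren_comp (r r' : nat -> nat) :
  (fun n => upren r (upren r' n)) = upren (fun n => r (r' n)).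
Proof. extensionality n; destruct n; reflexivity. Qed.

Lemma ren_ren :
  (forall E (r r' : nat -> nat), renN r (renN r' E) = renN (fun n => r (r' n)) E) /\
  (forall P (r r' : nat -> nat), renP r (renP r' P) = renP (fun n => r (r' n)) P).
Proof.
  apply NE_PE_ind; simpl; intros; f_equal; auto.
  rewrite H, upren_comp; reflexivity.
Qed.

Lemma upsub_upren s (r : nat -> nat) :
  (fun n => upsub s (upren r n)) = upsub (fun n => s (r n)).
Proof. extensionality n; destruct n; reflexivity. Qed.

Lemma subst_ren :
  (forall E s (r : nat -> nat), substN s (renN r E) = substN (fun n => s (r n)) E) /\
  (forall P s (r : nat -> nat), substP s (renP r P) = substP (fun n => s (r n)) P).
Proof.
  apply NE_PE_ind; simpl; intros; f_equal; auto.
  rewrite H, upsub_upren; reflexivity.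
Qed.

Lemma ren_upsub s (r : nat -> nat) :
  (fun n => renN (upren r) (upsub s n)) = upsub (fun n => renN r (s n)).
Proof.
  extensionality n; destruct n; simpl; [reflexivity|].
  rewrite !(proj1 ren_ren); reflexivity.
Qed.

Lemma ren_subst :
  (forall E (r : nat -> nat) s, renN r (substN s E) = substN (fun n => renN r (s n)) E) /\
  (forall P (r : nat -> nat) s, renP r (substP s P) = substP (fun n => renN r (s n)) P).
Proof.
  apply NE_PE_ind; simpl; intros; f_equal; auto.
  rewrite H, ren_upsub; reflexivity.
Qed.

Lemma upsub_comp s t :
  (fun n => substN (upsub s) (upsub t n)) = upsub (fun n => substN s (t n)).
Proof.
  extensionality n; destruct n; simpl; [reflexivity|].
  rewrite (proj1 subst_ren), (proj1 ren_subst); reflexivity.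
Qed.

Lemma subst_subst :
  (forall E s t, substN s (substN t E) = substN (fun n => substN s (t n)) E) /\
  (forall P s t, substP s (substP t P) = substP (fun n => substN s (t n)) P).
Proof.
  apply NE_PE_ind; simpl; intros; f_equal; auto.
  rewrite H, upsub_comp; reflexivity.
Qed.

Lemma upsub_Var : upsub (Var Act) = Var Act.
Proof. extensionality n; destruct n; reflexivity. Qed.

Lemma subst_Var :
  (forall E, substN (Var Act) E = E) /\ (forall P, substP (Var Act) P = P).
Proof.
  apply NE_PE_ind; simpl; intros; f_equal; auto.
  rewrite upsub_Var; assumption.
Qed.

Lemma substN_substN E s t : substN s (substN t E) = substN (fun n => substN s (t n)) E.
Proof. apply subst_subst. Qed.

Lemma substN_renN E s (r : nat -> nat) : substN s (renN r E) = substN (fun n => s (r n)) E.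
Proof. apply subst_ren. Qed.

Lemma inst_up E s F : inst (substN (upsub s) E) F = substN (scons F s) E.
Proof.
  unfold inst; rewrite substN_substN; f_equal; extensionality n.
  destruct n; simpl; [reflexivity|].
  rewrite substN_renN; apply (proj1 subst_Var).
Qed.

Lemma substN_inst E s F : substN s (inst E F) = inst (substN (upsub s) E) (substN s F).
Proof.
  rewrite inst_up; unfold inst; rewrite substN_substN; f_equal; extensionality n.
  destruct n; reflexivity.
Qed.

Lemma inst_renS E F : inst (renN S E) F = E.
Proof. unfold inst; rewrite substN_renN; apply (proj1 subst_Var). Qed.

Lemma closed_ren :
  (forall E j k (r : nat -> nat), closedN k E -> (forall n, (n < k)%nat -> (r n < j)%nat) ->
     closedN j (renN r E)) /\
  (forall P j k (r : nat -> nat), closedP k P -> (forall n, (n < k)%nat -> (r n < j)%nat) ->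
     closedP j (renP r P)).
Proof.
  apply NE_PE_ind; simpl; intros; auto; try (split; intuition eauto; fail).
  - eauto.
  - eapply H; eauto. intros [|m] Hm; simpl; [lia|]. apply -> Nat.succ_lt_mono. apply H1; lia.
  - eauto.
Qed.

Lemma closed_subst :
  (forall E j k s, closedN k E -> (forall n, (n < k)%nat -> closedN j (s n)) ->
     closedN j (substN s E)) /\
  (forall P j k s, closedP k P -> (forall n, (n < k)%nat -> closedN j (s n)) ->
     closedP j (substP s P)).
Proof.
  apply NE_PE_ind; simpl; intros; auto; try (split; intuition eauto; fail).
  - eauto.
  - eapply H; eauto. intros [|m] Hm; simpl; [lia|].
    eapply (proj1 closed_ren); [apply H1; lia|intros; lia].
  - eauto.
Qed.

Lemma closed_substN E s : (forall n, closed (s n)) -> closed (substN s E).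
Proof.
  revert E; assert (forall E k s, (forall n, closedN k (s n)) -> closedN k (substN s E)) as H.
  { intros E.
    apply (NE_mut (P := fun E => forall k s, (forall n, closedN k (s n)) -> closedN k (substN s E))
                  (P0 := fun P => forall k s, (forall n, closedN k (s n)) -> closedP k (substP s P)));
      simpl; intros; auto.
    apply H; intros [|m]; simpl; [lia|].
    eapply (proj1 closed_ren); eauto; intros; lia. }
  intros; apply H; assumption.
Qed.

End Syntax.

Ltac rmax := unfold Rmax in *; repeat destruct Rle_dec; try lra.

(** * Expectations and values *)

Section Infimum.

Definition capped (X : R -> Prop) (x : R) : Prop := x = 1 \/ (X x /\ 0 <= x).

Lemma capped_bound X : bound (fun x => capped X (- x)).
Proof. exists 0; intros x [H|[_ H]]; lra. Qed.

Lemma capped_inhabited X : exists x, capped X (- x).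
Proof. exists (-1); left; lra. Qed.

(* The infimum of the nonnegative elements of X, capped at 1 (so 1 if there are none). *)
Definition inf1 (X : R -> Prop) : R :=
  - proj1_sig (completeness _ (capped_bound X) (capped_inhabited X)).

Lemma inf1_lower X x : capped X x -> inf1 X <= x.
Proof.
  intro H; unfold inf1; destruct completeness as [m [Hm Hm']]; simpl; clear Hm'.
  assert (- x <= m) by (apply Hm; rewrite Ropp_involutive; assumption). lra.
Qed.

Lemma inf1_le1 X : inf1 X <= 1.
Proof. apply inf1_lower; left; reflexivity. Qed.

Lemma inf1_le X x : X x -> 0 <= x -> inf1 X <= x.
Proof. intros; apply inf1_lower; right; split; assumption. Qed.

Lemma inf1_glb X y : y <= 1 -> (forall x, X x -> 0 <= x -> y <= x) -> y <= inf1 X.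
Proof.
  intros H1 H; unfold inf1; destruct completeness as [m [Hm' Hm]]; simpl; clear Hm'.
  assert (m <= - y); [|lra].
  apply Hm; intros x [Hx|[Hx H0]]; [lra|]. specialize (H _ Hx H0); lra.
Qed.

Lemma inf1_ge0 X : 0 <= inf1 X.
Proof. apply inf1_glb; [lra|auto]. Qed.

End Infimum.

Definition wcons (x : R) (w : nat -> R) (n : nat) : R :=
  match n with O => x | S m => w m end.

Section Values.
Variable Act : Type.
Local Notation NE := (NE Act).
Local Notation PE := (PE Act).
Implicit Types (E F C D K : NE) (P Q : PE) (s t : nat -> NE) (a b : Act)
  (f g h : NE -> R) (w : nat -> R).

Fixpoint expect P f {struct P} : R :=
  match P with
  | Dirac E => f E
  | PCh p P1 P2 => pval p * expect P1 f + (1 - pval p) * expect P2 f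
  end.

Lemma expect_lin P h f g d : (forall D, h D <= f D + d * g D) ->
  expect P h <= expect P f + d * expect P g.
Proof.
  intro H; induction P as [E|p P1 IH1 P2 IH2]; simpl; [apply H|].
  destruct (pval_range p); nra.
Qed.

Lemma expect_mono P f g : (forall D, f D <= g D) -> expect P f <= expect P g.
Proof.
  intro H; pose proof (expect_lin P (h := f) (f := g) (g := g) (d := 0)).
  assert (forall D, f D <= g D + 0 * g D) as H1 by (intro D; specialize (H D); lra).
  specialize (H0 H1); lra.
Qed.

Lemma expect_const P x : expect P (fun _ => x) = x.
Proof. induction P; simpl; [reflexivity|]. rewrite IHP1, IHP2; ring. Qed.

Lemma expect_bounds P f x y : (forall D, x <= f D <= y) -> x <= expect P f <= y.
Proof.
  intro H; rewrite <- (expect_const P x), <- (expect_const P y) at 1.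
  split; apply expect_mono; apply H.
Qed.

Lemma expect_subst P s f : expect (substP s P) f = expect P (fun D => f (substN s D)).
Proof. induction P; simpl; congruence. Qed.

Lemma expect_ren P (r : nat -> nat) f : expect (renP r P) f = expect P (fun D => f (renN r D)).
Proof. induction P; simpl; congruence. Qed.

(* The best expectation of f after one a-transition, and 0 if there is none.  All transitions
   of Rec E are transitions of E with Rec E substituted, hence the structural recursion. *)
Fixpoint stepv a E f {struct E} : R :=
  match E with
  | Nil _ => 0
  | Var _ _ => 0
  | Pre b P => if excluded_middle_informative (a = b) then expect P f else 0
  | Rec E1 => stepv a E1 (fun D => f (inst D (Rec E1)))
  | Sum E1 E2 => Rmax (stepv a E1 f) (stepv a E2 f)
  end.

(* The largest weight of a variable that occurs in E outside all prefixes. *)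
Fixpoint expo E w {struct E} : R :=
  match E with
  | Nil _ => 0
  | Var _ n => w n
  | Pre _ _ => 0
  | Rec E1 => expo E1 (wcons 0 w)
  | Sum E1 E2 => Rmax (expo E1 w) (expo E2 w)
  end.

(** A maximum is only sublinear, so linearity survives as an inequality with [d >= 0]. The case
    [d = 0] gives monotonicity; the [d]-term carries the error in the contraction argument for
    R2. *)
Lemma stepv_lin a E h f g d : 0 <= d -> (forall D, h D <= f D + d * g D) ->
  stepv a E h <= stepv a E f + d * stepv a E g.
Proof.
  intros Hd; revert h f g.
  apply (NE_mut (P := fun E => forall h f g, (forall D, h D <= f D + d * g D) ->
    stepv a E h <= stepv a E f + d * stepv a E g) (P0 := fun _ => True)); simpl; intros; auto; try lra.
  - destruct excluded_middle_informative; [|lra]. apply expect_lin; assumption.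
  - specialize (H h f g H1); specialize (H0 h f g H1).
    apply Rmax_lub; eapply Rle_trans; try eassumption; apply Rplus_le_compat;
      try apply Rmult_le_compat_l; auto using Rmax_l, Rmax_r.
Qed.

Lemma stepv_mono a E f g : (forall D, f D <= g D) -> stepv a E f <= stepv a E g.
Proof.
  intro H; pose proof (@stepv_lin a E f g g 0 (Rle_refl 0)).
  assert (forall D, f D <= g D + 0 * g D) as H1 by (intro D; specialize (H D); lra).
  specialize (H0 H1); lra.
Qed.

Lemma stepv_bounds a E f : (forall D, 0 <= f D <= 1) -> 0 <= stepv a E f <= 1.
Proof.
  revert f; apply (NE_mut (P := fun E => forall f, (forall D, 0 <= f D <= 1) -> 0 <= stepv a E f <= 1)
    (P0 := fun _ => True)); simpl; intros; auto; try lra.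
  - destruct excluded_middle_informative; [|lra]. apply expect_bounds; assumption.
  - specialize (H f H1); specialize (H0 f H1); rmax.
Qed.

Lemma stepv_ge0 a E f : (forall D, 0 <= f D) -> 0 <= stepv a E f.
Proof.
  revert f; apply (NE_mut (P := fun E => forall f, (forall D, 0 <= f D) -> 0 <= stepv a E f)
    (P0 := fun _ => True)); simpl; intros; auto; try lra.
  - destruct excluded_middle_informative; [|lra].
    rewrite <- (expect_const p 0); apply expect_mono; assumption.
  - specialize (H f H1); specialize (H0 f H1); rmax.
Qed.

Lemma expo_lin E w w1 w2 d : 0 <= d -> (forall n, w n <= w1 n + d * w2 n) ->
  expo E w <= expo E w1 + d * expo E w2.
Proof.
  intros Hd; revert w w1 w2.
  apply (NE_mut (P := fun E => forall w w1 w2, (forall n, w n <= w1 n + d * w2 n) ->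
    expo E w <= expo E w1 + d * expo E w2) (P0 := fun _ => True)); simpl; intros; auto; try lra.
  - apply H; intros [|m]; simpl; [lra|auto].
  - specialize (H _ _ _ H1); specialize (H0 _ _ _ H1).
    apply Rmax_lub; eapply Rle_trans; try eassumption; apply Rplus_le_compat;
      try apply Rmult_le_compat_l; auto using Rmax_l, Rmax_r.
Qed.

Lemma expo_mono E w w' : (forall n, w n <= w' n) -> expo E w <= expo E w'.
Proof.
  intro H; pose proof (@expo_lin E w w' w' 0 (Rle_refl 0)).
  assert (forall n, w n <= w' n + 0 * w' n) as H1 by (intro n; specialize (H n); lra).
  specialize (H0 H1); lra.
Qed.

Lemma expo_bounds E w : (forall n, 0 <= w n <= 1) -> 0 <= expo E w <= 1.
Proof.
  revert w; apply (NE_mut (P := fun E => forall w, (forall n, 0 <= w n <= 1) -> 0 <= expo E w <= 1)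
    (P0 := fun _ => True)); simpl; intros; auto; try lra.
  - apply H; intros [|m]; simpl; [lra|auto].
  - specialize (H _ H1); specialize (H0 _ H1); rmax.
Qed.

Lemma expo_le E w x : 0 <= x -> (forall n, w n <= x) -> expo E w <= x.
Proof.
  intro Hx; revert w.
  apply (NE_mut (P := fun E => forall w, (forall n, w n <= x) -> expo E w <= x)
    (P0 := fun _ => True)); simpl; intros; auto.
  - apply H; intros [|m]; simpl; auto.
  - apply Rmax_lub; auto.
Qed.

Lemma expo_max E w w' :
  expo E (fun n => Rmax (w n) (w' n)) <= Rmax (expo E w) (expo E w').
Proof.
  revert w w'; apply (NE_mut (P := fun E => forall w w',
    expo E (fun n => Rmax (w n) (w' n)) <= Rmax (expo E w) (expo E w'))
    (P0 := fun _ => True)); simpl; intros; auto; try (rmax; fail).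
  - eapply Rle_trans; [|apply H]. apply expo_mono; intros [|m]; simpl; rmax.
  - specialize (H w w'); specialize (H0 w w'); rmax.
Qed.

Lemma expo_ren E w (r : nat -> nat) : expo (renN r E) w = expo E (fun n => w (r n)).
Proof.
  revert w r; apply (NE_mut (P := fun E => forall w (r : nat -> nat),
    expo (renN r E) w = expo E (fun n => w (r n)))
    (P0 := fun _ => True)); simpl; intros; auto.
  - rewrite H; f_equal; extensionality m; destruct m; reflexivity.
  - rewrite H, H0; reflexivity.
Qed.

Lemma expo_subst E w s : expo (substN s E) w = expo E (fun n => expo (s n) w).
Proof.
  revert w s; apply (NE_mut (P := fun E => forall w s,
    expo (substN s E) w = expo E (fun n => expo (s n) w))
    (P0 := fun _ => True)); simpl; intros; auto.
  - rewrite H; f_equal; extensionality m; destruct m; simpl; [reflexivity|].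
    rewrite expo_ren; reflexivity.
  - rewrite H, H0; reflexivity.
Qed.

Lemma renN_inst (r : nat -> nat) D K : renN r (inst D K) = inst (renN (upren r) D) (renN r K).
Proof.
  unfold inst; rewrite (proj1 (ren_subst Act)), substN_renN; f_equal; extensionality n.
  destruct n; reflexivity.
Qed.

Lemma stepv_ren a E (r : nat -> nat) f :
  stepv a (renN r E) f = stepv a E (fun D => f (renN r D)).
Proof.
  revert r f; apply (NE_mut (P := fun E => forall (r : nat -> nat) f,
    stepv a (renN r E) f = stepv a E (fun D => f (renN r D)))
    (P0 := fun _ => True)); simpl; intros; auto.
  - destruct excluded_middle_informative; [apply expect_ren|reflexivity].
  - rewrite H; f_equal; extensionality D; rewrite renN_inst; reflexivity.
  - rewrite H, H0; reflexivity.
Qed.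

(** A move of the instance is either a move of the context or a move of the expression put for an
    exposed variable. Nonnegativity of [f] makes the value 0 of an absent move neutral for the
    maximum. *)
Lemma stepv_subst a C s f : (forall D, 0 <= f D) ->
  stepv a (substN s C) f =
  Rmax (stepv a C (fun D => f (substN s D))) (expo C (fun n => stepv a (s n) f)).
Proof.
  revert s f; apply (NE_mut (P := fun C => forall s f, (forall D, 0 <= f D) ->
    stepv a (substN s C) f =
    Rmax (stepv a C (fun D => f (substN s D))) (expo C (fun n => stepv a (s n) f)))
    (P0 := fun _ => True)); simpl; intros; auto.
  - rmax.
  - rewrite Rmax_right; [reflexivity|apply stepv_ge0; assumption].
  - destruct excluded_middle_informative; [|rmax].
    rewrite expect_subst, Rmax_left; [reflexivity|].
    rewrite <- (expect_const p 0); apply expect_mono; auto.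
  - rewrite H by auto. f_equal; f_equal; extensionality D.
    + f_equal; symmetry; apply substN_inst.
    + destruct D; simpl; [reflexivity|].
      rewrite stepv_ren; f_equal; extensionality D'. rewrite inst_renS; reflexivity.
  - rewrite H, H0 by assumption; rmax.
Qed.

(** Justifies the structural recursion in [stepv]: after unfolding, an exposed occurrence of the
    bound variable contributes only the moves of [Rec E] itself, which are already counted. *)
Lemma stepv_rec a E f : (forall D, 0 <= f D) -> stepv a (Rec E) f = stepv a (inst E (Rec E)) f.
Proof.
  intro Hf; unfold inst at 1; rewrite stepv_subst by assumption; cbn [stepv].
  symmetry; apply Rmax_left, expo_le; [apply stepv_ge0; auto|].
  intros [|n]; simpl; [lra|apply stepv_ge0; auto].
Qed.

End Values.

(** * Weak values and functional similarity *)

Section Similarity.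
Variable Act : Type.
Variable tau : Act.
Local Notation NE := (NE Act).
Local Notation PE := (PE Act).
Implicit Types (E F G H C D K : NE) (P Q : PE) (s t : nat -> NE) (a b : Act)
  (f g h U : NE -> R) (w : nat -> R).

Definition range01 f : Prop := forall D, 0 <= f D <= 1.

Definition superh (lam : R) f U : Prop :=
  forall D, f D <= U D /\ lam * stepv tau D U <= U D.

(* For lam = 1, the supremum of the expectations of f over the distributions weakly reachable from E
   by tau-steps; lam < 1 discounts each step. *)
Definition tauv (lam : R) f E : R := inf1 (fun x => exists U, superh lam f U /\ x = U E).

Lemma tauv_bounds lam f : range01 (tauv lam f).
Proof. intro D; split; [apply inf1_ge0|apply inf1_le1]. Qed.

Lemma tauv_least lam f U E : range01 f -> superh lam f U -> tauv lam f E <= U E.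
Proof.
  intros Hf HU; apply inf1_le; [eauto|].
  destruct (Hf E), (HU E); lra.
Qed.

Lemma tauv_ge lam f E : range01 f -> f E <= tauv lam f E.
Proof.
  intro Hf; apply inf1_glb; [apply Hf|]. intros x [U [HU ->]] _; apply HU.
Qed.

Lemma stepv_range01 a f : range01 f -> range01 (fun D => stepv a D f).
Proof. intros Hf D; apply stepv_bounds; exact Hf. Qed.

Lemma tauv_super lam f E : 0 <= lam <= 1 -> range01 f ->
  lam * stepv tau E (tauv lam f) <= tauv lam f E.
Proof.
  intros Hl Hf; apply inf1_glb.
  - destruct (stepv_range01 tau (tauv_bounds lam f) E); nra.
  - intros x [U [HU ->]] _. eapply Rle_trans; [|apply HU].
    apply Rmult_le_compat_l; [apply Hl|].
    apply stepv_mono; intro D; apply tauv_least; assumption.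
Qed.

(** As in the Knaster-Tarski theorem: the right-hand side is itself a superharmonic majorant of [f],
    so the least one cannot exceed it. *)
Lemma tauv_fix lam f E : 0 <= lam <= 1 -> range01 f ->
  tauv lam f E = Rmax (f E) (lam * stepv tau E (tauv lam f)).
Proof.
  intros Hl Hf.
  assert (Hle : forall D, Rmax (f D) (lam * stepv tau D (tauv lam f)) <= tauv lam f D).
  { intro D; apply Rmax_lub; [apply tauv_ge|apply tauv_super]; assumption. }
  apply Rle_antisym; [|apply Hle].
  apply (@tauv_least lam f (fun D => Rmax (f D) (lam * stepv tau D (tauv lam f)))); [assumption|].
  intro D; split; [apply Rmax_l|].
  eapply Rle_trans; [|apply Rmax_r].
  apply Rmult_le_compat_l; [apply Hl|]. apply stepv_mono, Hle.
Qed.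

Lemma tauv_mono lam lam' f g E : 0 <= lam <= lam' -> lam' <= 1 -> range01 f -> range01 g ->
  (forall D, f D <= g D) -> tauv lam f E <= tauv lam' g E.
Proof.
  intros Hl Hl' Hf Hg H; apply tauv_least; [assumption|].
  intro D; split.
  - eapply Rle_trans; [apply H|apply tauv_ge; assumption].
  - eapply Rle_trans; [|apply tauv_super; [lra|assumption]].
    apply Rmult_le_compat_r; [|lra].
    apply (stepv_range01 tau (tauv_bounds lam' g)).
Qed.

Notation V := (tauv 1).

(** The inner [V f] accounts for the tau-steps after the a-step, the outer [V] for those before
    it. *)
Definition weakv a f : NE -> R := V (fun D => stepv a D (V f)).

Lemma weakv_bounds a f : range01 (weakv a f).
Proof. apply tauv_bounds. Qed.

Lemma one_disc : 0 <= 1 <= 1.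
Proof. lra. Qed.

Lemma weakv_fix a f E : range01 f ->
  weakv a f E = Rmax (stepv a E (V f)) (stepv tau E (weakv a f)).
Proof.
  intro Hf; unfold weakv at 1; rewrite (tauv_fix _ one_disc), Rmult_1_l; [reflexivity|].
  apply stepv_range01, tauv_bounds.
Qed.

Lemma V_super f E : range01 f -> stepv tau E (V f) <= V f E.
Proof. intro; rewrite <- Rmult_1_l at 1; apply tauv_super; [lra|assumption]. Qed.

(** For tau the leading steps are absorbed: [V f] does not increase along tau-moves, so the first
    tau-step may be taken as the obligatory one. *)
Lemma weakv_tau f E : range01 f -> weakv tau f E = stepv tau E (V f).
Proof.
  intro Hf; apply Rle_antisym.
  - unfold weakv; apply (@tauv_least 1 _ (fun D => stepv tau D (V f))).
    + apply stepv_range01, tauv_bounds.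
    + intro D; split; [lra|]. rewrite Rmult_1_l.
      apply stepv_mono; intro D'; apply V_super; assumption.
  - rewrite weakv_fix by assumption; apply Rmax_l.
Qed.

Lemma V_fix f E : range01 f -> V f E = Rmax (f E) (weakv tau f E).
Proof. intro; rewrite weakv_tau, (tauv_fix _ one_disc), Rmult_1_l by assumption; reflexivity. Qed.

Lemma weakv_le_V f E : range01 f -> weakv tau f E <= V f E.
Proof. intro; rewrite V_fix by assumption; apply Rmax_r. Qed.

Lemma weakv_super a f E : range01 f -> stepv tau E (weakv a f) <= weakv a f E.
Proof. intro; rewrite (@weakv_fix a f E) by assumption; apply Rmax_r. Qed.

Lemma stepv_le_weakv a f E : range01 f -> stepv a E (V f) <= weakv a f E.
Proof. intro; rewrite (@weakv_fix a f E) by assumption; apply Rmax_l. Qed.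

Lemma weakv_ge0 a f E : 0 <= weakv a f E.
Proof. apply weakv_bounds. Qed.

Lemma V_ge0 f E : 0 <= V f E.
Proof. apply tauv_bounds. Qed.

Lemma weakv_nil a f : range01 f -> weakv a f (Nil Act) = 0.
Proof. intro; rewrite weakv_fix by assumption; simpl; rmax. Qed.

Lemma weakv_sum a f E F : range01 f -> weakv a f (Sum E F) = Rmax (weakv a f E) (weakv a f F).
Proof.
  intro; rewrite (@weakv_fix a f (Sum E F)), (@weakv_fix a f E), (@weakv_fix a f F) by assumption.
  simpl; rmax.
Qed.

Lemma weakv_rec a f E : range01 f -> weakv a f (Rec E) = weakv a f (inst E (Rec E)).
Proof.
  intro; rewrite (@weakv_fix a f (Rec E)), (@weakv_fix a f (inst E (Rec E))) by assumption.
  rewrite !(@stepv_rec _ _ E) by (intro; (apply V_ge0 || apply weakv_ge0)); reflexivity.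
Qed.

(* The function whose expectation over P is the value of the prefix b.P for weak a-transitions. *)
Definition prev a b f D : R :=
  if excluded_middle_informative (b = a) then V f D
  else if excluded_middle_informative (b = tau) then weakv a f D else 0.

Lemma weakv_pre a b f P : range01 f -> weakv a f (Pre b P) = expect P (prev a b f).
Proof.
  intro Hf; rewrite weakv_fix by assumption; simpl.
  assert (Hz : forall h, (forall D, 0 <= h D) -> 0 <= expect P h).
  { intros h Hh; rewrite <- (expect_const P 0); apply expect_mono; assumption. }
  destruct (excluded_middle_informative (b = a)) as [->|Hab].
  - replace (prev a a f) with (V f)
      by (extensionality D; unfold prev; destruct excluded_middle_informative; congruence).
    destruct (excluded_middle_informative (a = a)) as [_|]; [|congruence].
    destruct excluded_middle_informative as [<-|].
    + apply Rmax_left, expect_mono; intro; apply weakv_le_V; assumption.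
    + apply Rmax_left, Hz, V_ge0.
  - destruct (excluded_middle_informative (a = b)) as [->|_]; [congruence|].
    unfold prev; destruct (excluded_middle_informative (b = a)) as [|_]; [congruence|].
    destruct (excluded_middle_informative (tau = b)) as [<-|Hb].
    + destruct (excluded_middle_informative (tau = tau)) as [_|]; [|congruence].
      apply Rmax_right, Hz, weakv_ge0.
    + destruct excluded_middle_informative as [->|_]; [congruence|].
      rewrite expect_const; apply Rmax_left; lra.
Qed.

Lemma prev_same a f D : prev a a f D = V f D.
Proof. unfold prev; destruct excluded_middle_informative; congruence. Qed.

Lemma prev_ne a f D : a <> tau -> prev a tau f D = weakv a f D.
Proof. intro; unfold prev; repeat destruct excluded_middle_informative; congruence. Qed.

Lemma prev_other a b f D : b <> a -> b <> tau -> prev a b f D = 0.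
Proof. intros; unfold prev; repeat destruct excluded_middle_informative; congruence. Qed.

Lemma weakv_le_prev a f D : range01 f -> weakv a f D <= prev a tau f D.
Proof.
  intro; destruct (excluded_middle_informative (a = tau)) as [->|].
  - rewrite prev_same; apply weakv_le_V; assumption.
  - rewrite prev_ne by assumption; lra.
Qed.

(** An exposed variable lends the instance both the a-moves and the tau-moves of its value;
    [expo_max] separates the two kinds so that [stepv_subst] applies to each. *)
Lemma expo_weakv a f s C : range01 f -> expo C (fun n => weakv a f (s n)) <= weakv a f (substN s C).
Proof.
  intro Hf.
  apply Rle_trans with
    (expo C (fun n => Rmax (stepv a (s n) (V f)) (stepv tau (s n) (weakv a f)))).
  { apply expo_mono; intro; rewrite <- weakv_fix by assumption; lra. }
  eapply Rle_trans; [apply expo_max|].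
  rewrite (@weakv_fix a f (substN s C)) by assumption.
  rewrite !stepv_subst by (intro; (apply V_ge0 || apply weakv_ge0)). rmax.
Qed.

Lemma stepv_ctx a f s C : (forall D, 0 <= f D) ->
  stepv a C (fun D => f (substN s D)) <= stepv a (substN s C) f.
Proof. intro; rewrite stepv_subst by assumption; apply Rmax_l. Qed.

(* Comparison of the values of all instances of contexts under s with a function on contexts that is
   superharmonic for the transitions of the context itself (first two premises on Psi) and dominates
   the transitions of the substituted expressions (last two premises). *)
Lemma tauv_ctx s g (Psi : NE -> R) (k : nat -> R) : range01 g ->
  (forall C, 0 <= Psi C) -> (forall C, stepv tau C Psi <= Psi C) ->
  (forall C, g (substN s C) <= Psi C) ->
  (forall U, (forall D, 0 <= U D <= V g D) -> (forall C, U (substN s C) <= Psi C) ->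
     forall n, stepv tau (s n) U <= k n) ->
  (forall C, expo C k <= Psi C) ->
  forall C, V g (substN s C) <= Psi C.
Proof.
  intros Hg HP0 HP HgP Hk HkP C.
  (* One expression may be an instance of several contexts, so [Psi] does not define a function on
     expressions. The infimum over all presentations does, and including [V g K] keeps it below
     [V g]. *)
  set (U := fun K => inf1 (fun x => x = V g K \/ exists C, K = substN s C /\ x = Psi C)).
  assert (U1 : forall D, 0 <= U D <= V g D).
  { intro D; split; [apply inf1_ge0|]. apply inf1_le; [auto|apply V_ge0]. }
  assert (U2 : forall C, U (substN s C) <= Psi C).
  { intro C'; apply inf1_le; [right; eauto|apply HP0]. }
  eapply Rle_trans; [|apply U2].
  apply tauv_least; [assumption|].
  intro D; split; [|rewrite Rmult_1_l]; apply inf1_glb.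
  - apply Hg.
  - intros x [->|[C' [-> ->]]] _; [apply tauv_ge; assumption|apply HgP].
  - apply stepv_bounds; intro D'. destruct (U1 D'), (tauv_bounds 1 g D'); lra.
  - intros x [->|[C' [-> ->]]] _.
    + eapply Rle_trans; [|apply V_super; assumption]. apply stepv_mono; apply U1.
    + rewrite stepv_subst by apply U1. apply Rmax_lub.
      * eapply Rle_trans; [|apply HP]. apply stepv_mono, U2.
      * eapply Rle_trans; [|apply HkP]. apply expo_mono, Hk; assumption.
Qed.

(* The probability of reaching an exposed variable, where exposing variable n is rewarded by w n. *)
Definition reachv w : NE -> R := V (fun C => expo C w).

(** * Comparison of two instances of all contexts, with an error term *)

Section Contexts.
Variables (s t : nat -> NE) (f : NE -> R) (w : nat -> R) (d : R).
Hypothesis Hf : range01 f.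
Hypothesis Hd : 0 <= d.
Hypothesis Hw : forall n, 0 <= w n <= 1.

Lemma expo_range : range01 (fun C => expo C w).
Proof. intro D; apply expo_bounds, Hw. Qed.

(** The error [d] is paid only in proportion to the probability of reaching an exposed variable of
    positive weight. Both summands are superharmonic on contexts, hence so is the sum, by
    [stepv_lin]. *)
Lemma tauv_ctx_sum g (k : nat -> R) : range01 g ->
  (forall C, g (substN s C) <= V g (substN t C) + d * reachv w C) ->
  (forall U, (forall D, 0 <= U D <= V g D) ->
     (forall C, U (substN s C) <= V g (substN t C) + d * reachv w C) ->
     forall n, stepv tau (s n) U <= k n + d * w n) ->
  (forall C, expo C k <= V g (substN t C)) ->
  forall C, V g (substN s C) <= V g (substN t C) + d * reachv w C.
Proof.
  intros Hg HgP Hk HkP.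
  apply (@tauv_ctx s g (fun C => V g (substN t C) + d * reachv w C) (fun n => k n + d * w n));
    auto.
  - intro C; pose proof (V_ge0 g (substN t C)); pose proof (V_ge0 (fun C => expo C w) C).
    unfold reachv; nra.
  - intro C. eapply Rle_trans.
    { apply (@stepv_lin _ tau C _ (fun C => V g (substN t C)) (reachv w) d Hd); intro; lra. }
    apply Rplus_le_compat.
    + eapply Rle_trans; [apply (@stepv_ctx tau (V g)), V_ge0|apply V_super; assumption].
    + apply Rmult_le_compat_l; [assumption|apply V_super, expo_range].
  - intro C. eapply Rle_trans.
    { apply (@expo_lin _ C _ k w d Hd); intro; lra. }
    apply Rplus_le_compat; [apply HkP|].
    apply Rmult_le_compat_l; [assumption|].
    apply (@tauv_ge 1 (fun C => expo C w)), expo_range.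
Qed.

Lemma V_ctx : (forall C, f (substN s C) <= f (substN t C)) ->
  (forall U, (forall D, 0 <= U D <= V f D) ->
     (forall C, U (substN s C) <= V f (substN t C) + d * reachv w C) ->
     forall n, stepv tau (s n) U <= weakv tau f (t n) + d * w n) ->
  forall C, V f (substN s C) <= V f (substN t C) + d * reachv w C.
Proof.
  intros H1 H2; apply tauv_ctx_sum with (k := fun n => weakv tau f (t n)); auto.
  - intro C; pose proof (H1 C); pose proof (tauv_ge 1 (substN t C) Hf).
    pose proof (V_ge0 (fun C => expo C w) C); unfold reachv; nra.
  - intro C; eapply Rle_trans; [apply expo_weakv|apply weakv_le_V]; assumption.
Qed.

Lemma weakv_ctx a : (forall C, V f (substN s C) <= V f (substN t C)) ->
  (forall n, stepv a (s n) (V f) <= weakv a f (t n) + d * w n) ->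
  (forall U, (forall D, 0 <= U D <= weakv a f D) ->
     (forall C, U (substN s C) <= weakv a f (substN t C) + d * reachv w C) ->
     forall n, stepv tau (s n) U <= weakv a f (t n) + d * w n) ->
  forall C, weakv a f (substN s C) <= weakv a f (substN t C) + d * reachv w C.
Proof.
  intros H1 H2 H3; apply tauv_ctx_sum with (k := fun n => weakv a f (t n)); auto.
  - apply stepv_range01, tauv_bounds.
  - intro C; fold (weakv a f). rewrite stepv_subst by apply V_ge0.
    assert (Hr := V_ge0 (fun C => expo C w) C). fold (reachv w) in Hr.
    apply Rmax_lub.
    + apply Rle_trans with (weakv a f (substN t C)); [|nra].
      eapply Rle_trans; [|apply stepv_le_weakv; assumption].
      eapply Rle_trans; [|apply stepv_ctx, V_ge0]. apply stepv_mono, H1.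
    + eapply Rle_trans.
      { apply (@expo_lin _ C _ (fun n => weakv a f (t n)) w d Hd), H2. }
      apply Rplus_le_compat; [apply expo_weakv; assumption|].
      apply Rmult_le_compat_l; [assumption|].
      apply (@tauv_ge 1 (fun C => expo C w)), expo_range.
  - intro C; apply expo_weakv; assumption.
Qed.

(** Here [V] may be compared with error [d], while [weakv_ctx] needs a comparison of [V] without
    error. For R2 this bound is used to obtain [d = 0] for tau, after which [weakv_ctx] becomes
    available for every action. *)
Lemma weakv_tau_ctx :
  (forall C, V f (substN s C) <= V f (substN t C) + d * reachv w C) ->
  (forall n, weakv tau f (s n) <= weakv tau f (t n) + d * w n) ->
  forall C, weakv tau f (substN s C) <= weakv tau f (substN t C) + d * reachv w C.
Proof.
  intros H1 H2 C. rewrite (@weakv_tau f (substN s C)), stepv_subst by (assumption || apply V_ge0).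
  apply Rmax_lub.
  - eapply Rle_trans.
    { apply (@stepv_lin _ tau C _ (fun C => V f (substN t C)) (reachv w) d Hd), H1. }
    apply Rplus_le_compat.
    + rewrite weakv_tau by assumption; apply stepv_ctx, V_ge0.
    + apply Rmult_le_compat_l; [assumption|apply V_super, expo_range].
  - eapply Rle_trans.
    { apply (@expo_lin _ C _ (fun n => weakv tau f (t n)) w d Hd).
      intro n; rewrite <- weakv_tau by assumption; apply H2. }
    apply Rplus_le_compat; [apply expo_weakv; assumption|].
    apply Rmult_le_compat_l; [assumption|].
    apply (@tauv_ge 1 (fun C => expo C w)), expo_range.
Qed.

End Contexts.

Definition respects (S : NE -> NE -> Prop) f : Prop := forall E F, S E F -> f E = f F.

(* Weak bisimulation expressed by functions instead of relations: the equality "=" hides a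
   comparison of suprema in both directions. *)
Definition fbisim (S : NE -> NE -> Prop) : Prop :=
  forall f, range01 f -> respects S f ->
    respects S (V f) /\ forall a, a <> tau -> respects S (weakv a f).

Definition fsim E F : Prop := exists S, fbisim S /\ S E F.

Definition inv f : Prop := range01 f /\ respects fsim f.

(** Including [a = tau] expresses the root condition of weak congruence: [weakv tau] demands at
    least one tau-step, whereas [V] also allows none. *)
Definition fle E F : Prop := forall f a, inv f -> weakv a f E <= weakv a f F.
Definition feq E F : Prop := forall f a, inv f -> weakv a f E = weakv a f F.
Definition peq P Q : Prop := forall f, inv f -> expect P f = expect Q f.

Lemma fbisim_fsim : fbisim fsim.
Proof.
  intros f Hf Hr; split; [|intros a Ha]; intros E F [S [HS HEF]];
    (assert (respects S f) as Hr' by (intros E' F' H'; apply Hr; exists S; auto));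
    apply (HS f Hf Hr'); assumption.
Qed.

Lemma inv_V f : inv f -> inv (V f).
Proof. intros [H1 H2]; split; [apply tauv_bounds|]. apply fbisim_fsim; assumption. Qed.

Lemma inv_weakv a f : a <> tau -> inv f -> inv (weakv a f).
Proof. intros Ha [H1 H2]; split; [apply weakv_bounds|]. apply fbisim_fsim; assumption. Qed.

Lemma inv_prev a b f : inv f -> inv (prev a b f).
Proof.
  intro Hf; unfold prev.
  destruct (excluded_middle_informative (b = a)); [apply inv_V; assumption|].
  destruct (excluded_middle_informative (b = tau)) as [->|].
  - apply inv_weakv; [congruence|assumption].
  - split; [intro; lra|]. intros ? ? ?; reflexivity.
Qed.

(** Coinduction up to similarity: since [S] is united with [fsim], the test functions may be assumed
    invariant under [fsim] as well. *)
Lemma fsim_intro (S : NE -> NE -> Prop) :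
  (forall f, inv f -> respects S f ->
    respects S (V f) /\ forall a, a <> tau -> respects S (weakv a f)) ->
  forall E F, S E F -> fsim E F.
Proof.
  intros HS E F HEF; exists (fun E F => fsim E F \/ S E F); split; [|auto].
  intros f Hf Hr.
  assert (Hi : inv f) by (split; [assumption|]; intros ? ? ?; apply Hr; auto).
  assert (HrS : respects S f) by (intros ? ? ?; apply Hr; auto).
  split; [|intros a Ha]; intros E' F' [H'|H'].
  - apply (inv_V Hi); assumption.
  - apply (HS f Hi HrS); assumption.
  - apply (inv_weakv Ha Hi); assumption.
  - apply (HS f Hi HrS); assumption.
Qed.

Lemma feq_fsim E F : feq E F -> fsim E F.
Proof.
  apply fsim_intro; intros f Hf Hr; split; [|intros a Ha]; intros E' F' H'.
  - rewrite !V_fix by apply Hf. rewrite (Hr _ _ H'), (H' f tau Hf); reflexivity.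
  - apply H'; assumption.
Qed.

Lemma feq_inv E F f : feq E F -> inv f -> f E = f F.
Proof. intros H [_ Hf]; apply Hf, feq_fsim, H. Qed.

Lemma feq_sym E F : feq E F -> feq F E.
Proof. intros H f a Hf; symmetry; auto. Qed.

Lemma feq_trans E F G : feq E F -> feq F G -> feq E G.
Proof. intros H1 H2 f a Hf; rewrite H1; auto. Qed.

Lemma feq_fle E F : feq E F -> fle E F.
Proof. intros H f a Hf; rewrite H; [lra|assumption]. Qed.

Lemma feq_unfold E : feq (Rec E) (inst E (Rec E)).
Proof. intros f a Hf; apply weakv_rec, Hf. Qed.

(** Coinduction with the relation of all pairs of instances of a common context. Once these pairs
    are similar, every invariant [f] agrees on them, and the hypothesis applies to all actions, tau
    included. *)
Lemma feq_ctx s t :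
  (forall f, inv f -> (forall C, f (substN s C) = f (substN t C)) ->
    (forall C, V f (substN s C) = V f (substN t C)) /\
    (forall a C, weakv a f (substN s C) = weakv a f (substN t C))) ->
  forall C, feq (substN s C) (substN t C).
Proof.
  intros H.
  assert (Hsim : forall C, fsim (substN s C) (substN t C)).
  { intro C; apply fsim_intro with (S := fun E F => exists C, E = substN s C /\ F = substN t C);
      [|eauto].
    intros f Hf Hr. destruct (H f Hf) as [H1 H2]; [intro C'; apply Hr; eauto|].
    split; [|intros a Ha]; intros E F [C' [-> ->]]; auto. }
  intros C f a Hf. apply H; [assumption|]. intro C'; apply Hf, Hsim.
Qed.

(* Park induction for Rec E, for values of functions invariant under fsim. *)
Lemma rec_ctx E B f : inv f ->
  (forall C, f (inst C (Rec E)) = f (inst C B)) -> fle (inst E B) B ->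
  (forall C, V f (inst C (Rec E)) <= V f (inst C B)) /\
  (forall a C, weakv a f (inst C (Rec E)) <= weakv a f (inst C B)).
Proof.
  intros Hf Heq Hle; unfold inst in Heq |- *.
  set (s := scons (Rec E) (Var Act)) in *; set (t := scons B (Var Act)) in *.
  assert (Hr := proj1 Hf).
  assert (Hw : forall n : nat, 0 <= (fun _ : nat => 0) n <= 1) by (intro; lra).
  (* A move of [Rec E] comes from a move of the context [E]; replacing [Rec E] by [B] in its target
     gives a move of [inst E B], whose value [B] dominates. *)
  assert (Hpark : forall a U U' x, (forall D, 0 <= U' D) ->
     (forall C, U (substN s C) <= U' (substN t C)) -> stepv a (inst E B) U' <= x ->
     stepv a (Rec E) U <= x).
  { intros a U U' x HU' HUU' Hx; cbn [stepv]; eapply Rle_trans; [|apply Hx].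
    eapply Rle_trans; [|apply (@stepv_ctx a U' t E HU')]. apply stepv_mono, HUU'. }
  assert (HV : forall C, V f (substN s C) <= V f (substN t C)).
  (* Park induction is the case without error: [d] and all weights are 0. *)
  { intro C; replace (V f (substN t C)) with (V f (substN t C) + 0 * reachv (fun _ => 0) C) by ring.
    revert C; apply V_ctx; auto; try lra.
    - intro C; rewrite Heq; lra.
    - intros U HU HUC [|n]; simpl; [|rewrite Rmult_0_l, Rplus_0_r; apply weakv_ge0].
      rewrite Rmult_0_l, Rplus_0_r.
      apply Hpark with (U' := V f); [apply V_ge0|intro C; specialize (HUC C); lra|].
      rewrite <- weakv_tau by assumption; apply Hle; assumption. }
  split; [assumption|].
  intros a C.
  replace (weakv a f (substN t C)) with (weakv a f (substN t C) + 0 * reachv (fun _ => 0) C) by ring.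
  revert C; apply weakv_ctx; auto; try lra.
  - intros [|n]; simpl; rewrite Rmult_0_l, Rplus_0_r; [|apply weakv_ge0].
    apply Hpark with (U' := V f); [apply V_ge0|assumption|].
    eapply Rle_trans; [apply stepv_le_weakv; assumption|apply Hle; assumption].
  - intros U HU HUC [|n]; simpl; rewrite Rmult_0_l, Rplus_0_r; [|apply weakv_ge0].
    apply Hpark with (U' := weakv a f); [apply weakv_ge0|intro C; specialize (HUC C); lra|].
    eapply Rle_trans; [apply weakv_super; assumption|apply Hle; assumption].
Qed.

(** Each side is a pre-fixed point of the body of the other, so Park induction gives both
    inequalities; the context consisting of variable 0 alone yields the claim. *)
Lemma feq_rec E F : fle (inst E (Rec F)) (Rec F) -> fle (inst F (Rec E)) (Rec E) ->
  feq (Rec E) (Rec F).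
Proof.
  intros H1 H2.
  apply (@feq_ctx (scons (Rec E) (Var Act)) (scons (Rec F) (Var Act))) with (C := Var Act 0).
  intros f Hf Hr.
  destruct (rec_ctx Hf Hr H1) as [HV HW].
  destruct (rec_ctx Hf (fun C => eq_sym (Hr C)) H2) as [HV' HW'].
  split; [intro C|intros a C]; apply Rle_antisym; auto;
    [apply HV|apply HV'|apply HW|apply HW'].
Qed.

Definition w0 : nat -> R := wcons 1 (fun _ => 0).

Lemma w0_range n : 0 <= w0 n <= 1.
Proof. destruct n; simpl; lra. Qed.

(* The differences of the values at G and H are contracted by the factor reachv w0 E < 1. *)
Lemma guarded_ctx s0 E G H f : inv f ->
  (forall C, f (substN (scons G s0) C) = f (substN (scons H s0) C)) ->
  feq G (substN (scons G s0) E) -> feq H (substN (scons H s0) E) -> reachv w0 E < 1 ->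
  (forall C, V f (substN (scons G s0) C) <= V f (substN (scons H s0) C)) /\
  (forall a C, weakv a f (substN (scons G s0) C) <= weakv a f (substN (scons H s0) C)).
Proof.
  intros Hf Heq HG HH Hlt; set (s := scons G s0) in *; set (t := scons H s0) in *.
  assert (Hr := proj1 Hf). assert (Hw := w0_range).
  (* [d] is the positive part of the difference of the values at [G] and [H]. *)
  assert (Hd : forall a, exists d, 0 <= d /\ (d = 0 \/ d = weakv a f G - weakv a f H) /\
            weakv a f G <= weakv a f H + d).
  { intro a; destruct (Rle_dec (weakv a f G) (weakv a f H)).
    - exists 0; lra.
    - exists (weakv a f G - weakv a f H); lra. }
  assert (Hn : forall a d, 0 <= d -> weakv a f G <= weakv a f H + d ->
             forall n, weakv a f (s n) <= weakv a f (t n) + d * w0 n).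
  { intros a d Hd0 Hle [|n]; simpl; lra. }
  (* As [G] and [H] have the values of their unfoldings, a difference [d] satisfies
     [d <= d * reachv w0 E], and the factor is less than 1. *)
  assert (Hcon : forall a d, 0 <= d -> (d = 0 \/ d = weakv a f G - weakv a f H) ->
     weakv a f (substN s E) <= weakv a f (substN t E) + d * reachv w0 E -> d = 0).
  { intros a d Hd0 [|Hd1] Hle; [assumption|]. rewrite <- (HG f a Hf), <- (HH f a Hf) in Hle. nra. }
  assert (HV : forall C, V f (substN s C) <= V f (substN t C)).
  { destruct (Hd tau) as [d [Hd0 [Hd1 Hd2]]].
    assert (HV : forall C, V f (substN s C) <= V f (substN t C) + d * reachv w0 C).
    { apply V_ctx; auto.
      - intro C; rewrite Heq; lra.
      - intros U HU _ n. eapply Rle_trans; [|apply Hn; assumption].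
        rewrite (@weakv_tau f (s n)) by assumption; apply stepv_mono, HU. }
    assert (d = 0) as ->.
    { apply (Hcon tau); auto. apply weakv_tau_ctx; auto. }
    intro C; specialize (HV C); lra. }
  split; [assumption|].
  intro a; destruct (Hd a) as [d [Hd0 [Hd1 Hd2]]].
  assert (HW : forall C, weakv a f (substN s C) <= weakv a f (substN t C) + d * reachv w0 C).
  { apply weakv_ctx; auto.
    - intro n; eapply Rle_trans; [|apply Hn; assumption]. apply stepv_le_weakv; assumption.
    - intros U HU _ n. eapply Rle_trans; [|apply Hn; assumption].
      eapply Rle_trans; [|apply weakv_super; assumption]. apply stepv_mono, HU. }
  assert (d = 0) as -> by (apply (Hcon a); auto).
  intro C; specialize (HW C); lra.
Qed.

Lemma feq_guarded s0 E G H :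
  feq G (substN (scons G s0) E) -> feq H (substN (scons H s0) E) -> reachv w0 E < 1 -> feq G H.
Proof.
  intros HG HH Hlt.
  apply (@feq_ctx (scons G s0) (scons H s0)) with (C := Var Act 0).
  intros f Hf Hr.
  destruct (guarded_ctx Hf Hr HG HH Hlt) as [HV HW].
  destruct (guarded_ctx Hf (fun C => eq_sym (Hr C)) HH HG Hlt) as [HV' HW'].
  split; [intro C|intros a C]; apply Rle_antisym; auto.
Qed.

End Similarity.

Scheme eqN_mut := Minimality for eqN Sort Prop
with eqP_mut := Minimality for eqP Sort Prop.
Combined Scheme eqN_eqP_ind from eqN_mut, eqP_mut.

(** * Guardedness *)

Section Guardedness.
Variable Act : Type.
Variable tau : Act.
Local Notation NE := (NE Act).
Local Notation PE := (PE Act).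
Local Notation reachv := (reachv tau).
Implicit Types (E F : NE) (P Q : PE) (w : nat -> R).

Definition range_w w : Prop := forall n, 0 <= w n <= 1.

Lemma reachv_fix w E : range_w w -> reachv w E = Rmax (expo E w) (stepv tau E (reachv w)).
Proof.
  intro Hw; unfold reachv; rewrite (tauv_fix tau _ one_disc), Rmult_1_l; [reflexivity|].
  intro D; apply expo_bounds, Hw.
Qed.

Lemma reachv_bounds w E : 0 <= reachv w E <= 1.
Proof. apply tauv_bounds. Qed.

Lemma reachv_var w n : range_w w -> reachv w (Var Act n) = w n.
Proof. intro Hw; rewrite reachv_fix by assumption; simpl; apply Rmax_left, Hw. Qed.

Lemma reachv_sum w E F : range_w w -> reachv w (Sum E F) = Rmax (reachv w E) (reachv w F).
Proof.
  intro Hw; rewrite (@reachv_fix w (Sum E F)), (@reachv_fix w E), (@reachv_fix w F) by assumption.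
  simpl; rmax.
Qed.

(** Park induction for reachability: rewarding the bound variable with the guess [y] must not lift
    the body above [y]. It is used in contrapositive form, to pass from a strict lower bound on
    [Rec E] to one on [E]. *)
Lemma reachv_rec w E y : range_w w -> 0 <= y <= 1 -> reachv (wcons y w) E <= y ->
  reachv w (Rec E) <= y.
Proof.
  intros Hw Hy Hle.
  assert (Hw' : range_w (wcons y w)) by (intros [|n]; simpl; auto).
  apply Rle_trans with (reachv (wcons y w) (Var Act 0)); [|rewrite reachv_var; [simpl; lra|auto]].
  apply (@tauv_ctx _ tau (scons (Rec E) (Var Act)) (fun C => expo C w)
    (reachv (wcons y w)) (wcons y w)) with (C := Var Act 0).
  - intro D; apply expo_bounds, Hw.
  - intro; apply reachv_bounds.
  - intro C; rewrite (@reachv_fix _ C) by assumption; apply Rmax_r.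
  - intro C; rewrite expo_subst, reachv_fix by assumption.
    eapply Rle_trans; [|apply Rmax_l].
    apply expo_mono; intros [|n]; simpl; [|lra].
    eapply Rle_trans; [|apply Hle]. rewrite reachv_fix by assumption.
    eapply Rle_trans; [|apply Rmax_l].
    apply expo_mono; intros [|n]; simpl; lra.
  - intros U HU HUC [|n]; simpl; [|apply Hw].
    eapply Rle_trans; [|apply Hle]. rewrite reachv_fix by assumption.
    eapply Rle_trans; [|apply Rmax_r]. apply stepv_mono, HUC.
  - intro C; rewrite reachv_fix by assumption; apply Rmax_l.
Qed.

(* y < (1 - eps) * max_V w + eps * min_V w *)
Definition below_mix (eps : R) w (y : R) (V : list nat) : Prop :=
  exists v, In v V /\ forall v', In v' V -> w v' <= w v /\ y < (1 - eps) * w v + eps * w v'.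

Lemma below_mix_le eps eps' w y V : eps' <= eps -> below_mix eps w y V -> below_mix eps' w y V.
Proof.
  intros He [v [Hv H]]; exists v; split; [assumption|].
  intros v' Hv'; destruct (H v' Hv'); split; [assumption|nra].
Qed.

(** [v1] is a maximiser over both sets. A variable with share [e] in its branch keeps at least the
    share [Rmin p (1 - p) * e] in the choice. *)
Lemma below_mix_app_l e p w V1 V2 y1 y2 y v1 v2 : 0 < e <= 1 -> 0 < p < 1 ->
  y < p * y1 + (1 - p) * y2 -> w v2 <= w v1 -> In v1 V1 -> In v2 V2 ->
  (forall v', In v' V1 -> w v' <= w v1 /\ y1 < (1 - e) * w v1 + e * w v') ->
  (forall v', In v' V2 -> w v' <= w v2 /\ y2 < (1 - e) * w v2 + e * w v') ->
  forall v', In v' V1 \/ In v' V2 ->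
    w v' <= w v1 /\ y < (1 - (Rmin p (1 - p) * e)) * w v1 + Rmin p (1 - p) * e * w v'.
Proof.
  intros He Hp Hy Hv Hi1 Hi2 H1 H2 v' Hv'.
  assert (Hm : Rmin p (1 - p) <= p /\ Rmin p (1 - p) <= 1 - p) by (split; [apply Rmin_l|apply Rmin_r]).
  assert (y1 < w v1) by (destruct (H1 v1 Hi1); lra).
  assert (y2 < w v1) by (destruct (H2 v2 Hi2); lra).
  destruct Hv' as [Hv'|Hv'].
  - destruct (H1 v' Hv') as [Ha Hb]; split; [assumption|].
    assert (Rmin p (1 - p) * (e * (w v1 - w v')) <= p * (e * (w v1 - w v'))).
    { apply Rmult_le_compat_r; [nra|lra]. }
    nra.
  - destruct (H2 v' Hv') as [Ha Hb]; split; [lra|].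
    assert (Rmin p (1 - p) * (e * (w v1 - w v')) <= (1 - p) * (e * (w v1 - w v'))).
    { apply Rmult_le_compat_r; [nra|lra]. }
    assert ((1 - e) * w v2 <= (1 - e) * w v1) by nra.
    nra.
Qed.

(* Among the sets V with E |> V, the probability of reaching an exposed variable is governed by a
   convex combination of w over V in which every variable has weight at least eps, unless the
   probability of not reaching any variable is at least eps. *)
Lemma reachv_ug :
  (forall E, exists eps, 0 < eps <= 1 /\ forall w y, range_w w -> y < reachv w E ->
     y < 1 - eps \/ exists V, ugN tau E V /\ below_mix eps w y V) /\
  (forall P, exists eps, 0 < eps <= 1 /\ forall w y, range_w w -> y < expect P (reachv w) ->
     y < 1 - eps \/ exists V, ugP tau P V /\ below_mix eps w y V).
Proof.
  apply NE_PE_ind.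
  - exists (1/2); split; [lra|]; intros w y Hw; rewrite reachv_fix by assumption; simpl; left; rmax.
  - intro n; exists (1/2); split; [lra|]; intros w y Hw; rewrite reachv_var by assumption.
    right; exists [n]; split; [constructor|]. exists n; split; [left; reflexivity|].
    intros v' [<-|[]]; lra.
  - intros a P [eps [He H]]; exists eps; split; [assumption|]; intros w y Hw.
    rewrite reachv_fix by assumption; simpl.
    assert (0 <= expect P (reachv w)).
    { rewrite <- (expect_const P 0); apply expect_mono; intro; apply reachv_bounds. }
    destruct excluded_middle_informative as [<-|]; [|intro; left; rmax].
    rewrite Rmax_right by assumption; intro Hy.
    destruct (H w y Hw Hy) as [|[V [H1 H2]]]; [auto|right; exists V; split; [constructor|]; assumption].
  - intros E [eps [He H]]; exists eps; split; [assumption|]; intros w y Hw Hy.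
    destruct (Rlt_dec y 0) as [|Hy0]; [left; lra|].
    assert (Hy1 : 0 <= y <= 1) by (pose proof (reachv_bounds w (Rec E)); lra).
    (* The bound variable is rewarded with [y] itself. It then cannot be the maximiser in
       [below_mix], which would give [y < y]; so [V] contains another variable and [ug_rec]
       applies. *)
    assert (Hw' : range_w (wcons y w)) by (intros [|n]; simpl; auto).
    assert (Hy' : y < reachv (wcons y w) E).
    { apply Rnot_le_lt; intro Hle; pose proof (reachv_rec Hw Hy1 Hle); lra. }
    destruct (H _ y Hw' Hy') as [|[V [H1 [[|v] [H2 H3]]]]]; [auto| |].
    + destruct (H3 _ H2) as [_ H4]; simpl in H4; lra.
    + right; eexists; split; [apply ug_rec; [exact H1|]|].
      * intro Hs; apply Hs in H2; discriminate.
      * exists v; split.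
        -- apply in_map_iff; exists (S v); split; [reflexivity|].
           apply filter_In; auto.
        -- intros v' Hv'; apply in_map_iff in Hv'; destruct Hv' as [[|u] [<- Hu]];
             apply filter_In in Hu; destruct Hu as [Hu Hu']; [discriminate|].
           apply (H3 _ Hu).
  - intros E [e1 [He1 H1]] F [e2 [He2 H2]].
    exists (Rmin e1 e2); split; [rmax; unfold Rmin; destruct Rle_dec; lra|].
    intros w y Hw; rewrite reachv_sum by assumption; intro Hy.
    pose proof (Rmin_l e1 e2) as Hl; pose proof (Rmin_r e1 e2) as Hr.
    assert (y < reachv w E \/ y < reachv w F) as [Hy'|Hy'] by rmax.
    + destruct (H1 w y Hw Hy') as [|[V [Hu Hm]]]; [left; lra|].
      right; exists V; split; [constructor; assumption|exact (below_mix_le Hl Hm)].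
    + destruct (H2 w y Hw Hy') as [|[V [Hu Hm]]]; [left; lra|].
      right; exists V; split; [apply ug_sumr; assumption|exact (below_mix_le Hr Hm)].
  - intros E [eps [He H]]; exists eps; split; [assumption|]; intros w y Hw Hy.
    destruct (H w y Hw Hy) as [|[V [H1 H2]]]; [auto|right; exists V; split; [constructor|]; assumption].
  - intros p P [e1 [He1 H1]] Q [e2 [He2 H2]].
    pose proof (pval_range p) as Hp; set (q := pval p) in *.
    set (e := Rmin e1 e2).
    assert (He : 0 < e <= 1 /\ e <= e1 /\ e <= e2) by (unfold e, Rmin; destruct Rle_dec; lra).
    assert (Hm : 0 < Rmin q (1 - q) <= 1 /\ Rmin q (1 - q) <= q /\ Rmin q (1 - q) <= 1 - q)
      by (unfold Rmin; destruct Rle_dec; lra).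
    exists (Rmin q (1 - q) * e); split; [nra|].
    intros w y Hw Hy; cbn [expect] in Hy; fold q in Hy.
    assert (Hb : forall P', expect P' (reachv w) <= 1).
    { intro P'; apply (expect_bounds P' (f := reachv w) (x := 0)), reachv_bounds. }
    set (A := expect P (reachv w)) in *; set (B := expect Q (reachv w)) in *.
    assert (HA : A <= 1) by apply Hb. assert (HB : B <= 1) by apply Hb.
    (* Half of the slack is given up in both branches, so that the bounds on the branches are strict
       and their average still exceeds [y]. *)
    set (dl := (q * A + (1 - q) * B - y) / 2).
    assert (Hdl : 0 < dl) by (unfold dl; lra).
    assert (Hy2 : y < q * (A - dl) + (1 - q) * (B - dl)) by (unfold dl; lra).
    assert (A - dl < A) as HyA by lra. assert (B - dl < B) as HyB by lra.
    assert (Rmin q (1 - q) * e <= q * e /\ Rmin q (1 - q) * e <= (1 - q) * e) as Hme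
      by (split; apply Rmult_le_compat_r; lra).
    destruct (H1 w _ Hw HyA) as [HA'|[V1 [Hu1 Hx1]]]; [left; nra|].
    destruct (H2 w _ Hw HyB) as [HB'|[V2 [Hu2 Hx2]]]; [left; nra|].
    right; exists (V1 ++ V2); split; [constructor; assumption|].
    apply (below_mix_le (eps' := e)) in Hx1; [|apply He].
    apply (below_mix_le (eps' := e)) in Hx2; [|apply He].
    destruct Hx1 as [v1 [Hv1 Hx1]], Hx2 as [v2 [Hv2 Hx2]].
    destruct (Rle_dec (w v2) (w v1)) as [Hle|Hle].
    + exists v1; split; [apply in_or_app; auto|]. intros v' Hv'; apply in_app_or in Hv'.
      apply (@below_mix_app_l e q w V1 V2 (A - dl) (B - dl) y v1 v2); auto; apply He. 
    + exists v2; split; [apply in_or_app; auto|]. intros v' Hv'; apply in_app_or in Hv'.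
      replace (Rmin q (1 - q)) with (Rmin (1 - q) (1 - (1 - q)))
        by (rewrite Rmin_comm; f_equal; ring).
      apply (@below_mix_app_l e (1 - q) w V2 V1 (B - dl) (A - dl) y v2 v1); auto; try apply He;
        try lra; tauto.
Qed.

(** With the bound [1 - eps] the first alternative of [reachv_ug] is excluded, and a variable of
    weight 0 in [V] would give [1 - eps < 1 - eps]. Hence [V] contains only variable 0. *)
Lemma guarded_reachv E : ~ unguarded tau E 0 -> reachv w0 E < 1.
Proof.
  intro Hg; apply Rnot_le_lt; intro Hle.
  destruct (proj1 reachv_ug E) as [eps [He H]].
  destruct (H w0 (1 - eps)) as [|[V [Hu [v [Hv Hm]]]]]; [intro; apply w0_range|lra|lra|].
  apply Hg; exists V; split; [assumption|].
  assert (forall v', In v' V -> v' = 0%nat) as Hz.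
  { intros v' Hv'; destruct (Hm v' Hv') as [_ Hlt].
    destruct v' as [|v']; [reflexivity|]. simpl in Hlt. pose proof (w0_range v). nra. }
  intro y; split; [apply Hz|]. intros ->; rewrite <- (Hz v Hv); assumption.
Qed.

End Guardedness.

(** * Finite sums and iterated probabilistic choice *)

Fixpoint lsum (A : Type) (g : A -> R) (l : list A) : R :=
  match l with [] => 0 | x :: l' => g x + lsum g l' end.

Lemma lsum_app A (g : A -> R) l l' : lsum g (l ++ l') = lsum g l + lsum g l'.
Proof. induction l; simpl; [ring|rewrite IHl; ring]. Qed.

Lemma lsum_map A B (g : B -> R) (k : A -> B) l : lsum g (map k l) = lsum (fun x => g (k x)) l.
Proof. induction l; simpl; congruence. Qed.

Lemma lsum_scal A (g : A -> R) c l : lsum (fun x => c * g x) l = c * lsum g l.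
Proof. induction l; simpl; [ring|rewrite IHl; ring]. Qed.

Lemma lsum_plus A (g g' : A -> R) l : lsum (fun x => g x + g' x) l = lsum g l + lsum g' l.
Proof. induction l; simpl; [ring|rewrite IHl; ring]. Qed.

Lemma lsum_le A (g g' : A -> R) l : (forall x, In x l -> g x <= g' x) -> lsum g l <= lsum g' l.
Proof.
  induction l; simpl; intro H; [lra|].
  apply Rplus_le_compat; auto.
Qed.

Lemma lsum_ext A (g g' : A -> R) l : (forall x, In x l -> g x = g' x) -> lsum g l = lsum g' l.
Proof. intro H; apply Rle_antisym; apply lsum_le; intros x Hx; rewrite (H x Hx); lra. Qed.

Section WeightedSums.
Variable Act : Type.
Local Notation NE := (NE Act).
Local Notation PE := (PE Act).
Implicit Types (h : NE -> R) (l : list (R * PE)) (P Q : PE).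

Lemma wsum_expect l Q h : wsum l Q ->
  expect Q h = lsum (fun x => fst x * expect (snd x) h) l.
Proof.
  induction 1 as [P|p l1 l2 Q1 Q2 _ IH1 _ IH2]; simpl; [ring|].
  rewrite IH1, IH2, lsum_app, !lsum_map, <- !lsum_scal.
  f_equal; apply lsum_ext; intros; simpl; ring.
Qed.

Lemma wsum_pos l Q : wsum l Q -> forall x, In x l -> 0 < fst x.
Proof.
  induction 1 as [P|p l1 l2 Q1 Q2 _ IH1 _ IH2]; intros x Hx.
  - destruct Hx as [<-|[]]; simpl; lra.
  - pose proof (pval_range p); apply in_app_or in Hx; destruct Hx as [Hx|Hx];
      apply in_map_iff in Hx; destruct Hx as [y [<- Hy]]; simpl;
      apply Rmult_lt_0_compat; auto; lra.
Qed.

Lemma wsum_subst s l Q : wsum l Q ->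
  wsum (map (fun x => (fst x, substP s (snd x))) l) (substP s Q).
Proof.
  induction 1 as [P|p l1 l2 Q1 Q2 _ IH1 _ IH2]; simpl; [constructor|].
  rewrite map_app, !map_map.
  pose proof (ws_node p IH1 IH2) as H; rewrite !map_map in H; exact H.
Qed.

Lemma wsum_ge l Q h c : wsum l Q -> (forall x, In x l -> c <= expect (snd x) h) -> c <= expect Q h.
Proof.
  induction 1 as [P|p l1 l2 Q1 Q2 _ IH1 _ IH2]; intro Hc.
  - apply (Hc (1, P)); left; reflexivity.
  - pose proof (pval_range p); simpl.
    assert (c <= expect Q1 h).
    { apply IH1; intros x Hx; apply (Hc (wscale (pval p) x)).
      apply in_or_app; left; apply in_map; assumption. }
    assert (c <= expect Q2 h).
    { apply IH2; intros x Hx; apply (Hc (wscale (1 - pval p) x)).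
      apply in_or_app; right; apply in_map; assumption. }
    nra.
Qed.

Lemma wsum_le l Q h c : wsum l Q -> (forall x, In x l -> expect (snd x) h <= c) -> expect Q h <= c.
Proof.
  intros Hw Hc.
  assert (forall P, expect P (fun D => - h D) = - expect P h) as Hn.
  { induction P; simpl; [reflexivity|]. rewrite IHP1, IHP2; ring. }
  apply Ropp_le_cancel; rewrite <- Hn.
  apply (wsum_ge Hw); intros x Hx; rewrite Hn; apply Ropp_le_contravar; auto.
Qed.

(** An average with positive weights of values that are at least [c] can be at most [c] only if no
    value exceeds [c]. This is what R6 rests on. *)
Lemma wsum_le_all l Q h c : wsum l Q -> (forall x, In x l -> c <= expect (snd x) h) ->
  expect Q h <= c -> forall x, In x l -> expect (snd x) h <= c.
Proof.
  induction 1 as [P|p l1 l2 Q1 Q2 H1 IH1 H2 IH2]; intros Hc Hle x Hx.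
  - destruct Hx as [<-|[]]; assumption.
  - pose proof (pval_range p); simpl in Hle.
    assert (Hc1 : forall x, In x l1 -> c <= expect (snd x) h).
    { intros y Hy; apply (Hc (wscale (pval p) y)).
      apply in_or_app; left; apply in_map; assumption. }
    assert (Hc2 : forall x, In x l2 -> c <= expect (snd x) h).
    { intros y Hy; apply (Hc (wscale (1 - pval p) y)).
      apply in_or_app; right; apply in_map; assumption. }
    pose proof (wsum_ge H1 Hc1); pose proof (wsum_ge H2 Hc2).
    apply in_app_or in Hx; destruct Hx as [Hx|Hx]; apply in_map_iff in Hx;
      destruct Hx as [y [<- Hy]]; simpl; [apply IH1|apply IH2]; auto; nra.
Qed.

Lemma wsum_compare A (ws : list A) (wt : A -> R) (P1 P2 : A -> PE) Q1 Q2 h1 h2 :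
  wsum (map (fun x => (wt x, P1 x)) ws) Q1 -> wsum (map (fun x => (wt x, P2 x)) ws) Q2 ->
  (forall x, expect (P2 x) h2 <= expect (P1 x) h1) -> expect Q2 h2 <= expect Q1 h1.
Proof.
  intros H1 H2 H; rewrite (wsum_expect h1 H1), (wsum_expect h2 H2), !lsum_map; simpl.
  apply lsum_le; intros x Hx; apply Rmult_le_compat_l; [|apply H].
  apply Rlt_le, (wsum_pos H1 (x := (wt x, P1 x))), in_map_iff; eauto.
Qed.

End WeightedSums.

(** * Soundness for functional similarity *)

Section Soundness.
Variable Act : Type.
Variable tau : Act.
Local Notation NE := (NE Act).
Local Notation PE := (PE Act).
Local Notation V := (tauv tau 1).
Local Notation weakv := (weakv tau).
Local Notation prev := (prev tau).
Local Notation fsim := (fsim tau).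
Local Notation feq := (feq tau).
Local Notation fle := (fle tau).
Local Notation peq := (peq tau).
Local Notation inv := (inv tau).
Implicit Types (E F K A B : NE) (P Q : PE) (s : nat -> NE) (a b : Act) (f g h : NE -> R).

Lemma inv_range f : inv f -> range01 f.
Proof. intros [H _]; exact H. Qed.

Lemma fsim_inv f E F : fsim E F -> inv f -> f E = f F.
Proof. intros H [_ Hf]; apply Hf, H. Qed.

Lemma fsim_tau E : fsim (Pre tau (Dirac E)) E.
Proof.
  apply fsim_intro with (S := fun K L => K = Pre tau (Dirac L)); [|reflexivity].
  intros f Hf Hr; assert (H01 := inv_range Hf).
  split; [|intros a Ha]; intros K L ->.
  - rewrite V_fix, weakv_pre by assumption; simpl; rewrite prev_same, (Hr (Pre tau (Dirac L)) L eq_refl).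
    apply Rmax_right, tauv_ge; assumption.
  - rewrite weakv_pre by assumption; simpl; apply prev_ne; assumption.
Qed.

(** [A] behaves like [K] with an additional tau-loop. The fixed point equation at [A] would admit
    any larger value too, so the argument must use that the solution is least. *)
Lemma tauv_loop A K g : range01 g -> g A = g K ->
  (forall f, (forall D, 0 <= f D) -> stepv tau A f = Rmax (f A) (stepv tau K f)) ->
  V g A = V g K.
Proof.
  intros Hg Heq HA.
  assert (Hle : V g K <= V g A).
  { rewrite (tauv_fix tau K one_disc Hg), Rmult_1_l, <- Heq. apply Rmax_lub; [apply tauv_ge; assumption|].
    eapply Rle_trans; [|apply V_super; assumption]. rewrite HA by apply V_ge0; apply Rmax_r. }
  apply Rle_antisym; [|assumption].
  (* Lowering the least solution at A to its value at K gives another solution. *)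
  set (U := fun D => if excluded_middle_informative (D = A) then V g K else V g D).
  assert (HUA : U A = V g K) by (unfold U; destruct excluded_middle_informative; congruence).
  assert (HU : forall D, 0 <= U D <= V g D).
  { intro D; unfold U; destruct excluded_middle_informative as [->|];
      [split; [apply V_ge0|assumption]|split; [apply V_ge0|lra]]. }
  assert (HsK : stepv tau K U <= V g K).
  { eapply Rle_trans; [|apply V_super; assumption]. apply stepv_mono; apply HU. }
  rewrite <- HUA; apply tauv_least; [assumption|].
  intro D; rewrite Rmult_1_l.
  destruct (excluded_middle_informative (D = A)) as [->|HD].
  - rewrite HA, HUA by apply HU. split; [rewrite Heq; apply tauv_ge; assumption|].
    apply Rmax_lub; [lra|assumption].
  - assert (U D = V g D) as -> by (unfold U; destruct excluded_middle_informative; congruence).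
    split; [apply tauv_ge; assumption|].
    eapply Rle_trans; [|apply V_super; assumption]. apply stepv_mono; apply HU.
Qed.

Lemma fsim_loop A K :
  (forall a f, (forall D, 0 <= f D) -> stepv a A f = stepv a (Sum (Pre tau (Dirac A)) K) f) ->
  fsim A K.
Proof.
  intro HA; apply fsim_intro with (S := fun D L => D = A /\ L = K); [|auto].
  assert (Ht : forall f, (forall D, 0 <= f D) -> stepv tau A f = Rmax (f A) (stepv tau K f)).
  { intros f Hf; rewrite HA by assumption; cbn [stepv].
    destruct excluded_middle_informative; [reflexivity|congruence]. }
  intros f Hf Hr; assert (H01 := inv_range Hf).
  split; [|intros a Ha]; intros D L [-> ->].
  - apply tauv_loop; auto.
  - apply tauv_loop; auto.
    + apply stepv_range01, tauv_bounds.
    + rewrite HA by apply V_ge0; cbn [stepv]; destruct excluded_middle_informative; [congruence|].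
      apply Rmax_right, stepv_ge0, V_ge0.
Qed.

Lemma fle_sum E F K : fle E K -> fle F K -> fle (Sum E F) K.
Proof. intros H1 H2 f a Hf; rewrite weakv_sum by apply Hf; apply Rmax_lub; auto. Qed.

Lemma fle_trans E F K : fle E F -> fle F K -> fle E K.
Proof. intros H1 H2 f a Hf; eapply Rle_trans; eauto. Qed.

Lemma fle_suml E F : fle E (Sum E F).
Proof. intros f a Hf; rewrite weakv_sum by apply Hf; apply Rmax_l. Qed.

Lemma fle_sumr E F : fle F (Sum E F).
Proof. intros f a Hf; rewrite weakv_sum by apply Hf; apply Rmax_r. Qed.

Lemma fle_refl E : fle E E.
Proof. intros f a Hf; lra. Qed.

Lemma fle_feq E F : fle E F -> fle F E -> feq E F.
Proof. intros H1 H2 f a Hf; apply Rle_antisym; auto. Qed.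

Lemma fle_unfold E : fle (inst E (Rec E)) (Rec E).
Proof. apply feq_fle, feq_sym, feq_unfold. Qed.

Lemma feq_absorb E F : fle F E -> feq (Sum E F) E.
Proof. intro H; apply fle_feq; [apply fle_sum; [apply fle_refl|exact H]|apply fle_suml]. Qed.

Lemma fle_nsum (l : list NE) K : (forall E, In E l -> fle E K) -> fle (nsum l) K.
Proof.
  induction l as [|E [|F l] IH]; intro H.
  - intros f a Hf; simpl; rewrite weakv_nil by apply Hf; apply weakv_ge0.
  - apply H; left; reflexivity.
  - cbn [nsum]; apply fle_sum; [apply H; left; reflexivity|]. apply IH; intros; apply H; right; assumption.
Qed.

Lemma nsum_fle (l : list NE) E : In E l -> fle E (nsum l).
Proof.
  induction l as [|K [|F l] IH]; intro H; [destruct H|destruct H as [->|[]]; apply fle_refl|].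
  cbn [nsum]; destruct H as [->|H]; [apply fle_suml|].
  eapply fle_trans; [apply IH; assumption|apply fle_sumr].
Qed.

Lemma substN_nsum s (l : list NE) : substN s (nsum l) = nsum (map (substN s) l).
Proof.
  induction l as [|E [|F l] IH]; [reflexivity|reflexivity|].
  change (Sum (substN s E) (substN s (nsum (F :: l))) = nsum (map (substN s) (E :: F :: l))).
  rewrite IH; reflexivity.
Qed.

Lemma feq_pre a P Q : peq P Q -> feq (Pre a P) (Pre a Q).
Proof. intros H f b Hf; rewrite !weakv_pre by apply Hf; apply H, inv_prev, Hf. Qed.

Lemma peq_T1 p E P : peq (PCh p (Dirac (Pre tau (Dirac E))) P) (PCh p (Dirac E) P).
Proof. intros f Hf; simpl; rewrite (fsim_inv (fsim_tau E) Hf); reflexivity. Qed.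

Lemma fle_T2 (ws : list (R * NE)) F Q :
  wsum (map (fun x => (fst x, Dirac (Sum (snd x) F))) ws) Q -> fle F (Pre tau Q).
Proof.
  intros Hw f a Hf; rewrite weakv_pre by apply Hf; apply (wsum_ge Hw).
  intros x Hx; apply in_map_iff in Hx; destruct Hx as [y [<- _]]; simpl.
  eapply Rle_trans; [apply (@fle_sumr (snd y) F f a Hf)|apply weakv_le_prev, Hf].
Qed.

Lemma fle_T3 (ws : list (R * (NE * PE))) a Q1 Q2 :
  wsum (map (fun x => (fst x, Dirac (Sum (fst (snd x)) (Pre a (snd (snd x)))))) ws) Q1 ->
  wsum (map (fun x => (fst x, snd (snd x))) ws) Q2 -> fle (Pre a Q2) (Pre tau Q1).
Proof.
  intros H1 H2 f b Hf; rewrite !weakv_pre by apply Hf; apply (wsum_compare H1 H2).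
  intro x; simpl; rewrite <- weakv_pre by apply Hf.
  eapply Rle_trans; [apply fle_sumr, Hf|apply weakv_le_prev, Hf].
Qed.

(** The comparison is made branch by branch, using the summand [tau.P_i]. For [a = b] its tau-step
    follows the required step, for [a = tau] different from [b] it precedes it, and otherwise the
    prefix contributes 0. *)
Lemma fle_T4 (ws : list (R * (NE * PE))) a Q1 Q2 :
  wsum (map (fun x => (fst x, Dirac (Sum (fst (snd x)) (Pre tau (snd (snd x)))))) ws) Q1 ->
  wsum (map (fun x => (fst x, snd (snd x))) ws) Q2 -> fle (Pre a Q2) (Pre a Q1).
Proof.
  intros H1 H2 f b Hf; rewrite !weakv_pre by apply Hf; apply (wsum_compare H1 H2).
  intros [r [E P]]; simpl; assert (H01 := inv_range Hf).
  destruct (excluded_middle_informative (a = b)) as [->|Hab].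
  - rewrite prev_same; replace (prev b b f) with (prev tau tau f)
      by (extensionality D; rewrite !prev_same; reflexivity).
    rewrite <- weakv_pre by assumption.
    eapply Rle_trans; [apply fle_sumr, Hf|apply weakv_le_V, Hf].
  - destruct (excluded_middle_informative (a = tau)) as [->|Ha].
    + rewrite <- weakv_pre by assumption.
      eapply Rle_trans; [apply fle_sumr, Hf|apply weakv_le_prev, Hf].
    + replace (prev b a f) with (fun _ : NE => 0); [rewrite expect_const; lra|].
      extensionality D; rewrite prev_other; auto.
Qed.

(** The expectation over the mixture is a convex combination of two numbers and so never exceeds
    their maximum. *)
Lemma feq_C a P Q p : feq (Sum (Pre a P) (Pre a Q)) (Sum (Sum (Pre a P) (Pre a (PCh p P Q))) (Pre a Q)).
Proof.
  intros f b Hf; rewrite !weakv_sum, !weakv_pre by apply Hf; cbn [expect].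
  destruct (pval_range p); unfold Rmax; repeat destruct Rle_dec; nra.
Qed.

Lemma feq_R3 E p P F :
  feq (Rec (Sum (Pre tau (PCh p (Dirac (Sum (Var Act 0) E)) P)) F))
      (Rec (Sum (Sum (Pre tau (PCh p (Dirac (Sum (Var Act 0) E)) P)) (Pre tau P)) F)).
Proof.
  set (body := Sum (Pre tau (PCh p (Dirac (Sum (Var Act 0) E)) P)) F).
  set (body' := Sum (Sum (Pre tau (PCh p (Dirac (Sum (Var Act 0) E)) P)) (Pre tau P)) F).
  apply feq_rec.
  - eapply fle_trans; [|apply fle_unfold]. unfold inst, body, body'; cbn [substN substP scons].
    apply fle_sum; [eapply fle_trans; [apply fle_suml|apply fle_suml]|apply fle_sumr].
  - set (A := Rec body).
    assert (HA : fle (inst body A) A) by apply fle_unfold.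
    eapply fle_trans; [|apply HA]. unfold inst, body, body' in *; cbn [substN substP scons] in *.
    set (s := scons A (Var Act)) in *.
    repeat apply fle_sum; [apply fle_suml| |apply fle_sumr].
    intros f a Hf; assert (H01 := inv_range Hf).
    assert (Hx := HA f a Hf); rewrite weakv_sum, !weakv_pre in Hx by assumption; cbn [expect] in Hx.
    rewrite weakv_sum, !weakv_pre by assumption; cbn [expect].
    set (e := expect (substP s P) (prev a tau f)) in *.
    set (u := prev a tau f (Sum A (substN s E))) in *.
    (* With [x] the value of [A], [p u + (1 - p) e <= x <= u]. Hence [e <= u], and [e] is at most
       the average, which is the value of the original summand. *)
    assert (Hu : weakv a f A <= u).
    { eapply Rle_trans; [apply fle_suml, Hf|apply weakv_le_prev, H01]. }
    eapply Rle_trans; [|apply Rmax_l].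
    destruct (pval_range p); unfold Rmax in Hx; destruct Rle_dec; nra.
Qed.

Lemma feq_R4 E : feq (Rec (Sum (Var Act 0) E)) (Rec E).
Proof.
  apply feq_rec.
  - unfold inst; cbn [substN scons]; apply fle_sum; [apply fle_refl|apply fle_unfold].
  - eapply fle_trans; [|apply fle_unfold]. unfold inst; cbn [substN scons]; apply fle_sumr.
Qed.

Lemma feq_R5 E : feq (Rec (Sum (Pre tau (Dirac (Var Act 0))) E)) (Rec (Pre tau (Dirac E))).
Proof.
  apply feq_rec.
  - set (B := Rec (Pre tau (Dirac E))).
    assert (HB : feq B (Pre tau (Dirac (inst E B)))) by apply feq_unfold.
    intros f a Hf; assert (H01 := inv_range Hf).
    unfold inst at 1; cbn [substN substP scons].
    rewrite (HB f a Hf), weakv_sum, !weakv_pre by assumption; cbn [expect].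
    change (substN (scons B (Var Act)) E) with (inst E B).
    (* [B] is congruent to a tau-prefix of [inst E B], and an invariant function does not see that
       prefix. *)
    assert (prev a tau f B = prev a tau f (inst E B)) as ->.
    { rewrite (feq_inv HB (inv_prev a tau Hf)). apply fsim_inv; [apply fsim_tau|apply inv_prev, Hf]. }
    apply Rmax_lub; [lra|apply weakv_le_prev, H01].
  - set (body := Sum (Pre tau (Dirac (Var Act 0))) E). set (A := Rec body).
    assert (HA : feq A (Sum (Pre tau (Dirac A)) (inst E A))) by apply feq_unfold.
    (* [A] has the moves of [inst E A] and a tau-loop, which [fsim_loop] removes. *)
    assert (Hsim : fsim A (inst E A)).
    { apply fsim_loop; intros a f Hf.
      unfold A; rewrite stepv_rec by assumption; reflexivity. }
    intros f a Hf; assert (H01 := inv_range Hf).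
    unfold inst; cbn [substN substP scons].
    change (substN (scons A (Var Act)) E) with (inst E A).
    rewrite (HA f a Hf), weakv_sum, !weakv_pre by assumption; cbn [expect].
    rewrite (fsim_inv Hsim (inv_prev a tau Hf)). apply Rmax_l.
Qed.

(** With [B] for the right-hand side, [B] absorbs every [E_i], so the choice over [B + E_i] is no
    better than the tau-loop. With [A] for the left-hand side, each [A + E_i] is worth at least [A]
    while their average is at most [A]; so [wsum_le_all] makes all of them worth exactly [A], and
    [A] absorbs every [E_i]. *)
Lemma feq_R6 (ws : list (R * NE)) F Q :
  wsum (map (fun x => (fst x, Dirac (Sum (Var Act 0) (snd x)))) ws) Q ->
  feq (Rec (Sum (Pre tau Q) F))
      (Rec (Sum (Sum (Pre tau (Dirac (Var Act 0))) (nsum (map snd ws))) F)).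
Proof.
  intro Hw.
  set (body := Sum (Pre tau Q) F).
  set (body' := Sum (Sum (Pre tau (Dirac (Var Act 0))) (nsum (map snd ws))) F).
  assert (Hws : forall K, wsum (map (fun x => (fst x, Dirac (Sum K (substN (scons K (Var Act)) (snd x))))) ws)
                       (substP (scons K (Var Act)) Q)).
  { intro K; pose proof (wsum_subst (scons K (Var Act)) Hw) as H; rewrite map_map in H; exact H. }
  apply feq_rec.
  - set (B := Rec body'). eapply fle_trans; [|apply fle_unfold].
    fold B; unfold inst, body, body'; cbn [substN substP scons].
    set (s := scons B (Var Act)) in *.
    apply fle_sum; [|apply fle_sumr].
    apply fle_trans with (Pre tau (Dirac B)); [|eapply fle_trans; [apply fle_suml|apply fle_suml]].
    assert (HE : forall x, In x ws -> feq B (Sum B (substN s (snd x)))).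
    { intros x Hx; apply feq_sym, feq_absorb. eapply fle_trans; [|apply fle_unfold].
      fold B; unfold inst, body'; cbn [substN substP scons]. fold s.
      eapply fle_trans; [|apply fle_suml]. eapply fle_trans; [|apply fle_sumr].
      rewrite substN_nsum, map_map. apply nsum_fle, in_map_iff; eauto. }
    intros f a Hf; rewrite !weakv_pre by apply Hf; cbn [expect].
    apply (wsum_le (Hws B)). intros y Hy; apply in_map_iff in Hy; destruct Hy as [x [<- Hx]].
    cbn [snd expect]; fold s. rewrite <- (feq_inv (HE x Hx) (inv_prev a tau Hf)). lra.
  - set (A := Rec body).
    assert (HA : fle (inst body A) A) by apply fle_unfold.
    unfold inst, body, body' in *; cbn [substN substP scons] in *.
    set (s := scons A (Var Act)) in *.
    assert (HQ : fle (Pre tau (substP s Q)) A) by (eapply fle_trans; [apply fle_suml|exact HA]).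
    assert (HF : fle (substN s F) A) by (eapply fle_trans; [apply fle_sumr|exact HA]).
    assert (HE : forall x, In x ws -> fle (substN s (snd x)) A).
    { intros x Hx f a Hf; assert (H01 := inv_range Hf).
      assert (HQf := HQ f a Hf); rewrite weakv_pre in HQf by assumption.
      assert (H := wsum_le_all (Hws A) (h := prev a tau f) (c := weakv a f A)).
      specialize (fun H1 => H H1 HQf).
      eapply Rle_trans; [apply fle_sumr, Hf|]. eapply Rle_trans; [apply weakv_le_prev, H01|].
      apply H with (x := (fst x, Dirac (Sum A (substN s (snd x))))).
      - intros y Hy; apply in_map_iff in Hy; destruct Hy as [z [<- _]]; cbn [snd expect].
        eapply Rle_trans; [apply fle_suml, Hf|apply weakv_le_prev, H01].
      - apply in_map_iff; eauto. }
    repeat apply fle_sum; [| |exact HF].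
    + intros f a Hf; rewrite weakv_pre by apply Hf; cbn [expect].
      eapply Rle_trans; [|apply (HQ f a Hf)]. rewrite weakv_pre by apply Hf.
      apply (wsum_ge (Hws A)); intros y Hy; apply in_map_iff in Hy; destruct Hy as [x [<- Hx]].
      cbn [snd expect]; fold s. rewrite (feq_inv (feq_absorb (HE x Hx)) (inv_prev a tau Hf)); lra.
    + rewrite substN_nsum, map_map; apply fle_nsum; intros E HEin.
      apply in_map_iff in HEin; destruct HEin as [x [<- Hx]]; auto.
Qed.

(** Quantifying over all substitutions allows the congruence case for rec to use the induction
    hypothesis on the bodies with the recursive expression substituted for index 0. *)
Theorem eqN_feq :
  (forall E F, eqN tau E F -> forall s, feq (substN s E) (substN s F)) /\
  (forall P Q, eqP tau P Q -> forall s, peq (substP s P) (substP s Q)).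
Proof.
  apply eqN_eqP_ind; intros; cbn [substN substP].
  - intros f b Hf; reflexivity.
  - apply feq_sym; auto.
  - eapply feq_trans; eauto.
  - apply feq_pre; auto.
  - apply feq_rec; (eapply fle_trans; [|apply fle_unfold]); rewrite !inst_up; apply feq_fle; auto.
    apply feq_sym; auto.
  - intros f b Hf; rewrite !weakv_sum by apply Hf; f_equal; [apply H0|apply H2]; assumption.
  - intros f b Hf; rewrite !weakv_sum by apply Hf; apply Rmax_comm.
  - intros f b Hf; rewrite !weakv_sum by apply Hf; apply Rmax_assoc.
  - intros f b Hf; rewrite !weakv_sum by apply Hf; rmax.
  - intros f b Hf; rewrite weakv_sum, weakv_nil by apply Hf; apply Rmax_left, weakv_ge0.
  - apply feq_pre, peq_T1.
  - apply feq_absorb. apply (@fle_T2 (map (fun x => (fst x, substN s (snd x))) ws)).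
    apply (wsum_subst s) in H; rewrite map_map in *; exact H.
  - apply feq_absorb.
    apply (@fle_T3 (map (fun x => (fst x, (substN s (fst (snd x)), substP s (snd (snd x))))) ws)).
    + apply (wsum_subst s) in H; rewrite map_map in *; exact H.
    + apply (wsum_subst s) in H0; rewrite map_map in *; exact H0.
  - apply feq_absorb.
    apply (@fle_T4 (map (fun x => (fst x, (substN s (fst (snd x)), substP s (snd (snd x))))) ws)).
    + apply (wsum_subst s) in H; rewrite map_map in *; exact H.
    + apply (wsum_subst s) in H0; rewrite map_map in *; exact H0.
  - apply feq_C.
  - rewrite substN_inst; apply feq_unfold.
  (* [F] and the recursive expression both solve the equation given by [E], the former by the
     induction hypothesis, the latter by unfolding. *)
  - apply (@feq_guarded _ _ s E).
    + pose proof (H0 s) as H2; rewrite substN_inst, inst_up in H2; exact H2.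
    + pose proof (@feq_unfold _ tau (substN (upsub s) E)) as H2; rewrite inst_up in H2; exact H2.
    + apply guarded_reachv; assumption.
  - apply feq_R3.
  - apply feq_R4.
  - apply feq_R5.
  - rewrite substN_nsum, map_map; cbn [upsub].
    pose proof (@feq_R6 (map (fun x => (fst x, substN (upsub s) (snd x))) ws)
      (substN (upsub s) F) (substP (upsub s) Q)) as H1.
    rewrite !map_map in H1; apply H1.
    apply (wsum_subst (upsub s)) in H; rewrite map_map in H; exact H.
  - intros f Hf; reflexivity.
  - intros f Hf; symmetry; apply H0; exact Hf.
  - intros f Hf; rewrite (H0 s f Hf); apply H2; exact Hf.
  - intros f Hf; simpl; eapply feq_inv; [apply H0|exact Hf].
  - intros f Hf; simpl; rewrite (H0 s f Hf), (H2 s f Hf); reflexivity.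
  - intros f Hf; simpl; rewrite H; ring.
  - intros f Hf; simpl.
    pose proof (pval_range p); pose proof (pval_range c).
    rewrite H, H0, H1; field; lra.
  - intros f Hf; simpl; ring.
Qed.

End Soundness.

(** * Transitions and combinations *)

Section Transitions.
Variable Act : Type.
Local Notation NE := (NE Act).
Local Notation PE := (PE Act).
Local Notation dist := (dist Act).
Implicit Types (E C D : NE) (P Q : PE) (s : nat -> NE) (a b : Act) (f : NE -> R).

Fixpoint pdist P : dist :=
  match P with
  | Dirac E => dirac E
  | PCh p P1 P2 => fun D => pval p * pdist P1 D + (1 - pval p) * pdist P2 D
  end.

Lemma pstep_pdist P : pstep P (pdist P).
Proof. induction P; simpl; constructor; assumption. Qed.

Lemma pstep_inv P mu : pstep P mu -> mu = pdist P.
Proof. induction 1; simpl; subst; reflexivity. Qed.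

Fixpoint moves E : list (Act * PE) :=
  match E with
  | Nil _ => []
  | Var _ _ => []
  | Pre a P => [(a, P)]
  | Rec E1 => map (fun m => (fst m, substP (scons (Rec E1) (Var Act)) (snd m))) (moves E1)
  | Sum E1 E2 => moves E1 ++ moves E2
  end.

Fixpoint exposed E (n : nat) : Prop :=
  match E with
  | Nil _ => False
  | Var _ m => n = m
  | Pre _ _ => False
  | Rec E1 => exposed E1 (S n)
  | Sum E1 E2 => exposed E1 n \/ exposed E2 n
  end.

Lemma moves_ren E (r : nat -> nat) :
  moves (renN r E) = map (fun m => (fst m, renP r (snd m))) (moves E).
Proof.
  revert r; apply (NE_mut (P := fun E => forall r : nat -> nat,
    moves (renN r E) = map (fun m => (fst m, renP r (snd m))) (moves E))
    (P0 := fun _ => True)); simpl; intros; auto.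
  - rewrite H, !map_map; apply map_ext; intros [a P]; simpl; f_equal.
    rewrite (proj2 (subst_ren Act)), (proj2 (ren_subst Act)); f_equal.
    extensionality m; destruct m; reflexivity.
  - rewrite H, H0, map_app; reflexivity.
Qed.

Lemma moves_subst C a P : forall s, In (a, P) (moves (substN s C)) ->
  (exists P', In (a, P') (moves C) /\ P = substP s P') \/
  (exists n, exposed C n /\ In (a, P) (moves (s n))).
Proof.
  revert a P; apply (NE_mut (P := fun C => forall a P s, In (a, P) (moves (substN s C)) ->
    (exists P', In (a, P') (moves C) /\ P = substP s P') \/
    (exists n, exposed C n /\ In (a, P) (moves (s n)))) (P0 := fun _ => True)); simpl; intros; auto; try tauto.
  - right; exists n; auto.
  - destruct H0 as [[= <- <-]|[]]; eauto.
  - apply in_map_iff in H0; destruct H0 as [[b Q] [[= -> <-] HQ]].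
    destruct (H _ _ _ HQ) as [[P' [H1 ->]]|[[|m] [H1 H2]]].
    + left; eexists; split; [apply in_map_iff; exists (a, P'); split; [reflexivity|assumption]|].
      simpl. rewrite !(proj2 (subst_subst Act)); f_equal; extensionality m.
      destruct m; simpl; [reflexivity|]. rewrite substN_renN; apply (proj1 (subst_Var Act)).
    + destruct H2.
    + right; exists m; split; [assumption|]. simpl in H2; rewrite moves_ren in H2.
      apply in_map_iff in H2; destruct H2 as [[b R] [[= -> <-] HR]].
      rewrite (proj2 (subst_ren Act)); simpl. rewrite (proj2 (subst_Var Act)); assumption.
  - apply in_app_or in H1; destruct H1 as [H1|H1]; [apply H in H1|apply H0 in H1];
      (destruct H1 as [[P' [H1 ->]]|[m [H1 H2]]]; [left; exists P'|right; exists m]);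
      split; auto; apply in_or_app; auto.
Qed.

Lemma moves_inst_rec E m : In m (moves (inst E (Rec E))) -> In m (moves (Rec E)).
Proof.
  destruct m as [a P]; intro H; apply moves_subst in H; destruct H as [[P' [H1 ->]]|[[|n] [H1 H2]]].
  - simpl; apply in_map_iff; exists (a, P'); auto.
  - exact H2.
  - destruct H2.
Qed.

Lemma nstep_moves E a mu : nstep E a mu -> exists P, In (a, P) (moves E) /\ mu = pdist P.
Proof.
  induction 1 as [a P mu H|E a mu _ [P [H1 H2]]|E F a mu _ [P [H1 H2]]|E F a mu _ [P [H1 H2]]].
  - exists P; split; [left; reflexivity|apply pstep_inv; assumption].
  - exists P; split; [apply moves_inst_rec|]; assumption.
  - exists P; split; [apply in_or_app; left|]; assumption.
  - exists P; split; [apply in_or_app; right|]; assumption.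
Qed.

(** Generalised over [s] because the rule for rec leads to the body instantiated with the recursive
    expression. *)
Lemma moves_nstep_subst C a P :
  forall s, In (a, P) (moves C) -> nstep (substN s C) a (pdist (substP s P)).
Proof.
  revert a P; apply (NE_mut (P := fun C => forall a P s, In (a, P) (moves C) ->
    nstep (substN s C) a (pdist (substP s P))) (P0 := fun _ => True)); simpl; intros; auto; try tauto.
  - destruct H0 as [[= <- <-]|[]]; constructor; apply pstep_pdist.
  - apply in_map_iff in H0; destruct H0 as [[b Q] [[= -> <-] HQ]].
    constructor; rewrite inst_up, (proj2 (subst_subst Act)).
    replace (fun n0 => substN s (scons (Rec n) (Var Act) n0)) with (scons (Rec (substN (upsub s) n)) s)
      by (extensionality m; destruct m; reflexivity).
    apply H; assumption.
  - apply in_app_or in H1; destruct H1; [apply ns_suml|apply ns_sumr]; auto.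
Qed.

Lemma moves_nstep E a P : In (a, P) (moves E) -> nstep E a (pdist P).
Proof.
  intro H; rewrite <- (proj1 (subst_Var Act) E), <- (proj2 (subst_Var Act) P).
  apply moves_nstep_subst; assumption.
Qed.

Lemma stepv_ge E a P f : In (a, P) (moves E) -> expect P f <= stepv a E f.
Proof.
  revert P f; apply (NE_mut (P := fun E => forall P f, In (a, P) (moves E) ->
    expect P f <= stepv a E f) (P0 := fun _ => True)); simpl; intros; auto; try tauto.
  - destruct H0 as [[= <- <-]|[]]; destruct excluded_middle_informative; [lra|congruence].
  - apply in_map_iff in H0; destruct H0 as [[b Q] [[= -> <-] HQ]].
    simpl; rewrite expect_subst; apply (H Q); assumption.
  - apply in_app_or in H1; destruct H1 as [H1|H1]; [apply (H P f) in H1|apply (H0 P f) in H1]; rmax.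
Qed.

Lemma stepv_attained E a f :
  stepv a E f = 0 \/ exists P, In (a, P) (moves E) /\ stepv a E f = expect P f.
Proof.
  revert f; apply (NE_mut (P := fun E => forall f,
    stepv a E f = 0 \/ exists P, In (a, P) (moves E) /\ stepv a E f = expect P f)
    (P0 := fun _ => True)); simpl; intros; auto.
  - destruct excluded_middle_informative as [<-|]; [|auto]. right; eauto.
  - destruct (H (fun D => f (inst D (Rec n)))) as [|[P [H1 H2]]]; [auto|right].
    eexists; split; [apply in_map_iff; exists (a, P); split; [reflexivity|assumption]|].
    simpl; rewrite expect_subst; assumption.
  - unfold Rmax; destruct Rle_dec;
      [destruct (H0 f) as [|[P [H1 H2]]]|destruct (H f) as [|[P [H1 H2]]]]; auto;
      right; exists P; (split; [apply in_or_app; auto|assumption]).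
Qed.

Fixpoint supp P : list NE :=
  match P with
  | Dirac E => [E]
  | PCh _ P1 P2 => supp P1 ++ supp P2
  end.

(* Finitely many expressions suffice: der is closed under taking derivatives, see der_moves. *)
Fixpoint der E : list NE :=
  match E with
  | Nil _ => []
  | Var _ _ => []
  | Pre _ P => derP P
  | Rec E1 => map (fun D => inst D (Rec E1)) (der E1)
  | Sum E1 E2 => der E1 ++ der E2
  end
with derP P : list NE :=
  match P with
  | Dirac E => E :: der E
  | PCh _ P1 P2 => derP P1 ++ derP P2
  end.

Lemma supp_subst s P : supp (substP s P) = map (substN s) (supp P).
Proof. induction P; simpl; [reflexivity|]. rewrite IHP1, IHP2, map_app; reflexivity. Qed.

Lemma der_moves :
  (forall E, (forall a P, In (a, P) (moves E) -> incl (supp P) (der E)) /\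
     (forall D a P, In D (der E) -> In (a, P) (moves D) -> incl (supp P) (der E))) /\
  (forall P, incl (supp P) (derP P) /\
     (forall D a Q, In D (derP P) -> In (a, Q) (moves D) -> incl (supp Q) (derP P))).
Proof.
  apply NE_PE_ind; simpl.
  - split; intros; tauto.
  - split; intros; tauto.
  - intros a P [H1 H2]; split; [|assumption].
    intros b Q [[= <- <-]|[]]; assumption.
  - intros E [H1 H2].
    assert (HA : forall a P, In (a, P) (moves (Rec E)) ->
              incl (supp P) (map (fun D => inst D (Rec E)) (der E))).
    { intros a P H; simpl in H; apply in_map_iff in H; destruct H as [[b Q] [[= -> <-] HQ]].
      simpl; rewrite supp_subst; intros D HD; apply in_map_iff in HD; destruct HD as [D' [<- HD']].
      apply in_map_iff; exists D'; split; [reflexivity|]. apply (H1 _ _ HQ); assumption. }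
    split; [exact HA|].
    intros D a P HD HP; apply in_map_iff in HD; destruct HD as [D' [<- HD']].
    apply moves_subst in HP; destruct HP as [[P' [HP ->]]|[[|n] [_ HP]]].
    + rewrite supp_subst; intros C HC; apply in_map_iff in HC; destruct HC as [C' [<- HC']].
      apply in_map_iff; exists C'; split; [reflexivity|]. apply (H2 _ _ _ HD' HP); assumption.
    + apply (HA a P); assumption.
    + destruct HP.
  - intros E [H1 H2] F [H3 H4]; split.
    + intros a P H; apply in_app_or in H; destruct H as [H|H];
        [apply incl_appl, (H1 _ _ H)|apply incl_appr, (H3 _ _ H)].
    + intros D a P HD HP; apply in_app_or in HD; destruct HD as [HD|HD];
        [apply incl_appl, (H2 _ _ _ HD HP)|apply incl_appr, (H4 _ _ _ HD HP)].
  - intros E [H1 H2]; split.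
    + intros D [<-|[]]; left; reflexivity.
    + intros D a Q [<-|HD] HQ; apply incl_tl; eauto.
  - intros p P [H1 H2] Q [H3 H4]; split.
    + apply incl_app; [apply incl_appl|apply incl_appr]; assumption.
    + intros D a S HD HP; apply in_app_or in HD; destruct HD as [HD|HD];
        [apply incl_appl, (H2 _ _ _ HD HP)|apply incl_appr, (H4 _ _ _ HD HP)].
Qed.

Lemma der_closed :
  (forall E k, closedN k E -> forall D, In D (der E) -> closedN k D) /\
  (forall P k, closedP k P -> forall D, In D (derP P) -> closedN k D).
Proof.
  apply NE_PE_ind; simpl; intros; try tauto; eauto.
  - apply in_map_iff in H1; destruct H1 as [D' [<- H1]].
    eapply (proj1 (closed_subst Act)); [apply (H (S k)); assumption|].
    intros [|m] Hm; simpl; [assumption|lia].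
  - apply in_app_or in H2; destruct H1, H2; eauto.
  - destruct H1 as [<-|H1]; eauto.
  - apply in_app_or in H2; destruct H1, H2; eauto.
Qed.

End Transitions.

(** * Infinite sums and countable convex combinations *)

Section Combinations.

Lemma infsum_ext (g g' : nat -> R) l : (forall i, g i = g' i) -> infinite_sum g l -> infinite_sum g' l.
Proof. intros H; replace g' with g by (extensionality i; apply H); auto. Qed.

Lemma infsum_plus (g g' : nat -> R) l l' : infinite_sum g l -> infinite_sum g' l' ->
  infinite_sum (fun i => g i + g' i) (l + l').
Proof.
  intros H H'; pose proof (CV_plus _ _ _ _ H H') as H0.
  intros eps Heps; destruct (H0 eps Heps) as [N HN]; exists N; intros n Hn.
  rewrite sum_plus; apply HN; assumption.
Qed.

Lemma infsum_scal (g : nat -> R) c l : infinite_sum g l -> infinite_sum (fun i => c * g i) (c * l).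
Proof.
  intros H. assert (Hc : Un_cv (fun _ => c) c).
  { intros eps Heps; exists 0%nat; intros; rewrite Rdist_eq; assumption. }
  pose proof (CV_mult _ _ _ _ Hc H) as H0.
  intros eps Heps; destruct (H0 eps Heps) as [N HN]; exists N; intros n Hn.

  replace (sum_f_R0 (fun i => c * g i) n) with (c * sum_f_R0 g n); [apply HN; assumption|].
  rewrite scal_sum; apply sum_eq; intros; ring.
Qed.

Lemma infsum_zero : infinite_sum (fun _ => 0) 0.
Proof.
  intros eps Heps; exists 0%nat; intros n _.
  rewrite sum_cte, Rmult_0_l, Rdist_eq; assumption.
Qed.

Lemma infsum_lsum A (l : list A) (g : A -> nat -> R) (L : A -> R) :
  (forall x, In x l -> infinite_sum (g x) (L x)) ->
  infinite_sum (fun i => lsum (fun x => g x i) l) (lsum L l).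
Proof.
  induction l as [|x l IH]; simpl; intro H; [apply infsum_zero|].
  apply infsum_plus; auto.
Qed.

Lemma sum_cons (g : nat -> R) x n :
  sum_f_R0 (fun i => match i with O => x | S j => g j end) (S n) = x + sum_f_R0 g n.
Proof. induction n; [reflexivity|]. rewrite tech5, IHn; simpl; ring. Qed.

Lemma infsum_cons (g : nat -> R) x l : infinite_sum g l ->
  infinite_sum (fun i => match i with O => x | S j => g j end) (x + l).
Proof.
  intros H eps Heps; destruct (H eps Heps) as [N HN]; exists (S N).
  intros [|n] Hn; [lia|]. rewrite sum_cons.
  specialize (HN n ltac:(lia)). unfold Rdist in *.
  replace (x + sum_f_R0 g n - (x + l)) with (sum_f_R0 g n - l) by ring; assumption.
Qed.

(** Turns a finite family into the sequence that [is_comb] asks for. Weights are padded with 0, so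
    the padding of the distributions does not matter. *)
Definition nthd A B (l : list A) (g : A -> B) (d : B) (i : nat) : B :=
  match nth_error l i with Some x => g x | None => d end.

Lemma infsum_nthd A (l : list A) (g : A -> R) : infinite_sum (nthd l g 0) (lsum g l).
Proof.
  induction l as [|x l IH]; simpl.
  - eapply infsum_ext; [|apply infsum_zero]. intros [|i]; reflexivity.
  - eapply infsum_ext; [|apply (infsum_cons (g x) IH)]. intros [|i]; reflexivity.
Qed.

Lemma sum_le_infsum (g : nat -> R) l n : (forall i, 0 <= g i) -> infinite_sum g l -> sum_f_R0 g n <= l.
Proof.
  intros H0 H; apply (growing_ineq (sum_f_R0 g)); [|assumption].
  intro m; simpl; specialize (H0 (S m)); lra.
Qed.

Lemma nthd_ge0 A (l : list A) (w : A -> R) i : (forall x, In x l -> 0 <= w x) -> 0 <= nthd l w 0 i.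
Proof.
  intro H; unfold nthd; destruct (nth_error l i) eqn:Hi; [|lra].
  apply H, (nth_error_In _ _ Hi).
Qed.

Variable Act : Type.
Local Notation NE := (NE Act).
Local Notation dist := (dist Act).

Section Lists.
Variables (A : Type) (l : list A) (w : A -> R).
Hypothesis Hw : forall x, In x l -> 0 <= w x.
Hypothesis Hw1 : lsum w l <= 1.

Lemma weights_nthd : weights (nthd l w 0).
Proof.
  split; [intro; apply nthd_ge0; assumption|].
  intro n; eapply Rle_trans; [|apply Hw1].
  apply sum_le_infsum; [intro; apply nthd_ge0; assumption|apply infsum_nthd].
Qed.

Lemma is_comb_nthd (mus : A -> dist) (mu : dist) :
  (forall s, mu s = lsum (fun x => w x * mus x s) l) ->
  is_comb (nthd l w 0) (nthd l mus (fun _ => 0)) mu.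
Proof.
  intros H s; rewrite H; eapply infsum_ext; [|apply infsum_nthd].
  intro i; unfold nthd; destruct nth_error; ring.
Qed.

Lemma ctrans_list a (nus mus : A -> dist) (nu mu : dist) :
  (forall x, In x l -> 0 < w x -> ctrans (nus x) a (mus x)) ->
  (forall s, nu s = lsum (fun x => w x * nus x s) l) ->
  (forall s, mu s = lsum (fun x => w x * mus x s) l) ->
  ctrans nu a mu.
Proof.
  intros H Hn Hm; eapply ct_comb;
    [apply weights_nthd| |apply is_comb_nthd, Hn|apply is_comb_nthd, Hm].
  intros i; unfold nthd; destruct (nth_error l i) eqn:Hi; intro; [|lra].
  apply H; [apply (nth_error_In _ _ Hi)|assumption].
Qed.

Lemma lift_list (Rl : NE -> NE -> Prop) (nus mus : A -> dist) (nu mu : dist) :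
  (forall x, In x l -> 0 < w x -> lift Rl (nus x) (mus x)) ->
  (forall s, nu s = lsum (fun x => w x * nus x s) l) ->
  (forall s, mu s = lsum (fun x => w x * mus x s) l) ->
  lift Rl nu mu.
Proof.
  intros H Hn Hm; eapply lift_comb;
    [apply weights_nthd| |apply is_comb_nthd, Hn|apply is_comb_nthd, Hm].
  intros i; unfold nthd; destruct (nth_error l i) eqn:Hi; intro; [|lra].
  apply H; [apply (nth_error_In _ _ Hi)|assumption].
Qed.

Lemma subdist_list (mus : A -> dist) : (forall x, In x l -> subdist (mus x)) ->
  subdist (fun s => lsum (fun x => w x * mus x s) l).
Proof.
  intro H; split.
  - intro s; replace 0 with (lsum (fun _ : A => 0 * 0) l) by (rewrite lsum_scal; ring).
    apply lsum_le; intros x Hx; rewrite Rmult_0_l; apply Rmult_le_pos; [auto|apply H; assumption].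
  - intros m Hm; eapply Rle_trans; [|apply Hw1].
    apply Rle_trans with (lsum (fun x => w x * sum_list (mus x) m) l).
    + clear Hm; induction m as [|s m IH]; simpl.
      * right; symmetry; rewrite (lsum_ext (g' := fun x => 0 * w x)), lsum_scal by (intros; ring); ring.
      * rewrite (lsum_ext (g := fun x => w x * (mus x s + sum_list (mus x) m))
                   (g' := fun x => w x * mus x s + w x * sum_list (mus x) m)) by (intros; ring).
        rewrite lsum_plus; lra.
    + apply lsum_le; intros x Hx; pose proof (proj2 (H x Hx) m Hm); pose proof (Hw Hx); nra.
Qed.

Lemma wtau_list (tau : Act) (mus nus : A -> dist) (mu nu : dist) :
  (forall x, In x l -> wtau tau (mus x) (nus x)) ->
  (forall s, mu s = lsum (fun x => w x * mus x s) l) ->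
  (forall s, nu s = lsum (fun x => w x * nus x s) l) ->
  wtau tau mu nu.
Proof.
  intros H Hm Hn.
  (* Choice needs a witness for every [x]; outside [l] the zero sequences serve as a dummy. *)
  assert (Hc : forall x, exists d : (nat -> dist) * (nat -> dist), In x l ->
    derivation tau (fst d) (snd d) /\ (forall s, mus x s = fst d O s + snd d O s) /\
    (forall s, infinite_sum (fun i => snd d i s) (nus x s))).
  { intro x; destruct (excluded_middle_informative (In x l)) as [Hx|Hx].
    - destruct (H x Hx) as [mt [mx H']]; exists (mt, mx); intros _; exact H'.
    - exists (fun _ _ => 0, fun _ _ => 0); intro; contradiction. }
  set (d := fun x => proj1_sig (constructive_indefinite_description _ (Hc x))).
  assert (Hd : forall x, In x l ->
    derivation tau (fst (d x)) (snd (d x)) /\ (forall s, mus x s = fst (d x) O s + snd (d x) O s) /\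
    (forall s, infinite_sum (fun i => snd (d x) i s) (nus x s))).
  { intro x; exact (proj2_sig (constructive_indefinite_description _ (Hc x))). }
  exists (fun i s => lsum (fun x => w x * fst (d x) i s) l),
         (fun i s => lsum (fun x => w x * snd (d x) i s) l).
  split; [split|split].
  - intro i; split; apply subdist_list; intros x Hx; apply (proj1 (proj1 (Hd x Hx))).
  - intro i; apply ctrans_list with (nus := fun x => fst (d x) i)
      (mus := fun x s => fst (d x) (S i) s + snd (d x) (S i) s).
    + intros x Hx _; apply (proj2 (proj1 (Hd x Hx))).
    + reflexivity.
    + intro s; rewrite <- lsum_plus; apply lsum_ext; intros; ring.
  - intro s; rewrite Hm, <- lsum_plus; apply lsum_ext; intros x Hx.
    rewrite (proj1 (proj2 (Hd x Hx)) s); ring.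
  - intro s; rewrite Hn; apply infsum_lsum; intros x Hx; apply infsum_scal, (Hd x Hx).
Qed.

End Lists.
End Combinations.

(** * Finite lists and enumeration of choice functions *)

Section FiniteLists.

Lemma lsum_swap A B (g : A -> B -> R) l l' :
  lsum (fun x => lsum (g x) l') l = lsum (fun y => lsum (fun x => g x y) l) l'.
Proof.
  induction l as [|x l IH]; simpl.
  - induction l'; simpl; [reflexivity|]. rewrite <- IHl'; ring.
  - rewrite IH, <- lsum_plus; reflexivity.
Qed.

Lemma lsum_ge0 A (g : A -> R) l : (forall x, In x l -> 0 <= g x) -> 0 <= lsum g l.
Proof.
  intro H; replace 0 with (lsum (fun _ : A => 0 * 0) l) by (rewrite lsum_scal; ring).
  apply lsum_le; intros x Hx; rewrite Rmult_0_l; auto.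
Qed.

Lemma lsum_zero A (g : A -> R) l : (forall x, In x l -> g x = 0) -> lsum g l = 0.
Proof. induction l; simpl; intro H; [reflexivity|]. rewrite H, IHl; auto; ring. Qed.

Lemma lsum_ge_term A (g : A -> R) l x : (forall x, In x l -> 0 <= g x) -> In x l -> g x <= lsum g l.
Proof.
  induction l as [|y l IH]; simpl; intros H Hx; [destruct Hx|].
  assert (0 <= lsum g l) by (apply lsum_ge0; auto).
  destruct Hx as [->|Hx]; [lra|]. pose proof (H y (or_introl eq_refl)).
  assert (g x <= lsum g l) by auto. lra.
Qed.

Lemma list_choice A B (Q : A -> B -> Prop) l : (forall x, In x l -> exists y, Q x y) ->
  exists l', (forall y, In y l' -> exists x, In x l /\ Q x y) /\
             (forall x, In x l -> exists y, In y l' /\ Q x y).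
Proof.
  induction l as [|x l IH]; intro H.
  - exists []; split; intros ? [].
  - destruct IH as [l' [H1 H2]]; [intros; apply H; right; assumption|].
    destruct (H x (or_introl eq_refl)) as [y Hy]. exists (y :: l'); split.
    + intros z [<-|Hz]; [exists x; split; [left; reflexivity|assumption]|].
      destruct (H1 z Hz) as [u [Hu HQ]]; exists u; split; [right|]; assumption.
    + intros z [<-|Hz]; [exists y; split; [left; reflexivity|assumption]|].
      destruct (H2 z Hz) as [u [Hu HQ]]; exists u; split; [right|]; assumption.
Qed.

Lemma list_argmax A (g : A -> R) l x : In x l -> exists y, In y l /\ forall z, In z l -> g z <= g y.
Proof.
  revert x; induction l as [|u l IH]; intros x Hx; [destruct Hx|].
  destruct l as [|v l].
  - exists u; split; [left; reflexivity|]. intros z [<-|[]]; lra.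
  - destruct (IH v (or_introl eq_refl)) as [y [Hy H]].
    destruct (Rle_dec (g u) (g y)).
    + exists y; split; [right; assumption|]. intros z [<-|Hz]; auto.
    + exists u; split; [left; reflexivity|]. intros z [<-|Hz]; [lra|]. specialize (H z Hz); lra.
Qed.

Lemma infsum_le (g : nat -> R) l b : (forall n, sum_f_R0 g n <= b) -> infinite_sum g l -> l <= b.
Proof.
  intros H Hg; apply Rnot_lt_le; intro Hlt.
  destruct (Hg (l - b)) as [N HN]; [lra|]. specialize (HN N (le_n N)). specialize (H N).
  unfold Rdist in HN; apply Rabs_def2 in HN; lra.
Qed.

Section Choices.
Variables (A X : Type) (dflt : X) (ch : A -> list X).

(** Applied to the tau-moves of a finite state set, this is the finite set of memoryless policies;
    the common value [dflt] off [l] keeps it finite. *)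
Fixpoint choices (l : list A) : list (A -> X) :=
  match l with
  | [] => [fun _ => dflt]
  | x :: l' => flat_map (fun phi =>
      map (fun c y => if excluded_middle_informative (y = x) then c else phi y) (ch x)) (choices l')
  end.

Lemma choices_in l phi x : In phi (choices l) -> In x l -> In (phi x) (ch x).
Proof.
  revert phi; induction l as [|y l IH]; intros phi Hp Hx; [destruct Hx|].
  apply in_flat_map in Hp; destruct Hp as [psi [Hpsi Hp]].
  apply in_map_iff in Hp; destruct Hp as [c [<- Hc]].
  destruct excluded_middle_informative as [->|Hne]; [assumption|].
  destruct Hx as [<-|Hx]; [congruence|]. apply IH; assumption.
Qed.

Lemma choices_all l (g : A -> X) : (forall x, In x l -> In (g x) (ch x)) ->
  exists phi, In phi (choices l) /\ forall x, In x l -> phi x = g x.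
Proof.
  induction l as [|y l IH]; intro H.
  - exists (fun _ => dflt); split; [left; reflexivity|intros ? []].
  - destruct IH as [phi [Hphi Heq]]; [intros; apply H; right; assumption|].
    exists (fun z => if excluded_middle_informative (z = y) then g y else phi z); split.
    + apply in_flat_map; exists phi; split; [assumption|].
      apply in_map_iff; exists (g y); split; [reflexivity|]. apply H; left; reflexivity.
    + intros x Hx; destruct excluded_middle_informative as [->|Hne]; [reflexivity|].
      destruct Hx as [<-|Hx]; [congruence|]; auto.
Qed.

End Choices.
End FiniteLists.

(** * Optimal policies *)

Section Attainment.
Variable Act : Type.
Variable tau : Act.
Local Notation NE := (NE Act).
Local Notation PE := (PE Act).
Local Notation dist := (dist Act).
Local Notation tauv := (tauv tau).
Local Notation V := (tauv 1).
Local Notation weakv := (weakv tau).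
Implicit Types (E F D : NE) (P Q : PE) (a : Act) (f g v : NE -> R) (mu nu : dist).

Lemma dirac_same E : dirac E E = 1.
Proof. unfold dirac; destruct excluded_middle_informative; congruence. Qed.

Lemma dirac_ne E D : D <> E -> dirac E D = 0.
Proof. intro; unfold dirac; destruct excluded_middle_informative; congruence. Qed.

Lemma dirac_ge0 E D : 0 <= dirac E D.
Proof. unfold dirac; destruct excluded_middle_informative; lra. Qed.

Lemma lsum_dirac l E f : NoDup l -> In E l -> lsum (fun s => dirac E s * f s) l = f E.
Proof.
  induction 1 as [|D l HD Hl IH]; intro HE; [destruct HE|]. simpl.
  destruct HE as [->|HE].
  - rewrite dirac_same, lsum_zero; [ring|].
    intros x Hx; rewrite dirac_ne; [ring|]. intros ->; contradiction.
  - rewrite IH, dirac_ne by (assumption || (intros ->; contradiction)); ring.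
Qed.

Lemma pdist_ge0 P s : 0 <= pdist P s.
Proof.
  induction P as [E|p P IHP Q IHQ]; simpl; [apply dirac_ge0|].
  destruct (pval_range p); nra.
Qed.

Lemma pdist_out P s : ~ In s (supp P) -> pdist P s = 0.
Proof.
  induction P as [E|p P IHP Q IHQ]; simpl; intro H.
  - apply dirac_ne; intros ->; tauto.
  - rewrite IHP, IHQ by (intro; apply H, in_or_app; auto); ring.
Qed.

Lemma lsum_pdist l P f : NoDup l -> incl (supp P) l ->
  lsum (fun s => pdist P s * f s) l = expect P f.
Proof.
  intro Hl; induction P as [E|p P IHP Q IHQ]; simpl; intro H.
  - apply lsum_dirac; [assumption|apply H; left; reflexivity].
  - apply incl_app_inv in H; destruct H as [H1 H2]; rewrite <- IHP, <- IHQ, <- !lsum_scal, <- lsum_plus by assumption.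
    apply lsum_ext; intros; ring.
Qed.

Variable L : list NE.
Hypothesis HL : NoDup L.
Hypothesis HLm : forall D a P, In D L -> In (a, P) (moves D) -> incl (supp P) L.

Definition dot nu f : R := lsum (fun s => nu s * f s) L.

Lemma dirac_decomp mu : (forall s, ~ In s L -> mu s = 0) ->
  forall s, mu s = lsum (fun E => mu E * dirac E s) L.
Proof.
  intros H s. destruct (excluded_middle_informative (In s L)) as [Hs|Hs].
  - rewrite <- (lsum_dirac mu HL Hs) at 1. apply lsum_ext; intros E _.
    unfold dirac; repeat destruct excluded_middle_informative; subst; try ring; congruence.
  - rewrite H by assumption; symmetry; apply lsum_zero; intros E HE.
    rewrite dirac_ne by (intros ->; contradiction); ring.
Qed.

Lemma subdist_dirac E : subdist (dirac E).
Proof.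
  split; [apply dirac_ge0|]. intros l Hl.
  replace (sum_list (dirac E) l) with (lsum (dirac E) l) by (clear; induction l; simpl; congruence).
  destruct (excluded_middle_informative (In E l)) as [HE|HE].
  - right; rewrite <- (lsum_dirac (fun _ => 1) Hl HE); apply lsum_ext; intros; ring.
  - rewrite lsum_zero; [lra|]. intros x Hx; apply dirac_ne; intros ->; contradiction.
Qed.

Lemma subdist_finite mu : (forall s, 0 <= mu s) -> (forall s, ~ In s L -> mu s = 0) ->
  lsum mu L <= 1 -> subdist mu.
Proof.
  intros H0 Hout H1.
  replace mu with (fun s => lsum (fun E => mu E * dirac E s) L)
    by (extensionality s; symmetry; apply dirac_decomp, Hout).
  apply subdist_list; auto. intros; apply subdist_dirac.
Qed.

Definition fin nu : Prop := (forall s, 0 <= nu s) /\ (forall s, ~ In s L -> nu s = 0).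

(** * Runs of a memoryless policy *)

Section Policy.
Variable pi : NE -> option PE.
Hypothesis Hpi : forall E P, In E L -> pi E = Some P -> In (tau, P) (moves E).
Variable F : NE.
Hypothesis HF : In F L.

Definition cont E : R := match pi E with Some _ => 1 | None => 0 end.
Definition target E : dist := match pi E with Some P => pdist P | None => fun _ => 0 end.

(** The part of the mass that has not stopped before step [i]; [None] means that the policy stops,
    [Some P] that it moves to [P]. *)
Fixpoint state (i : nat) : dist :=
  match i with
  | O => dirac F
  | S j => fun s => lsum (fun E => state j E * target E s) L
  end.

Lemma target_ge0 E s : 0 <= target E s.
Proof. unfold target; destruct (pi E); [apply pdist_ge0|lra]. Qed.

Lemma target_out E s : In E L -> ~ In s L -> target E s = 0.
Proof.
  intros HE Hs; unfold target; destruct (pi E) eqn:HP; [|reflexivity].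
  apply pdist_out; intro H; apply Hs, (HLm HE (Hpi HE HP)), H.
Qed.

Lemma state_fin i : fin (state i).
Proof.
  induction i as [|i [IH1 IH2]]; split; simpl; intros s.
  - apply dirac_ge0.
  - intro Hs; apply dirac_ne; intros ->; contradiction.
  - apply lsum_ge0; intros E HE; apply Rmult_le_pos; [apply IH1|apply target_ge0].
  - intro Hs; apply lsum_zero; intros E HE; rewrite target_out by assumption; ring.
Qed.

Lemma dot_target E f : In E L ->
  lsum (fun s => target E s * f s) L = match pi E with Some P => expect P f | None => 0 end.
Proof.
  intro HE; unfold target; destruct (pi E) eqn:HP.
  - apply lsum_pdist; [assumption|exact (HLm HE (Hpi HE HP))].
  - apply lsum_zero; intros; ring.
Qed.

Lemma dot_state i f :
  dot (state (S i)) f =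
  lsum (fun E => state i E * match pi E with Some P => expect P f | None => 0 end) L.
Proof.
  unfold dot; simpl.
  rewrite (lsum_ext (g' := fun s => lsum (fun E => state i E * (target E s * f s)) L)).
  2: { intros s Hs; rewrite Rmult_comm, <- lsum_scal; apply lsum_ext; intros; ring. }
  rewrite lsum_swap; apply lsum_ext; intros E HE; rewrite lsum_scal, dot_target by assumption; reflexivity.
Qed.

Lemma cont_bounds E : 0 <= cont E <= 1.
Proof. unfold cont; destruct (pi E); lra. Qed.

Definition stopped (i : nat) : dist := fun s => state i s * (1 - cont s).
Definition moving (i : nat) : dist := fun s => state i s * cont s.

Lemma stopped_ge0 i s : 0 <= stopped i s.
Proof. pose proof (cont_bounds s); pose proof (proj1 (state_fin i) s); unfold stopped; nra. Qed.

(** Conservation of mass. The shifted summand counts what stopped strictly before [i], since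
    [sum_f_R0] always includes index 0. *)
Lemma mass_state i :
  lsum (state i) L + sum_f_R0 (fun j => match j with O => 0 | S k => lsum (stopped k) L end) i = 1.
Proof.
  induction i as [|i IH].
  - simpl. rewrite <- (lsum_dirac (fun _ => 1) HL HF), Rplus_0_r; apply lsum_ext; intros; ring.
  - rewrite tech5, <- IH.
    assert (lsum (state (S i)) L = dot (state (S i)) (fun _ => 1)) as ->
      by (apply lsum_ext; intros; ring).
    rewrite dot_state.
    enough (lsum (fun E => state i E * match pi E with Some P => expect P (fun _ => 1) | None => 0 end) L
      + lsum (stopped i) L = lsum (state i) L) by lra.
    rewrite <- lsum_plus; apply lsum_ext; intros E HE; unfold stopped, cont.
    destruct (pi E); [rewrite expect_const|]; ring.
Qed.

Lemma state_mass i : lsum (state i) L <= 1.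
Proof.
  pose proof (mass_state i) as H.
  assert (0 <= sum_f_R0 (fun j => match j with O => 0 | S k => lsum (stopped k) L end) i).
  { apply cond_pos_sum; intros [|k]; [lra|]. apply lsum_ge0; intros; apply stopped_ge0. }
  lra.
Qed.

Lemma stopped_mass n : sum_f_R0 (fun i => lsum (stopped i) L) n <= 1.
Proof.
  pose proof (mass_state (S n)) as H; rewrite sum_cons in H.
  assert (0 <= lsum (state (S n)) L) by (apply lsum_ge0; intros; apply (proj1 (state_fin (S n)))).
  lra.
Qed.

Lemma stopped_out i s : ~ In s L -> stopped i s = 0.
Proof. intro Hs; unfold stopped; rewrite (proj2 (state_fin i) s Hs); ring. Qed.

Lemma stopped_cv s : {l | infinite_sum (fun i => stopped i s) l}.
Proof.
  apply growing_cv.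
  - intro n; simpl; pose proof (stopped_ge0 (S n) s); lra.
  - exists 1; intros x [n ->]. eapply Rle_trans; [|apply (stopped_mass n)].
    apply sum_Rle; intros i _.
    destruct (excluded_middle_informative (In s L)) as [Hs|Hs].
    + apply lsum_ge_term with (g := stopped i); [intros; apply stopped_ge0|assumption].
    + rewrite stopped_out by assumption; apply lsum_ge0; intros; apply stopped_ge0.
Qed.

Definition limit : dist := fun s => proj1_sig (stopped_cv s).

Lemma limit_cv s : infinite_sum (fun i => stopped i s) (limit s).
Proof. exact (proj2_sig (stopped_cv s)). Qed.

Lemma limit_fin : fin limit.
Proof.
  split; intro s.
  - eapply Rle_trans; [|apply (sum_le_infsum 0 (fun i => stopped_ge0 i s) (limit_cv s))].
    simpl; apply stopped_ge0.
  - intro Hs; apply Rle_antisym.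
    + apply (infsum_le (g := fun i => stopped i s)); [|apply limit_cv].
      intro n; rewrite (sum_eq _ (fun _ => 0)); [rewrite sum_cte; lra|].
      intros; apply stopped_out; assumption.
    + eapply Rle_trans; [|apply (sum_le_infsum 0 (fun i => stopped_ge0 i s) (limit_cv s))].
      simpl; apply stopped_ge0.
Qed.

Lemma dot_limit f : infinite_sum (fun i => dot (stopped i) f) (dot limit f).
Proof.
  apply infsum_lsum; intros s _.
  rewrite Rmult_comm; eapply infsum_ext; [|apply infsum_scal, limit_cv].
  intro i; simpl; ring.
Qed.

Lemma limit_mass : lsum limit L <= 1.
Proof.
  apply (infsum_le (g := fun i => lsum (stopped i) L)); [apply stopped_mass|].
  apply infsum_lsum; intros s _; apply limit_cv.
Qed.

Lemma wtau_limit : wtau tau (dirac F) limit.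
Proof.
  exists moving, stopped; split; [split|split].
  - intro i; assert (forall k : NE -> R, (forall s, 0 <= k s <= 1) ->
       subdist (fun s => state i s * k s)) as H.
    { intros k Hk; destruct (state_fin i) as [H0 H1]; apply subdist_finite.
      - intro s; apply Rmult_le_pos; [apply H0|apply Hk].
      - intros s Hs; rewrite H1 by assumption; ring.
      - eapply Rle_trans; [|apply (state_mass i)].
        apply lsum_le; intros s _; pose proof (H0 s); pose proof (Hk s); nra. }
    split; apply H; intro s; pose proof (cont_bounds s); lra.
  - intro i; apply ctrans_list with (l := L) (w := moving i) (nus := @dirac Act) (mus := target).
    + intros E _; apply Rmult_le_pos; [apply state_fin|apply cont_bounds].
    + eapply Rle_trans; [|apply (state_mass i)]; apply lsum_le; intros s _.
      pose proof (proj1 (state_fin i) s); pose proof (cont_bounds s); unfold moving; nra.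
    + intros E HE; unfold moving, cont, target; destruct (pi E) eqn:HP; [|lra].
      intros _; constructor; apply moves_nstep, Hpi; assumption.
    + apply dirac_decomp; intros s Hs; unfold moving; rewrite (proj2 (state_fin i) s Hs); ring.
    + intro s; unfold moving at 1, stopped.
      replace (state (S i) s * cont s + state (S i) s * (1 - cont s)) with (state (S i) s) by ring.
      simpl; apply lsum_ext; intros E HE; unfold moving, cont, target; destruct (pi E); ring.
  - intro s; unfold moving, stopped; simpl; ring.
  - apply limit_cv.
Qed.

(** Iterating the hypothesis leaves a remainder of at most [lam ^ n], which vanishes. For [lam = 1]
    a tau-loop would satisfy the hypothesis for any [v] although its limit is empty. *)
Lemma policy_value f lam v : range01 f -> range01 v -> 0 <= lam < 1 ->
  (forall E, In E L -> v E <= match pi E with None => f E | Some P => lam * expect P v end) ->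
  v F <= dot limit f.
Proof.
  intros Hf Hv Hlam H.
  assert (Hd : forall i, 0 <= dot (stopped i) f).
  { intro i; apply lsum_ge0; intros; apply Rmult_le_pos; [apply stopped_ge0|apply Hf]. }
  assert (Hstep : forall i, dot (state i) v <= dot (stopped i) f + lam * dot (state (S i)) v).
  { intro i; rewrite dot_state; unfold dot; rewrite <- lsum_scal, <- lsum_plus.
    apply lsum_le; intros E HE; specialize (H E HE); pose proof (proj1 (state_fin i) E).
    unfold stopped, cont; destruct (pi E); nra. }
  assert (Hpow : forall n, 0 <= lam ^ n <= 1).
  { intro n; split; [apply pow_le; lra|]. rewrite <- (pow1 n); apply pow_incr; lra. }
  assert (Hsum : forall n, v F <= sum_f_R0 (fun i => dot (stopped i) f) n
                      + lam ^ (S n) * dot (state (S n)) v).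
  { induction n as [|n IH].
    - simpl sum_f_R0; rewrite pow_1; eapply Rle_trans; [|apply Hstep].
      right; symmetry; apply lsum_dirac; assumption.
    - rewrite tech5; eapply Rle_trans; [exact IH|].
      pose proof (Hstep (S n)) as Hs; pose proof (Hpow (S n)) as Hp; pose proof (Hd (S n)) as Hd'.
      rewrite Rplus_assoc; apply Rplus_le_compat_l.
      apply Rle_trans with (lam ^ S n * (dot (stopped (S n)) f + lam * dot (state (S (S n))) v)).
      + apply Rmult_le_compat_l; [apply Hp|exact Hs].
      + replace (lam ^ S (S n)) with (lam ^ S n * lam) by (simpl; ring). nra. }
  apply Rnot_lt_le; intro Hlt.
  destruct (pow_lt_1_zero lam) with (y := v F - dot limit f) as [N HN];
    [rewrite Rabs_right; lra|lra|].
  specialize (HN (S N) ltac:(lia)); rewrite Rabs_right in HN by (apply Rle_ge, Hpow).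
  pose proof (Hsum N); pose proof (sum_le_infsum N Hd (dot_limit f)).
  assert (dot (state (S N)) v <= 1).
  { eapply Rle_trans; [|apply (state_mass (S N))]; apply lsum_le; intros s _.
    pose proof (proj1 (state_fin (S N)) s); pose proof (Hv s); nra. }
  pose proof (Hpow (S N)). nra.
Qed.

End Policy.

(** The limit of the discounted values along [1 - (1/2)^n] is superharmonic without discount, hence
    above [V f]. Passing to the limit is possible because [stepv] is 0 or attained by a single move,
    whose expectation is a finite sum. *)
Lemma tauv_sup f F B : range01 f -> (forall lam, 0 <= lam < 1 -> tauv lam f F <= B) -> V f F <= B.
Proof.
  intros Hf HB.
  set (lam := fun n : nat => 1 - (1/2) ^ n).
  assert (Hpow : forall n, 0 < (1/2) ^ n <= 1).
  { intro n; split; [apply pow_lt; lra|].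
    apply Rle_trans with (1 ^ n); [apply pow_incr; lra|rewrite pow1; lra]. }
  assert (Hlam : forall n, 0 <= lam n < 1) by (intro n; specialize (Hpow n); unfold lam; lra).
  assert (Hlam1 : Un_cv lam 1).
  { intros eps Heps; destruct (pow_lt_1_zero (1/2)) with (y := eps) as [N HN];
      [rewrite Rabs_right; lra|assumption|].
    exists N; intros n Hn; unfold Rdist, lam.
    replace (1 - (1/2)^n - 1) with (- (1/2)^n) by ring; rewrite Rabs_Ropp; apply HN; assumption. }
  assert (Hcv : forall E, {l | Un_cv (fun n => tauv (lam n) f E) l}).
  { intro E; apply growing_cv.
    - intro n; apply tauv_mono; auto; try lra; try (apply Rlt_le, Hlam).
      + split; [apply Hlam|]. unfold lam; simpl; specialize (Hpow n); lra.
      + intro; lra.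
    - exists 1; intros x [n ->]; apply tauv_bounds. }
  set (U := fun E => proj1_sig (Hcv E)).
  assert (HU : forall E, Un_cv (fun n => tauv (lam n) f E) (U E))
    by (intro E; exact (proj2_sig (Hcv E))).
  assert (HUexp : forall P, Un_cv (fun n => expect P (tauv (lam n) f)) (expect P U)).
  { assert (Hc : forall c : R, Un_cv (fun _ => c) c)
      by (intros c eps Heps; exists 0%nat; intros; rewrite Rdist_eq; assumption).
    induction P as [E|p P IHP Q IHQ]; [apply HU|]. simpl.
    apply CV_plus with (An := fun n => pval p * expect P (tauv (lam n) f))
      (Bn := fun n => (1 - pval p) * expect Q (tauv (lam n) f)).
    - apply CV_mult with (An := fun _ => pval p); auto.
    - apply CV_mult with (An := fun _ => 1 - pval p); auto. }
  assert (Hle : forall (u w : nat -> R) l l', Un_cv u l -> Un_cv w l' -> (forall n, u n <= w n) -> l <= l').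
  { intros u w l l' H1 H2 H; apply (Rle_cv_lim H); auto. }
  assert (Hc : forall c : R, Un_cv (fun _ => c) c)
      by (intros c eps Heps; exists 0%nat; intros; rewrite Rdist_eq; assumption).
  apply Rle_trans with (U F).
  2: { apply (Hle (fun n => tauv (lam n) f F) (fun _ => B) (U F) B); auto. }
  apply tauv_least; [assumption|].
  intro D; rewrite Rmult_1_l; split.
  - apply (Hle (fun _ => f D) (fun n => tauv (lam n) f D) (f D) (U D)); auto.
    intro; apply tauv_ge; assumption.
  - destruct (stepv_attained D tau U) as [->|[P [HP ->]]].
    + apply (Hle (fun _ => 0) (fun n => tauv (lam n) f D) 0 (U D)); auto.
      intro; apply tauv_bounds.
    + rewrite <- (Rmult_1_l (expect P U)).
      apply (Hle (fun n => lam n * expect P (tauv (lam n) f)) (fun n => tauv (lam n) f D)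
              (1 * expect P U) (U D)); auto.
      * apply CV_mult; auto.
      * intro n; eapply Rle_trans; [|apply tauv_super; [|assumption]];
          [|specialize (Hlam n); lra].
        apply Rmult_le_compat_l; [apply Hlam|]. apply stepv_ge; assumption.
Qed.

Definition tau_choices E : list (option PE) :=
  None :: map (fun m => Some (snd m))
    (filter (fun m => if excluded_middle_informative (fst m = tau) then true else false) (moves E)).

Lemma tau_choices_spec E P : In (Some P) (tau_choices E) <-> In (tau, P) (moves E).
Proof.
  unfold tau_choices; split.
  - intros [H|H]; [discriminate|]. apply in_map_iff in H; destruct H as [[a Q] [[= <-] H]].
    apply filter_In in H; destruct H as [H H']; simpl in *.
    destruct excluded_middle_informative; [subst; assumption|discriminate].
  - intro H; right; apply in_map_iff; exists (tau, P); split; [reflexivity|].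
    apply filter_In; split; [assumption|]. simpl; destruct excluded_middle_informative; congruence.
Qed.

Lemma greedy f lam : range01 f -> 0 <= lam < 1 ->
  exists pi, In pi (choices None tau_choices L) /\ forall E, In E L ->
    tauv lam f E <= match pi E with None => f E | Some P => lam * expect P (tauv lam f) end.
Proof.
  intros Hf Hlam.
  assert (Hc : forall E, exists c, In c (tau_choices E) /\
     tauv lam f E <= match c with None => f E | Some P => lam * expect P (tauv lam f) end).
  { intro E; rewrite (@tauv_fix _ tau lam f E) by (assumption || lra).
    destruct (stepv_attained E tau (tauv lam f)) as [->|[P [HP ->]]].
    - exists None; split; [left; reflexivity|]. rewrite Rmult_0_r; apply Rmax_lub; [lra|apply Hf].
    - destruct (Rle_dec (lam * expect P (tauv lam f)) (f E)).
      + exists None; split; [left; reflexivity|]. apply Rmax_lub; lra.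
      + exists (Some P); split; [apply tau_choices_spec; assumption|]. apply Rmax_lub; lra. }
  set (g := fun E => proj1_sig (constructive_indefinite_description _ (Hc E))).
  assert (Hg : forall E, In (g E) (tau_choices E) /\
     tauv lam f E <= match g E with None => f E | Some P => lam * expect P (tauv lam f) end)
    by (intro E; exact (proj2_sig (constructive_indefinite_description _ (Hc E)))).
  destruct (@choices_all _ _ None tau_choices L g) as [pi [Hpi Heq]]; [intros; apply Hg|].
  exists pi; split; [assumption|]. intros E HE; rewrite (Heq E HE); apply Hg.
Qed.

Definition run (mu nu : dist) : Prop := wtau tau mu nu /\ fin nu /\ lsum nu L <= 1.

(* Finitely many weak derivatives suffice, those of the memoryless policies: for each discount the
   greedy policy is optimal, and the undiscounted value is the supremum of the discounted ones. *)
Lemma V_attained F : In F L -> exists N, (forall nu, In nu N -> run (dirac F) nu) /\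
  forall f, range01 f -> exists nu, In nu N /\ V f F <= dot nu f.
Proof.
  intro HF.
  destruct (@list_choice _ _ (fun pi nu => run (dirac F) nu /\
     forall f lam v, range01 f -> range01 v -> 0 <= lam < 1 ->
      (forall E, In E L -> v E <= match pi E with None => f E | Some P => lam * expect P v end) ->
      v F <= dot nu f) (choices None tau_choices L)) as [N [HN1 HN2]].
  { intros pi Hpi.
    assert (Hpi' : forall E P, In E L -> pi E = Some P -> In (tau, P) (moves E)).
    { intros E P HE HP; apply tau_choices_spec; rewrite <- HP; apply (choices_in Hpi HE). }
    exists (limit Hpi' HF); split.
    - split; [apply wtau_limit|split; [apply limit_fin|apply limit_mass]].
    - intros f lam v; apply policy_value. }
  exists N; split.
  - intros nu Hnu; destruct (HN1 nu Hnu) as [pi [_ [H _]]]; exact H.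
  - intros f Hf.
    assert (Hlam : forall lam, 0 <= lam < 1 -> exists nu, In nu N /\ tauv lam f F <= dot nu f).
    { intros lam Hl; destruct (greedy Hf Hl) as [pi [Hpi H]].
      destruct (HN2 pi Hpi) as [nu [Hnu [_ Hv]]]; exists nu; split; [assumption|].
      apply (Hv f lam (tauv lam f)); auto. apply tauv_bounds. }
    (* Any discount shows that [N] is not empty; the best element of [N] for [f] then dominates the
       values of all discounts at once. *)
    destruct (Hlam 0) as [nu0 [Hnu0 _]]; [lra|].
    destruct (list_argmax (fun nu => dot nu f) Hnu0) as [nu [Hnu Hmax]].
    exists nu; split; [assumption|]. apply tauv_sup; [assumption|].
    intros lam Hl; destruct (Hlam lam Hl) as [nu' [Hnu' Hle]].
    eapply Rle_trans; [exact Hle|apply Hmax; assumption].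
Qed.

Definition mix2 (p : R) (mu nu : dist) : dist := fun s => p * mu s + (1 - p) * nu s.

Lemma wtau_mix p mu nu mu' nu' : 0 <= p <= 1 -> wtau tau mu mu' -> wtau tau nu nu' ->
  wtau tau (mix2 p mu nu) (mix2 p mu' nu').
Proof.
  intros Hp H1 H2.
  apply wtau_list with (l := [true; false]) (w := fun b : bool => if b then p else 1 - p)
    (mus := fun b : bool => if b then mu else nu) (nus := fun b : bool => if b then mu' else nu').
  - intros [|] _; lra.
  - simpl; lra.
  - intros [|] _; assumption.
  - intro s; unfold mix2; simpl; ring.
  - intro s; unfold mix2; simpl; ring.
Qed.

Lemma ctrans_mix a p mu nu mu' nu' : 0 <= p <= 1 -> ctrans mu a mu' -> ctrans nu a nu' ->
  ctrans (mix2 p mu nu) a (mix2 p mu' nu').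
Proof.
  intros Hp H1 H2.
  apply ctrans_list with (l := [true; false]) (w := fun b : bool => if b then p else 1 - p)
    (nus := fun b : bool => if b then mu else nu) (mus := fun b : bool => if b then mu' else nu').
  - intros [|] _; lra.
  - simpl; lra.
  - intros [|] _ _; assumption.
  - intro s; unfold mix2; simpl; ring.
  - intro s; unfold mix2; simpl; ring.
Qed.

Lemma fin_mix p mu nu : 0 <= p <= 1 -> fin mu -> fin nu -> fin (mix2 p mu nu).
Proof.
  intros Hp [H1 H2] [H3 H4]; split; intro s; unfold mix2.
  - pose proof (H1 s); pose proof (H3 s); nra.
  - intro Hs; rewrite H2, H4 by assumption; ring.
Qed.

Lemma lsum_mix p mu nu l : lsum (mix2 p mu nu) l = p * lsum mu l + (1 - p) * lsum nu l.
Proof. unfold mix2; rewrite <- !lsum_scal, <- lsum_plus; reflexivity. Qed.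

Lemma dot_mix p mu nu f : dot (mix2 p mu nu) f = p * dot mu f + (1 - p) * dot nu f.
Proof.
  unfold dot; rewrite <- !lsum_scal, <- lsum_plus; apply lsum_ext; intros; unfold mix2; ring.
Qed.

Lemma run_mix p mu nu mu' nu' : 0 <= p <= 1 -> run mu mu' -> run nu nu' ->
  run (mix2 p mu nu) (mix2 p mu' nu').
Proof.
  intros Hp [H1 [H2 H3]] [H4 [H5 H6]]; split; [apply wtau_mix; assumption|].
  split; [apply fin_mix; assumption|]. rewrite lsum_mix; nra.
Qed.

Lemma mix2_same p mu : mix2 p mu mu = mu.
Proof. extensionality s; unfold mix2; ring. Qed.

(** The two branches of a choice can be continued independently, so all mixtures of their candidates
    are taken. *)
Lemma expect_attained P : incl (supp P) L -> exists N, (forall nu, In nu N -> run (pdist P) nu) /\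
  forall f, range01 f -> exists nu, In nu N /\ expect P (V f) <= dot nu f.
Proof.
  induction P as [E|p P IHP Q IHQ]; intro H.
  - apply V_attained, H; left; reflexivity.
  - apply incl_app_inv in H; destruct H as [H1 H2].
    destruct (IHP H1) as [N1 [HN1 HV1]], (IHQ H2) as [N2 [HN2 HV2]].
    pose proof (pval_range p) as Hp.
    exists (flat_map (fun nu1 => map (mix2 (pval p) nu1) N2) N1); split.
    + intros nu Hnu; apply in_flat_map in Hnu; destruct Hnu as [nu1 [Hnu1 Hnu]].
      apply in_map_iff in Hnu; destruct Hnu as [nu2 [<- Hnu2]].
      apply (run_mix (p := pval p)); [lra|auto|auto].
    + intros f Hf; destruct (HV1 f Hf) as [nu1 [Hnu1 Hle1]], (HV2 f Hf) as [nu2 [Hnu2 Hle2]].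
      exists (mix2 (pval p) nu1 nu2); split.
      * apply in_flat_map; exists nu1; split; [assumption|]. apply in_map; assumption.
      * rewrite dot_mix; simpl; nra.
Qed.

(** The zero distribution matches the value 0 of [stepv] when no a-move exists. *)
Definition step_run a E nu : Prop :=
  (forall s, nu s = 0) \/ exists P, In (a, P) (moves E) /\ run (pdist P) nu.

Lemma step_attained a E : In E L -> exists N, (forall nu, In nu N -> step_run a E nu) /\
  forall f, range01 f -> exists nu, In nu N /\ stepv a E (V f) <= dot nu f.
Proof.
  intro HE.
  assert (H : forall ms, incl ms (moves E) -> exists N, (forall nu, In nu N -> step_run a E nu) /\
    forall f P, range01 f -> In (a, P) ms -> exists nu, In nu N /\ expect P (V f) <= dot nu f).
  { induction ms as [|[b P] ms IH]; intro Hms.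
    - exists []; split; [intros ? []|intros ? ? ? []].
    - destruct IH as [N [HN1 HN2]]; [intros m Hm; apply Hms; right; assumption|].
      destruct (excluded_middle_informative (b = a)) as [->|Hba].
      + assert (HP : In (a, P) (moves E)) by (apply Hms; left; reflexivity).
        destruct (expect_attained (HLm HE HP)) as [N' [HN1' HN2']].
        exists (N' ++ N); split.
        * intros nu Hnu; apply in_app_or in Hnu; destruct Hnu as [Hnu|Hnu]; [|auto].
          right; exists P; auto.
        * intros f Q Hf [[= <-]|HQ].
          -- destruct (HN2' f Hf) as [nu [Hnu Hle]]; exists nu; split; [apply in_or_app; auto|assumption].
          -- destruct (HN2 f Q Hf HQ) as [nu [Hnu Hle]]; exists nu; split; [apply in_or_app; auto|assumption].
      + exists N; split; [assumption|]. intros f Q Hf [[= -> _]|HQ]; [congruence|auto]. }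
  destruct (H (moves E) (incl_refl _)) as [N [HN1 HN2]].
  exists ((fun _ => 0) :: N); split.
  - intros nu [<-|Hnu]; [left; reflexivity|auto].
  - intros f Hf; destruct (stepv_attained E a (V f)) as [->|[P [HP ->]]].
    + exists (fun _ => 0); split; [left; reflexivity|]. unfold dot; rewrite lsum_zero; [lra|intros; ring].
    + destruct (HN2 f P Hf HP) as [nu [Hnu Hle]]; exists nu; split; [right|]; assumption.
Qed.

(* nu is reached from F by a weak a-transition, except that the part rho0 of the intermediate
   distribution, which may be unable to perform a, is given up. *)
Definition weak_run a F nu : Prop :=
  fin nu /\ exists rho rho0 eta,
    wtau tau (dirac F) (fun s => rho s + rho0 s) /\ ctrans rho a eta /\ wtau tau eta nu /\
    fin rho0 /\ lsum nu L <= 1 - lsum rho0 L.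

Lemma weak_run_intro a F rho (phi : NE -> dist) :
  run (dirac F) rho -> (forall E, In E L -> step_run a E (phi E)) ->
  weak_run a F (fun s => lsum (fun E => rho E * phi E s) L).
Proof.
  intros [Hrho [[Hrho0 Hrhoout] Hrho1]] Hphi.
  assert (Hc : forall E, exists P, In E L -> (forall s, phi E s = 0) \/
            (In (a, P) (moves E) /\ run (pdist P) (phi E))).
  { intro E; destruct (excluded_middle_informative (In E L)) as [HE|HE].
    - destruct (Hphi E HE) as [H|[P HP]]; [exists (Dirac E); auto|exists P; auto].
    - exists (Dirac E); intro; contradiction. }
  set (pe := fun E => proj1_sig (constructive_indefinite_description _ (Hc E))).
  assert (Hpe : forall E, In E L -> (forall s, phi E s = 0) \/
            (In (a, pe E) (moves E) /\ run (pdist (pe E)) (phi E)))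
    by (intro E; exact (proj2_sig (constructive_indefinite_description _ (Hc E)))).
  (* Where [phi] vanishes there need not be an a-move: this part of [rho] is given up as [rho0],
     while the remainder [ok] performs the step. *)
  set (stuck := fun E => forall s, phi E s = 0).
  set (ok := fun E => if excluded_middle_informative (stuck E) then 0 else rho E).
  set (rho0 := fun E => if excluded_middle_informative (stuck E) then rho E else 0).
  set (mus := fun E => if excluded_middle_informative (stuck E) then (fun _ => 0) else pdist (pe E)).
  assert (Hok : forall E, 0 <= ok E <= rho E)
    by (intro E; unfold ok; pose proof (Hrho0 E); destruct excluded_middle_informative; lra).
  assert (Hok1 : lsum ok L <= 1)
    by (eapply Rle_trans; [|exact Hrho1]; apply lsum_le; intros; apply Hok).
  assert (Hphi0 : forall E, In E L -> fin (phi E) /\ lsum (phi E) L <= 1).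
  { intros E HE; destruct (Hpe E HE) as [H|[_ [_ H]]]; [|exact H].
    split; [split; intros; rewrite H; lra|]. rewrite lsum_zero; [lra|auto]. }
  split.
  { split.
    - intro s; apply lsum_ge0; intros E HE; apply Rmult_le_pos; [apply Hrho0|apply (Hphi0 E HE)].
    - intros s Hs; apply lsum_zero; intros E HE. rewrite (proj2 (proj1 (Hphi0 E HE)) s Hs); ring. }
  exists ok, rho0, (fun s => lsum (fun E => ok E * mus E s) L).
  split; [|split; [|split; [|split]]].
  - replace (fun s => ok s + rho0 s) with rho; [assumption|].
    extensionality s; unfold ok, rho0; destruct excluded_middle_informative; ring.
  - apply ctrans_list with (l := L) (w := ok) (nus := @dirac Act) (mus := mus); auto.
    + intros; apply Hok.
    + intros E HE; unfold ok, mus; destruct excluded_middle_informative as [|Hs]; [lra|].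
      intros _; constructor; apply moves_nstep. destruct (Hpe E HE) as [H|[H _]]; [contradiction|exact H].
    + apply dirac_decomp; intros s Hs; unfold ok; rewrite (Hrhoout s Hs).
      destruct excluded_middle_informative; reflexivity.
  - apply wtau_list with (l := L) (w := ok) (mus := mus) (nus := phi); auto.
    + intros; apply Hok.
    + intros E HE; unfold mus; destruct excluded_middle_informative as [Hs|Hs].
      * apply wtau_list with (l := @nil NE) (w := fun _ => 0) (mus := fun _ _ => 0) (nus := fun _ _ => 0);
          simpl; auto; try lra; try tauto.
      * destruct (Hpe E HE) as [H|[_ [H _]]]; [contradiction|exact H].
    + intro s; apply lsum_ext; intros E HE; unfold ok; destruct excluded_middle_informative as [Hs|Hs];
        [rewrite Hs|]; ring.
  - split; intro s; unfold rho0; destruct excluded_middle_informative; try lra; auto.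
  - rewrite lsum_swap.
    apply Rle_trans with (lsum rho L - lsum rho0 L); [|lra].
    apply Rle_trans with (lsum ok L).
    + apply lsum_le; intros E HE; rewrite lsum_scal.
      unfold ok; destruct excluded_middle_informative as [Hs|Hs].
      * rewrite lsum_zero; [lra|]. auto.
      * pose proof (proj2 (Hphi0 E HE)); pose proof (Hrho0 E); nra.
    + apply Rplus_le_reg_r with (lsum rho0 L); rewrite <- lsum_plus.
      replace (lsum rho L - lsum rho0 L + lsum rho0 L) with (lsum rho L) by ring.
      right; apply lsum_ext; intros E _; unfold ok, rho0; destruct excluded_middle_informative; ring.
Qed.

Lemma weak_attained a F : In F L -> exists N, (forall nu, In nu N -> weak_run a F nu) /\
  forall f, range01 f -> exists nu, In nu N /\ weakv a f F <= dot nu f.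
Proof.
  intro HF; destruct (V_attained HF) as [NF [HNF1 HNF2]].
  assert (Hc : forall E, exists N, In E L -> (forall nu, In nu N -> step_run a E nu) /\
     forall f, range01 f -> exists nu, In nu N /\ stepv a E (V f) <= dot nu f).
  { intro E; destruct (excluded_middle_informative (In E L)) as [HE|HE].
    - destruct (step_attained a HE) as [N HN]; exists N; auto.
    - exists []; intro; contradiction. }
  set (NA := fun E => proj1_sig (constructive_indefinite_description _ (Hc E))).
  assert (HNA : forall E, In E L -> (forall nu, In nu (NA E) -> step_run a E nu) /\
     forall f, range01 f -> exists nu, In nu (NA E) /\ stepv a E (V f) <= dot nu f)
    by (intro E; exact (proj2_sig (constructive_indefinite_description _ (Hc E)))).
  exists (flat_map (fun rho : dist => map (fun (phi : NE -> dist) s => lsum (fun E => rho E * phi E s) L)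
            (choices (fun _ => 0) NA L)) NF); split.
  - intros nu Hnu; apply in_flat_map in Hnu; destruct Hnu as [rho [Hrho Hnu]].
    apply in_map_iff in Hnu; destruct Hnu as [phi [<- Hphi]].
    apply weak_run_intro; [auto|]. intros E HE; apply (HNA E HE), (choices_in Hphi HE).
  - intros f Hf.
    (* The first phase is optimised for the reward of the best a-step; its value is [weakv a f F] by
       definition. *)
    destruct (HNF2 (fun D => stepv a D (V f))) as [rho [Hrho Hle]]; [apply stepv_range01, tauv_bounds|].
    assert (Hg : forall E, exists nu, In E L -> In nu (NA E) /\ stepv a E (V f) <= dot nu f).
    { intro E; destruct (excluded_middle_informative (In E L)) as [HE|HE].
      - destruct (proj2 (HNA E HE) f Hf) as [nu Hnu]; exists nu; auto.
      - exists (fun _ => 0); intro; contradiction. }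
    set (g := fun E => proj1_sig (constructive_indefinite_description _ (Hg E))).
    assert (Hg' : forall E, In E L -> In (g E) (NA E) /\ stepv a E (V f) <= dot (g E) f)
      by (intro E; exact (proj2_sig (constructive_indefinite_description _ (Hg E)))).
    destruct (@choices_all _ _ (fun _ => 0) NA L g) as [phi [Hphi Heq]]; [intros; apply Hg'; assumption|].
    exists (fun s => lsum (fun E => rho E * phi E s) L); split.
    + apply in_flat_map; exists rho; split; [assumption|]. apply in_map_iff; eauto.
    + eapply Rle_trans; [exact Hle|]. unfold dot at 2.
      rewrite (lsum_ext (g' := fun s => lsum (fun E => rho E * (phi E s * f s)) L)).
      2: { intros s _; rewrite Rmult_comm, <- lsum_scal; apply lsum_ext; intros; ring. }
      rewrite lsum_swap; apply lsum_le; intros E HE; rewrite lsum_scal.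
      apply Rmult_le_compat_l; [apply (HNF1 rho Hrho)|].
      rewrite (Heq E HE); apply Hg'; assumption.
Qed.

Lemma weak_run_mix a F p mu nu : 0 <= p <= 1 -> weak_run a F mu -> weak_run a F nu ->
  weak_run a F (mix2 p mu nu).
Proof.
  intros Hp [H1 [r1 [z1 [e1 [A1 [B1 [C1 [D1 G1]]]]]]]] [H2 [r2 [z2 [e2 [A2 [B2 [C2 [D2 G2]]]]]]]].
  split; [apply fin_mix; assumption|].
  exists (mix2 p r1 r2), (mix2 p z1 z2), (mix2 p e1 e2).
  split; [|split; [apply ctrans_mix; assumption|split; [apply wtau_mix; assumption|
    split; [apply fin_mix; assumption|]]]].
  - replace (fun s => mix2 p r1 r2 s + mix2 p z1 z2 s)
      with (mix2 p (fun s => r1 s + z1 s) (fun s => r2 s + z2 s))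
      by (extensionality s; unfold mix2; ring).
    rewrite <- (mix2_same p (dirac F)); apply wtau_mix; assumption.
  - rewrite !lsum_mix; nra.
Qed.

(** Full mass at the end leaves no room for a part given up, so [rho0] is zero. *)
Lemma weak_run_wtrans a F nu : weak_run a F nu -> 1 <= lsum nu L -> wtrans tau (dirac F) a nu.
Proof.
  intros [H1 [r [z [e [A [B [C [[D1 D2] G]]]]]]]] Hm.
  assert (Hz : forall s, z s = 0).
  { intro s; destruct (excluded_middle_informative (In s L)) as [Hs|Hs]; [|auto].
    assert (z s <= lsum z L) by (apply lsum_ge_term; auto). specialize (D1 s); lra. }
  exists r, e; split; [|split; assumption].
  replace r with (fun s => r s + z s) by (extensionality s; rewrite Hz; ring). assumption.
Qed.

End Attainment.

(** * From values to weak transitions *)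

Section Ville.

Lemma between (lo hi : list R) x0 : In x0 lo -> (forall x y, In x lo -> In y hi -> x < y) ->
  exists t, (forall x, In x lo -> x < t) /\ (forall y, In y hi -> t < y).
Proof.
  intros H0 H; destruct (list_argmax (fun x => x) H0) as [m [Hm Hmax]].
  destruct hi as [|y0 hi].
  - exists (m + 1); split; [|intros ? []]. intros x Hx; specialize (Hmax x Hx); lra.
  - destruct (@list_argmax _ (fun x => - x) (y0 :: hi) y0 (or_introl eq_refl)) as [n [Hn Hmin]].
    pose proof (H m n Hm Hn). exists ((m + n) / 2); split.
    + intros x Hx; specialize (Hmax x Hx); lra.
    + intros y Hy; specialize (Hmin y Hy); lra.
Qed.

Lemma sumbool_if_true (A B : Prop) (d : {A} + {B}) : (if d then true else false) = true -> A.
Proof. destruct d; [auto|discriminate]. Qed.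

(* A form of the minimax theorem (Ville), by Fourier-Motzkin elimination of one coordinate at a
   time: the vectors with negative first coordinate are replaced by the points where the segments
   to the other vectors cross the hyperplane. *)
Lemma ville (J : Type) (js : list J) : NoDup js ->
  forall (D : (J -> R) -> Prop) (Pi : list (J -> R)) (u0 : J -> R),
  (forall p u v, 0 <= p <= 1 -> D u -> D v -> D (fun j => p * u j + (1 - p) * v j)) ->
  (forall u, In u Pi -> D u) -> In u0 Pi ->
  (forall y, (forall j, 0 <= y j) -> (exists j, In j js /\ 0 < y j) ->
     exists u, In u Pi /\ 0 <= lsum (fun j => u j * y j) js) ->
  exists u, D u /\ forall j, In j js -> 0 <= u j.
Proof.
  induction 1 as [|j0 js Hj0 Hjs IH]; intros D Pi u0 HD HPi Hu0 Hy.
  - exists u0; split; [auto|intros ? []].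
  - set (Pos := filter (fun u : J -> R => if Rle_dec 0 (u j0) then true else false) Pi).
    set (Neg := filter (fun u : J -> R => if Rle_dec 0 (u j0) then false else true) Pi).
    assert (HPos : forall u, In u Pos <-> In u Pi /\ 0 <= u j0).
    { intro u; unfold Pos; rewrite filter_In; destruct Rle_dec; intuition discriminate. }
    assert (HNeg : forall u, In u Neg <-> In u Pi /\ u j0 < 0).
    { intro u; unfold Neg; rewrite filter_In; destruct Rle_dec; intuition (discriminate || lra). }
    set (cross := fun (u v : J -> R) j =>
      - v j0 / (u j0 - v j0) * u j + (1 - - v j0 / (u j0 - v j0)) * v j).
    set (Pi' := Pos ++ flat_map (fun u => map (cross u) Neg) Pos).
    assert (Hcross : forall u v, 0 <= u j0 -> v j0 < 0 -> 0 <= - v j0 / (u j0 - v j0) <= 1).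
    { intros u v Hu Hv; split.
      - apply Rmult_le_pos; [lra|]. apply Rlt_le, Rinv_0_lt_compat; lra.
      - apply Rmult_le_reg_r with (u j0 - v j0); [lra|].
        replace (- v j0 / (u j0 - v j0) * (u j0 - v j0)) with (- v j0) by (field; lra). lra. }
    assert (HPi' : forall u, In u Pi' -> In u Pos \/ exists u1 u2, In u1 Pos /\ In u2 Neg /\ u = cross u1 u2).
    { intros u Hu; apply in_app_or in Hu; destruct Hu as [Hu|Hu]; [auto|right].
      apply in_flat_map in Hu; destruct Hu as [u1 [Hu1 Hu]].
      apply in_map_iff in Hu; destruct Hu as [u2 [<- Hu2]]; eauto. }
    (* Testing with the unit vector at [j0] yields a vector in [Pos], so the family [Pi'] is not
       empty. *)
    destruct (Hy (fun j => if excluded_middle_informative (j = j0) then 1 else 0)) as [u1 [Hu1 Hle1]].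
    { intro j; destruct excluded_middle_informative; lra. }
    { exists j0; split; [left; reflexivity|]. destruct excluded_middle_informative; [lra|congruence]. }
    assert (Hu1' : In u1 Pos).
    { apply HPos; split; [assumption|]. simpl in Hle1; rewrite lsum_zero in Hle1.
      - destruct excluded_middle_informative; [lra|congruence].
      - intros j Hj; destruct (excluded_middle_informative (j = j0)) as [Hj'|]; [|ring].
        rewrite Hj' in Hj; contradiction. }
    destruct (IH (fun u => D u /\ 0 <= u j0) Pi' u1) as [u [[Hu Huj0] Hujs]].
    + intros p u v Hp [H1 H2] [H3 H4]; split; [auto|nra].
    + intros u Hu; destruct (HPi' u Hu) as [Hu'|[v1 [v2 [Hv1 [Hv2 ->]]]]].
      * apply HPos in Hu'; destruct Hu'; auto.
      * apply HPos in Hv1; apply HNeg in Hv2; destruct Hv1, Hv2; split.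
        -- apply HD; auto.
        -- unfold cross; right; field; lra.
    + apply in_or_app; auto.
    + intros y Hy0 Hypos.
      destruct (excluded_middle_informative (exists u, In u Pi' /\ 0 <= lsum (fun j => u j * y j) js))
        as [|Hno]; [assumption|exfalso].
      set (sc := fun u : J -> R => lsum (fun j => u j * y j) js).
      assert (Hneg : forall u, In u Pi' -> sc u < 0).
      { intros u Hu; apply Rnot_le_lt; intro; apply Hno; exists u; auto. }
      assert (Hpair : forall u v, In u Pos -> In v Neg -> u j0 * sc v < v j0 * sc u).
      { intros u v Hu Hv; assert (Huv : In (cross u v) Pi').
        { apply in_or_app; right; apply in_flat_map; exists u; split; [assumption|].
          apply in_map; assumption. }
        apply Hneg in Huv; unfold sc at 1, cross in Huv.
        apply HPos in Hu; apply HNeg in Hv; destruct Hu as [_ Hu], Hv as [_ Hv].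
        set (lam := - v j0 / (u j0 - v j0)) in *.
        rewrite (lsum_ext (g' := fun j => lam * (u j * y j) + (1 - lam) * (v j * y j))) in Huv
          by (intros; ring).
        rewrite lsum_plus, !lsum_scal in Huv; fold (sc u) (sc v) in Huv.
        assert (Hl : lam * (u j0 - v j0) = - v j0) by (unfold lam; field; lra).
        assert (Hneg' : (u j0 - v j0) * (lam * sc u + (1 - lam) * sc v) < 0).
        { rewrite <- (Rmult_0_r (u j0 - v j0)); apply Rmult_lt_compat_l; lra. }
        replace ((u j0 - v j0) * (lam * sc u + (1 - lam) * sc v)) with
          (lam * (u j0 - v j0) * sc u + (u j0 - v j0 - lam * (u j0 - v j0)) * sc v) in Hneg' by ring.
        rewrite Hl in Hneg'; lra. }
      (* Some [t > 0] as coordinate [j0] would extend [y] so that all vectors score negatively: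
         those in [Neg] give lower bounds on [t], those positive at [j0] upper bounds, and [Hpair]
         makes them compatible. *)
      destruct (@between (0 :: map (fun v => sc v / - v j0) Neg)
        (map (fun u => - sc u / u j0)
          (filter (fun u : J -> R => if Rlt_dec 0 (u j0) then true else false) Pos)) 0)
        as [t [Ht1 Ht2]].
      * left; reflexivity.
      * intros x z Hx Hz; apply in_map_iff in Hz; destruct Hz as [u [<- Hu]].
        apply filter_In in Hu; destruct Hu as [Hu Huj]; apply sumbool_if_true in Huj.
        assert (Hscu : sc u < 0) by (apply Hneg, in_or_app; auto).
        destruct Hx as [<-|Hx].
        -- apply Rmult_lt_0_compat; [lra|apply Rinv_0_lt_compat; assumption].
        -- apply in_map_iff in Hx; destruct Hx as [v [<- Hv]].
           pose proof (Hpair u v Hu Hv); apply HNeg in Hv; destruct Hv as [_ Hv].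
           apply Rmult_lt_reg_r with (u j0 * - v j0); [nra|].
           replace (sc v / - v j0 * (u j0 * - v j0)) with (u j0 * sc v) by (field; lra).
           replace (- sc u / u j0 * (u j0 * - v j0)) with (v j0 * sc u) by (field; lra).
           assumption.
      * pose proof (Ht1 0 (or_introl eq_refl)) as Ht0.
        destruct (Hy (fun j => if excluded_middle_informative (j = j0) then t else y j)) as [u [Hu Hle]].
        { intro j; destruct excluded_middle_informative; [lra|auto]. }
        { exists j0; split; [left; reflexivity|]. destruct excluded_middle_informative; [lra|congruence]. }
        assert (Hle' : 0 <= u j0 * t + sc u).
        { simpl in Hle; destruct excluded_middle_informative; [|congruence].
          rewrite (lsum_ext (g' := fun j => u j * y j)) in Hle; [exact Hle|].
          intros j Hj; destruct (excluded_middle_informative (j = j0)) as [Hj'|]; [|reflexivity].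
          rewrite Hj' in Hj; contradiction. }
        destruct (Rlt_dec (u j0) 0) as [Hlt|Hge].
        -- assert (HuN : In u Neg) by (apply HNeg; auto).
           assert (sc u / - u j0 < t)
             by (apply Ht1; right; apply in_map_iff; exists u; auto).
           assert (sc u / - u j0 * - u j0 < t * - u j0) by (apply Rmult_lt_compat_r; lra).
           replace (sc u / - u j0 * - u j0) with (sc u) in * by (field; lra). nra.
        -- assert (HuP : In u Pos) by (apply HPos; split; [assumption|lra]).
           assert (Hscu : sc u < 0) by (apply Hneg, in_or_app; auto).
           destruct (Rlt_dec 0 (u j0)) as [Hgt|Hz].
           ++ assert (t < - sc u / u j0).
              { apply Ht2, in_map_iff; exists u; split; [reflexivity|].
                apply filter_In; split; [assumption|]. destruct Rlt_dec; [reflexivity|contradiction]. }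
              assert (t * u j0 < - sc u / u j0 * u j0) by (apply Rmult_lt_compat_r; assumption).
              replace (- sc u / u j0 * u j0) with (- sc u) in * by (field; lra). lra.
           ++ assert (u j0 = 0) as Hz0 by lra. rewrite Hz0 in Hle'; lra.
    + exists u; split; [assumption|]. intros j [<-|Hj]; auto.
Qed.

End Ville.

(** * Coupling of similarity classes and matching of transitions *)

Section Adequacy.
Variable Act : Type.
Variable tau : Act.
Local Notation NE := (NE Act).
Local Notation PE := (PE Act).
Local Notation dist := (dist Act).
Local Notation V := (tauv tau 1).
Local Notation weakv := (weakv tau).
Local Notation fsim := (fsim tau).
Local Notation feq := (feq tau).
Local Notation inv := (inv tau).
Implicit Types (E F D : NE) (P Q : PE) (a : Act) (f g : NE -> R) (mu nu : dist).

Lemma fsim_refl E : fsim E E.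
Proof. apply feq_fsim; intros f a Hf; reflexivity. Qed.

Lemma fsim_sym E F : fsim E F -> fsim F E.
Proof.
  intro H; apply (@fsim_intro Act tau (fun E F => fsim F E)); [|assumption].
  intros f Hf _; split; [|intros a Ha]; intros K K' HK; symmetry.
  - apply (fsim_inv HK), inv_V, Hf.
  - apply (fsim_inv HK), inv_weakv; assumption.
Qed.

Lemma fsim_trans E F D : fsim E F -> fsim F D -> fsim E D.
Proof.
  intros H1 H2; apply (@fsim_intro Act tau (fun E D => exists F, fsim E F /\ fsim F D)); [|eauto].
  intros f Hf _; split; [|intros a Ha]; intros K K' [K0 [HK HK']].
  - rewrite (fsim_inv HK (inv_V Hf)); apply (fsim_inv HK'), inv_V, Hf.
  - rewrite (fsim_inv HK (inv_weakv Ha Hf)); apply (fsim_inv HK'), inv_weakv; assumption.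
Qed.

Definition cls E D : R := if excluded_middle_informative (fsim E D) then 1 else 0.

Lemma cls_bounds E D : 0 <= cls E D <= 1.
Proof. unfold cls; destruct excluded_middle_informative; lra. Qed.

Lemma cls_refl E : cls E E = 1.
Proof. unfold cls; destruct excluded_middle_informative as [|H]; [reflexivity|]. destruct H; apply fsim_refl. Qed.

Lemma cls_sym E D : cls E D = cls D E.
Proof.
  unfold cls; do 2 destruct excluded_middle_informative; try reflexivity;
    exfalso; auto using fsim_sym.
Qed.

Lemma cls_eq E D : fsim E D -> cls E = cls D.
Proof.
  intro H; extensionality K; unfold cls; do 2 destruct excluded_middle_informative; try reflexivity;
    exfalso; eauto using fsim_sym, fsim_trans.
Qed.

Lemma lsum_prod A B (g : A * B -> R) l l' :
  lsum g (list_prod l l') = lsum (fun x => lsum (fun y => g (x, y)) l') l.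
Proof. induction l; simpl; [reflexivity|]. rewrite lsum_app, lsum_map, IHl; reflexivity. Qed.

Lemma dot_combination (l K : list NE) nu (y : NE -> R) (g : NE -> NE -> R) c :
  dot l nu (fun s => lsum (fun j => y j * g j s) K * c) = c * lsum (fun j => dot l nu (g j) * y j) K.
Proof.
  unfold dot.
  rewrite (lsum_ext (g' := fun s => lsum (fun j => c * (nu s * g j s * y j)) K)).
  - rewrite lsum_swap, <- lsum_scal; apply lsum_ext; intros j _.
    rewrite lsum_scal; f_equal; rewrite (Rmult_comm _ (y j)), <- lsum_scal.
    apply lsum_ext; intros; ring.
  - intros s _; rewrite lsum_scal.
    replace (nu s * (lsum (fun j => y j * g j s) K * c))
      with (c * (nu s * lsum (fun j => y j * g j s) K)) by ring.
    f_equal; rewrite <- lsum_scal; apply lsum_ext; intros; ring.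
Qed.

Section Coupling.
Variables (K L : list NE) (mu nu : dist).
Hypothesis HK : NoDup K.
Hypothesis HL : NoDup L.
Hypothesis Hmu : fin K mu.
Hypothesis Hnu : fin L nu.
Hypothesis Hmu1 : lsum mu K = 1.
Hypothesis Hnu1 : lsum nu L <= 1.
Hypothesis Hcls : forall E, In E K -> dot K mu (cls E) <= dot L nu (cls E).

Lemma dot_cls_ge0 l nu' E : fin l nu' -> 0 <= dot l nu' (cls E).
Proof. intros [H _]; apply lsum_ge0; intros; apply Rmult_le_pos; [auto|apply cls_bounds]. Qed.

Lemma le_dot_cls l nu' E : fin l nu' -> In E l -> nu' E <= dot l nu' (cls E).
Proof.
  intros [H _] HE; rewrite <- (Rmult_1_r (nu' E)), <- (cls_refl E).
  apply lsum_ge_term with (g := fun s => nu' s * cls E s); [|assumption].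
  intros; apply Rmult_le_pos; [auto|apply cls_bounds].
Qed.

(** A class that misses [K] has no mass under [mu]. *)
Lemma dot_cls_le D : dot K mu (cls D) <= dot L nu (cls D).
Proof.
  destruct (excluded_middle_informative (exists E, In E K /\ fsim E D)) as [[E [HE HED]]|Hno].
  - rewrite <- (cls_eq HED); apply Hcls; assumption.
  - unfold dot at 1; rewrite lsum_zero; [apply dot_cls_ge0; assumption|].
    intros s Hs; unfold cls; destruct excluded_middle_informative as [H|]; [|ring].
    destruct Hno; exists s; split; [assumption|apply fsim_sym; assumption].
Qed.

(** Within each class, [mu E] is distributed over the elements in proportion to [nu]. If [nu] gives
    the class no mass, then neither does [mu], and [/ 0 = 0] yields the right value. *)
Definition coupling (x : NE * NE) : R :=
  mu (fst x) * cls (fst x) (snd x) * nu (snd x) * / dot L nu (cls (fst x)).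

Lemma coupling_ge0 x : 0 <= coupling x.
Proof.
  destruct Hmu as [Hm _], Hnu as [Hn _], x as [E D]; unfold coupling; simpl.
  apply Rmult_le_pos.
  - repeat apply Rmult_le_pos; auto. apply cls_bounds.
  - destruct (Req_dec (dot L nu (cls E)) 0) as [->|Hne]; [rewrite Rinv_0; lra|].
    apply Rlt_le, Rinv_0_lt_compat. pose proof (dot_cls_ge0 E Hnu); lra.
Qed.

Lemma coupling_row E : In E K -> lsum (fun D => coupling (E, D)) L = mu E.
Proof.
  intro HE; unfold coupling; simpl.
  rewrite (lsum_ext (g' := fun D => mu E * / dot L nu (cls E) * (nu D * cls E D))) by (intros; ring).
  rewrite lsum_scal; fold (dot L nu (cls E)).
  destruct (Req_dec (dot L nu (cls E)) 0) as [H0|Hne]; [|field; assumption].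
  pose proof (le_dot_cls Hmu HE); pose proof (Hcls HE); pose proof (proj1 Hmu E).
  rewrite H0; lra.
Qed.

Lemma coupling_col D : In D L -> lsum (fun E => coupling (E, D)) K <= nu D.
Proof.
  intro HD; unfold coupling; simpl.
  rewrite (lsum_ext (g' := fun E => nu D * / dot L nu (cls D) * (mu E * cls D E))).
  2: { intros E _; rewrite (cls_sym D E).
       destruct (excluded_middle_informative (fsim E D)) as [H|H]; [rewrite (cls_eq H); ring|].
       assert (cls E D = 0) as -> by (unfold cls; destruct excluded_middle_informative; tauto).
       ring. }
  rewrite lsum_scal; fold (dot K mu (cls D)).
  pose proof (dot_cls_le D); pose proof (le_dot_cls Hnu HD); pose proof (proj1 Hnu D).
  pose proof (dot_cls_ge0 D Hmu).
  destruct (Req_dec (dot L nu (cls D)) 0) as [Hz|Hne].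
  - assert (nu D = 0) as -> by lra. lra.
  - apply Rle_trans with (nu D * / dot L nu (cls D) * dot L nu (cls D)).
    + apply Rmult_le_compat_l; [|assumption]. apply Rmult_le_pos; [assumption|].
      apply Rlt_le, Rinv_0_lt_compat; lra.
    + right; field; assumption.
Qed.

Lemma coupling_mass : lsum coupling (list_prod K L) = 1.
Proof.
  rewrite lsum_prod, <- Hmu1; apply lsum_ext; intros; apply coupling_row; assumption.
Qed.

Lemma coupling_cols_mass : lsum (fun D => lsum (fun E => coupling (E, D)) K) L = 1.
Proof. rewrite <- coupling_mass, lsum_prod; apply lsum_swap. Qed.

Lemma coupling_full : 1 <= lsum nu L.
Proof. rewrite <- coupling_cols_mass; apply lsum_le, coupling_col. Qed.

(* The columns sum up to at most nu, but both have mass 1. *)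
Lemma coupling_col_eq D : In D L -> lsum (fun E => coupling (E, D)) K = nu D.
Proof.
  intro HD; apply Rle_antisym; [apply coupling_col; assumption|].
  assert (H : nu D + -1 * lsum (fun E => coupling (E, D)) K <=
    lsum (fun D => nu D + -1 * lsum (fun E => coupling (E, D)) K) L).
  { apply lsum_ge_term with (g := fun D => nu D + -1 * lsum (fun E => coupling (E, D)) K);
      [|assumption]. intros D' HD'; pose proof (coupling_col HD'); lra. }
  rewrite lsum_plus, lsum_scal, coupling_cols_mass in H. lra.
Qed.

Lemma coupling_lift : lift (fun E D => In E K /\ In D L /\ fsim E D) mu nu.
Proof.
  apply lift_list with (l := list_prod K L) (w := coupling)
    (nus := fun x => dirac (fst x)) (mus := fun x => dirac (snd x)).
  - intros; apply coupling_ge0.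
  - rewrite coupling_mass; lra.
  - intros [E D] Hx Hpos; apply in_prod_iff in Hx; destruct Hx as [HE HD].
    constructor; simpl; split; [assumption|split; [assumption|]].
    unfold coupling, cls in Hpos; simpl in Hpos.
    destruct excluded_middle_informative; [assumption|]. exfalso; lra.
  - intro s; rewrite lsum_prod; rewrite (dirac_decomp HK (proj2 Hmu) s).
    apply lsum_ext; intros E HE; rewrite <- (coupling_row HE), Rmult_comm, <- lsum_scal.
    apply lsum_ext; intros; simpl; ring.
  - intro s; rewrite lsum_prod, lsum_swap; rewrite (dirac_decomp HL (proj2 Hnu) s).
    apply lsum_ext; intros D HD; rewrite <- (coupling_col_eq HD), Rmult_comm, <- lsum_scal.
    apply lsum_ext; intros; simpl; ring.
Qed.

End Coupling.

Lemma eq_NE_dec (E F : NE) : {E = F} + {E <> F}.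
Proof. apply excluded_middle_informative. Qed.

(* By ville, applied to the indicator functions of the similarity classes of supp P. *)
Lemma lift_of_values (L : list NE) P (DD : dist -> Prop) (N : list dist) : NoDup L ->
  (forall p nu nu', 0 <= p <= 1 -> DD nu -> DD nu' -> DD (mix2 p nu nu')) ->
  (forall nu, DD nu -> fin L nu /\ lsum nu L <= 1) ->
  (forall nu, In nu N -> DD nu) ->
  (forall f, inv f -> exists nu, In nu N /\ expect P f <= dot L nu f) ->
  exists nu, DD nu /\ 1 <= lsum nu L /\
    lift (fun E D => In E (supp P) /\ In D L /\ fsim E D) (pdist P) nu.
Proof.
  intros HL Hmix Hfin HN Hval.
  set (K := nodup eq_NE_dec (supp P)).
  assert (HK : NoDup K) by apply NoDup_nodup.
  assert (HKin : forall E, In E K <-> In E (supp P)) by (intro; apply nodup_In).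
  assert (Hexp : forall f, expect P f = dot K (pdist P) f).
  { intro f; symmetry; apply lsum_pdist; [assumption|]. intros E HE; apply HKin, HE. }
  assert (HmuK : fin K (pdist P)).
  { split; [apply pdist_ge0|]. intros s Hs; apply pdist_out; rewrite <- HKin; assumption. }
  assert (Hmu1 : lsum (pdist P) K = 1).
  { rewrite <- (expect_const P 1), Hexp; apply lsum_ext; intros; ring. }
  set (vec := fun nu j => dot L nu (cls j) + -1 * dot K (pdist P) (cls j)).
  (* Only needed to see that [N] is not empty, as [ville] requires. *)
  destruct (Hval (fun _ => 0)) as [nu0 [Hnu0 _]].
  { split; [intro; lra|intros ? ? ?; reflexivity]. }
  destruct (@ville NE K HK (fun u => exists nu, DD nu /\ u = vec nu) (map vec N) (vec nu0))
    as [u [[nu [HDnu ->]] Hu]].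
  - intros p u v Hp [nu [Hnu ->]] [nu' [Hnu' ->]]; exists (mix2 p nu nu'); split; [auto|].
    extensionality j; unfold vec; rewrite dot_mix; ring.
  - intros u Hu; apply in_map_iff in Hu; destruct Hu as [nu [<- Hnu]]; eauto.
  - apply in_map; assumption.
  - intros y Hy0 [j1 [Hj1 Hyj1]].
    (* Dividing by the total weight brings the test function into the range from 0 to 1 that [inv]
       demands; the sign of the result is unaffected. *)
    set (Y := lsum y K).
    assert (HY : 0 < Y).
    { apply Rlt_le_trans with (y j1); [assumption|]. apply lsum_ge_term; auto. }
    assert (HYi := Rinv_0_lt_compat _ HY).
    destruct (Hval (fun s => lsum (fun j => y j * cls j s) K * / Y)) as [nu [Hnu Hle]].
    { split.
      - intro D; split.
        + apply Rmult_le_pos; [|lra]. apply lsum_ge0; intros; apply Rmult_le_pos; [auto|apply cls_bounds].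
        + apply Rle_trans with (Y * / Y); [|right; field; lra].
          apply Rmult_le_compat_r; [lra|]. apply lsum_le; intros j _.
          pose proof (cls_bounds j D); pose proof (Hy0 j); nra.
      - intros E D HED; f_equal; apply lsum_ext; intros j _; f_equal.
        rewrite (cls_sym j E), (cls_sym j D), (cls_eq HED); reflexivity. }
    rewrite Hexp, !dot_combination in Hle.
    exists (vec nu); split; [apply in_map; assumption|]. unfold vec.
    rewrite (lsum_ext (g' := fun j => dot L nu (cls j) * y j + -1 * (dot K (pdist P) (cls j) * y j)))
      by (intros; ring).
    rewrite lsum_plus, lsum_scal. apply Rmult_le_reg_l in Hle; [lra|assumption].
  - destruct (Hfin nu HDnu) as [Hfnu Hnu1].
    assert (Hcls : forall E, In E K -> dot K (pdist P) (cls E) <= dot L nu (cls E))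
      by (intros E HE; specialize (Hu E HE); unfold vec in Hu; lra).
    exists nu; split; [assumption|split].
    + apply (coupling_full HmuK Hfnu Hmu1 Hcls).
    + assert (H := coupling_lift HK HL HmuK Hfnu Hmu1 Hnu1 Hcls).
      clear - H HKin; induction H as [E F [H1 H2]|p mus nus mu nu Hp _ IH Hm Hn].
      * constructor; rewrite <- HKin; auto.
      * eapply lift_comb; eauto.
Qed.

Lemma lift_impl (Rl Rl' : NE -> NE -> Prop) mu nu :
  (forall E F, Rl E F -> Rl' E F) -> lift Rl mu nu -> lift Rl' mu nu.
Proof. intro H; induction 1; [constructor; auto|eapply lift_comb; eauto]. Qed.

Lemma lift_flip (Rl : NE -> NE -> Prop) mu nu : lift Rl mu nu -> lift (fun E F => Rl F E) nu mu.
Proof. induction 1; [constructor; auto|eapply lift_comb; eauto]. Qed.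

Definition csim E F : Prop := closed E /\ closed F /\ fsim E F.

Definition states F : list NE := nodup eq_NE_dec (F :: der F).

Lemma states_moves F D a P : In D (states F) -> In (a, P) (moves D) -> incl (supp P) (states F).
Proof.
  unfold states; rewrite nodup_In; intros HD HP E HE; apply nodup_In; right.
  destruct (proj1 (der_moves Act) F) as [H1 H2].
  destruct HD as [<-|HD]; [apply (H1 a P HP E HE)|apply (H2 D a P HD HP E HE)].
Qed.

Lemma states_closed F D : closed F -> In D (states F) -> closed D.
Proof.
  intros HF HD; apply nodup_In in HD; destruct HD as [<-|HD]; [assumption|].
  apply (proj1 (der_closed Act) F 0%nat HF D HD).
Qed.

Lemma csim_lift E F a P nu : closed E -> closed F -> In (a, P) (moves E) ->
  lift (fun E' D => In E' (supp P) /\ In D (states F) /\ fsim E' D) (pdist P) nu ->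
  lift csim (pdist P) nu.
Proof.
  intros HE HF HP; apply lift_impl; intros E' D [H1 [H2 H3]]; split; [|split; [|assumption]].
  - apply (proj1 (der_closed Act) E 0%nat HE), (proj1 (proj1 (der_moves Act) E) a P HP), H1.
  - apply (states_closed HF H2).
Qed.

Lemma expect_le_V P f : inv f -> expect P f <= expect P (V f).
Proof. intro Hf; apply expect_mono; intro; apply tauv_ge, Hf. Qed.

(** The target of the step is worth at most [weakv a f E], hence at most [weakv a f F], which a
    finite set of weak runs attains; [lift_of_values] then gives a single run that also has full
    mass. *)
Lemma wtrans_match E F a mu : closed E -> closed F -> nstep E a mu ->
  (forall f, inv f -> weakv a f E <= weakv a f F) ->
  exists nu, wtrans tau (dirac F) a nu /\ lift csim mu nu.
Proof.
  intros HE HF Hstep Hle.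
  destruct (nstep_moves Hstep) as [P [HP ->]].
  assert (HL : NoDup (states F)) by apply NoDup_nodup.
  assert (HFin : In F (states F)) by (apply nodup_In; left; reflexivity).
  destruct (weak_attained tau HL (@states_moves F) a HFin) as [N [HN1 HN2]].
  destruct (@lift_of_values (states F) P (weak_run tau (states F) a F) N HL) as [nu [Hnu [Hm Hl]]].
  - intros; apply weak_run_mix; assumption.
  - intros nu [H [r [z [e [_ [_ [_ [[Hz _] Hle']]]]]]]]; split; [assumption|].
    assert (0 <= lsum z (states F)) by (apply lsum_ge0; auto). lra.
  - assumption.
  - intros f Hf; destruct (HN2 f (proj1 Hf)) as [nu [Hnu Hle']]; exists nu; split; [assumption|].
    eapply Rle_trans; [apply expect_le_V, Hf|].
    eapply Rle_trans; [apply (stepv_ge _ HP)|].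
    eapply Rle_trans; [apply stepv_le_weakv, Hf|].
    eapply Rle_trans; [apply Hle, Hf|exact Hle'].
  - exists nu; split; [apply (weak_run_wtrans Hnu Hm)|apply (csim_lift HE HF HP Hl)].
Qed.

Lemma wtau_match E F mu : closed E -> closed F -> nstep E tau mu -> fsim E F ->
  exists nu, wtau tau (dirac F) nu /\ lift csim mu nu.
Proof.
  intros HE HF Hstep Hsim.
  destruct (nstep_moves Hstep) as [P [HP ->]].
  assert (HL : NoDup (states F)) by apply NoDup_nodup.
  assert (HFin : In F (states F)) by (apply nodup_In; left; reflexivity).
  destruct (V_attained tau HL (@states_moves F) HFin) as [N [HN1 HN2]].
  destruct (@lift_of_values (states F) P (run tau (states F) (dirac F)) N HL) as [nu [Hnu [Hm Hl]]].
  - intros p nu nu' Hp H1 H2; rewrite <- (mix2_same p (dirac F)); apply run_mix; assumption.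
  - intros nu [_ H]; exact H.
  - assumption.
  - intros f Hf; destruct (HN2 f (proj1 Hf)) as [nu [Hnu Hle']]; exists nu; split; [assumption|].
    eapply Rle_trans; [apply expect_le_V, Hf|].
    eapply Rle_trans; [apply (stepv_ge _ HP)|].
    eapply Rle_trans; [apply V_super, Hf|].
    rewrite (fsim_inv Hsim (inv_V Hf)); exact Hle'.
  - exists nu; split; [apply Hnu|apply (csim_lift HE HF HP Hl)].
Qed.

Lemma whtrans_match E F a mu : csim E F -> nstep E a mu ->
  exists nu, whtrans tau (dirac F) a nu /\ lift csim mu nu.
Proof.
  intros [HE [HF Hsim]] Hstep; unfold whtrans.
  destruct (excluded_middle_informative (a = tau)) as [->|Ha].
  - destruct (wtau_match HE HF Hstep Hsim) as [nu [H1 H2]]; exists nu; auto.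
  - destruct (@wtrans_match E F a mu) as [nu [H1 H2]]; auto; [|exists nu; auto].
    intros f Hf; rewrite (fsim_inv Hsim (inv_weakv Ha Hf)); lra.
Qed.

Lemma csim_sym E F : csim E F -> csim F E.
Proof. intros [H1 [H2 H3]]; split; [|split]; auto using fsim_sym. Qed.

Lemma lift_csim_sym mu nu : lift csim mu nu -> lift csim nu mu.
Proof. intro H; apply (lift_impl (Rl := fun E F => csim F E)); [|apply lift_flip, H].
  intros E F; apply csim_sym. Qed.

Lemma csim_weak_bisim : weak_bisim tau csim.
Proof.
  intros E F H; split; [apply H|split; [apply H|split]]; intros a mu Hstep.
  - apply (whtrans_match H Hstep).
  - destruct (whtrans_match (csim_sym H) Hstep) as [nu [H1 H2]].
    exists nu; split; [assumption|apply lift_csim_sym; assumption].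
Qed.

Lemma csim_wbisimilar E F : csim E F -> wbisimilar tau E F.
Proof. intro H; exists csim; split; [apply csim_weak_bisim|assumption]. Qed.

Lemma feq_wcong_closed E F : closed E -> closed F -> feq E F -> wcong_closed tau E F.
Proof.
  intros HE HF H; split; intros a mu Hstep.
  - destruct (wtrans_match HE HF Hstep) as [nu [H1 H2]].
    + intros f Hf; rewrite (H f a Hf); lra.
    + exists nu; split; [assumption|apply (lift_impl csim_wbisimilar H2)].
  - destruct (wtrans_match HF HE Hstep) as [nu [H1 H2]].
    + intros f Hf; rewrite (H f a Hf); lra.
    + exists nu; split; [assumption|]. apply (lift_impl csim_wbisimilar), lift_csim_sym, H2.
Qed.

End Adequacy.

Theorem mainTheorem1 (Act : Type) (tau : Act) (E F : NE Act) :
  eqN tau E F -> wcong tau E F.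
Proof.
  intros H s Hs; apply feq_wcong_closed.
  - apply closed_substN, Hs.
  - apply closed_substN, Hs.
  - apply (proj1 (eqN_feq tau) E F H).
Qed.
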